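(* With $t$, $S_i$, $W_i$ and $t_\varnothing$ as defined in the context, for $k\ge1$ and $u=(x_1,y_1)\cdots(x_k,y_k)y_{k+1}\cdots y_{k+j}\in\mathrm{Pref}_{k,j}(\Omega)$ define $$ \mu([u])=\frac{t_{(x_1,y_1)y_2\cdots y_{j+1}}\left(\sum_{x'_1}t_{(x'_1,y_1)y_2\cdots y_{j+1}}\right)^{q^j\gamma-1}}{t_\varnothing}\cdot\prod_{p=0}^{j-1}W_{j-p}(y_1\cdots y_{j-p})^{\frac{1-q}{q}}\cdot\prod_{p=2}^{k}\frac{t_{(x_1,y_1)\cdots(x_p,y_p)y_{p+1}\cdots y_{p+j}}\left(\sum_{x'_p}t_{(x_1,y_1)\cdots(x_{p-1},y_{p-1})(x'_p,y_p)y_{p+1}\cdots y_{p+j}}\right)^{q^j\gamma-1}}{t_{(x_1,y_1)\cdots(x_{p-1},y_{p-1})y_p\cdots y_{p-1+j}}^{q^{j+1}\gamma}} . $$ This defines a Borel probability measure $\mu$ on $\Omega$ such that $\mathbb{P}_\mu$ is the unique optimal measure, i.e. $\mu$ is the unique Borel probability measure on $\Omega$ for which $\dim_H(\mathbb{P}_\mu)$ is maximal over all Borel probability measures on $\Omega$. Moreover $\dim_H(\mathbb{P}_\mu)=\frac{q-1}{q}\log_{m_2}(t_\varnothing)$, and consequently $$\dim_H(X_\Omega)\ge\frac{q-1}{q}\log_{m_2}(t_\varnothing).$$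
   Context: Setting. Let $q\ge 2$ and $m_1>m_2\ge 2$ be integers, $\mathcal{A}_i=\{0,\dots,m_i-1\}$, $\mathbb{N}^*=\{1,2,\dots\}$, $\Sigma_{m_1,m_2}=(\mathcal{A}_1\times\mathcal{A}_2)^{\mathbb{N}^*}$, with elements $(x,y)=(x_k,y_k)_{k\ge1}$. Put $\gamma=\log(m_2)/\log(m_1)$, $L(n)=\lceil n/\gamma\rceil$, and let $j$ be the unique non-negative integer with $q^j\le 1/\gamma<q^{j+1}$. Metric: $d((x,y),(u,v))=\max\left(m_1^{-\min\{k\ge0:(x_{k+1},y_{k+1})\ne(u_{k+1},v_{k+1})\}},\ m_1^{-\gamma\min\{k\ge0:y_{k+1}\ne v_{k+1}\}}\right)$ (with $m_1^{-\infty}=0$); the closed ball of radius $m_1^{-n}$ is $B_n(x,y)=\{(u,v): u_k=x_k\ \forall k\le n,\ v_k=y_k\ \forall k\le L(n)\}$. All Hausdorff dimensions are with respect to $d$; for a Borel probability measure $\nu$, $\dim_H(\nu)=\inf\{\dim_H(A):A\text{ Borel},\nu(A)>0\}$ (all the measures $\mathbb{P}_\mu$ below are exact dimensional: $-\frac1n\log_{m_1}\mathbb{P}_\mu(B_n(x,y))\to\dim_H(\mathbb{P}_\mu)$ for $\mathbb{P}_\mu$-a.e. $(x,y)$). Let $\Omega\subset\Sigma_{m_1,m_2}$ be nonempty and closed (product topology), and $X_\Omega=\{(x_k,y_k)_{k\ge1}:(x_{iq^\ell},y_{iq^\ell})_{\ell\ge0}\in\Omega\ \forall i\ge1,\ q\nmid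 i\}$. For a Borel probability measure $\mu$ on $\Omega$, $\mathbb{P}_\mu$ is the unique Borel probability measure on $\Sigma_{m_1,m_2}$ (supported on $X_\Omega$) with $\mathbb{P}_\mu([(x_1,y_1)\cdots(x_n,y_n)])=\prod_{i\le n,\ q\nmid i}\mu([(x_i,y_i)(x_{qi},y_{qi})\cdots(x_{q^ri},y_{q^ri})])$, $r$ being given by $q^ri\le n<q^{r+1}i$. Prefixes. For $u=(x_1,y_1)\cdots(x_p,y_p)y_{p+1}\cdots y_{p+\ell}$, the generalized cylinder $[u]$ is the set of sequences of $\Sigma_{m_1,m_2}$ whose first $p$ letters are $(x_1,y_1),\dots,(x_p,y_p)$ and whose second coordinates at positions $p+1,\dots,p+\ell$ are $y_{p+1},\dots,y_{p+\ell}$; $\mathrm{Pref}_{p,\ell}(\Omega)$ is the set of such $u$ with $\Omega\cap[u]\ne\varnothing$. The vector $t$. For $k\ge1$, a follower of $v=(x_1,y_1)\cdots(x_k,y_k)y_{k+1}\cdots y_{k+j}\in\mathrm{Pref}_{k,j}(\Omega)$ is any $w\in\mathrm{Pref}_{k+1,j}(\Omega)$ of the form $w=(x_1,y_1)\cdots(x_k,y_k)(x_{k+1},y_{k+1})y_{k+2}\cdots y_{k+j+1}$ (for $j\ge1$ the letters $y_{k+1},\dots,y_{k+j}$ are those of $v$ and $x_{k+1},y_{k+j+1}$ are new; for $j=0$ both $x_{k+1},y_{k+1}$ are new). For each $u\in\mathrm{Pref}_{1,j}(\Omega)$ let $V_{u,j}(\Omega)$ be the set consisting of $u$ and all its iterated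 followers. There is a unique family $t\in[1,m_2^{2/(\gamma(q-1))}]^{V_{u,j}(\Omega)}$ such that for all $v=(x_1,y_1)\cdots(x_k,y_k)y_{k+1}\cdots y_{k+j}\in V_{u,j}(\Omega)$, $$t_v^{q^{j+1}\gamma}=\sum_{y'_{k+j+1}}\Big(\sum_{x'_{k+1}}t_{(x_1,y_1)\cdots(x_k,y_k)(x'_{k+1},y_{k+1})y_{k+2}\cdots y_{k+j}y'_{k+j+1}}\Big)^{q^j\gamma},$$ the sums being over the followers of $v$ (for $j=0$, $y_{k+1}$ is replaced by $y'_{k+1}$). Taking all $u\in\mathrm{Pref}_{1,j}(\Omega)$ this defines $t_v$ for every $v\in\bigcup_{k\ge1}\mathrm{Pref}_{k,j}(\Omega)$. Nested sums. All sums run over letters for which the resulting words are prefixes of $\Omega$. Set $S_{j+1}(y_1\cdots y_{j+1})=\big(\sum_{x'_1}t_{(x'_1,y_1)y_2\cdots y_{j+1}}\big)^{q^j\gamma}$ and, for $i=j,j-1,\dots,1$, $W_i(y_1\cdots y_i)=\sum_{y'_{i+1}}S_{i+1}(y_1\cdots y_iy'_{i+1})$ and $S_i(y_1\cdots y_i)=W_i(y_1\cdots y_i)^{1/q}$. Finally $t_\varnothing=\sum_{y'_1}S_1(y'_1)$, i.e. $t_\varnothing=\sum_{y'_1}(\sum_{y'_2}(\cdots(\sum_{y'_{j+1}}(\sum_{x'_1}t_{(x'_1,y'_1)y'_2\cdots y'_{j+1}})^{q^j\gamma})^{1/q}\cdots)^{1/q})^{1/q}$. *)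

(* Defs.v *)
From HB Require Import structures.
From mathcomp Require Import all_boot all_order all_algebra.
From mathcomp Require Import all_classical all_reals all_analysis.

Set Implicit Arguments.
Unset Strict Implicit.
Unset Printing Implicit Defensive.

Import Order.TTheory GRing.Theory Num.Theory.
Import numFieldNormedType.Exports.

Local Open Scope classical_set_scope.
Local Open Scope ring_scope.

Section Hausdorff.
Context (R : realType) (T : Type) (dist : T -> T -> R).

Definition diam (A : set T) : \bar R :=
  ereal_sup [set (dist p.1 p.2)%:E | p in A `*` A].

(* Contribution of a covering set to the sums defining the s-dimensional
   measure: diam(A)^s, where the empty set contributes 0 and, for s = 0,
   every nonempty set contributes 1. *)
Definition gauge (s : R) (A : set T) : \bar R :=
  if `[< A = set0 >] then 0%E else (diam A `^ s)%E.

Definition hausdorff_premeasure (s delta : R) (A : set T) : \bar R :=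
  ereal_inf [set (\sum_(0 <= i <oo) gauge s (U i))%E | U in
    [set U : nat -> set T | A `<=` \bigcup_i U i /\
                            forall i, (diam (U i) <= delta%:E)%E]].

Definition hausdorff_measure (s : R) (A : set T) : \bar R :=
  ereal_sup [set hausdorff_premeasure s delta A | delta in
    [set delta : R | 0 < delta]].

Definition hausdorff_dim (A : set T) : \bar R :=
  ereal_inf [set s%:E | s in
    [set s : R | 0 <= s /\ hausdorff_measure s A = 0%E]].

End Hausdorff.

HB.instance Definition _ (n : nat) := isPointed.Build 'I_n.+1 ord0.

(* The alphabet {0, ..., m - 1}. Its size is written m.-1.+1, which is m as
   soon as 0 < m, so that the type is inhabited, as measurable types must be. *)
Notation letter m := ('I_(m.-1.+1)).

(* The sequences (x_k, y_k), k >= 1, with the product topology. They are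
   stored from index 0: the k-th letter of s is s k.-1. *)
Definition Sigma (m1 m2 : nat) : Type :=
  prod_topology (fun _ : nat => discrete_topology (letter m1 * letter m2)%type).

HB.instance Definition _ (m1 m2 : nat) := Pointed.on (Sigma m1 m2).
HB.instance Definition _ (m1 m2 : nat) := Topological.on (Sigma m1 m2).

Notation borel_Sigma m1 m2 := (g_sigma_algebraType (@open (Sigma m1 m2))).

(* The word (x_1,y_1)...(x_p,y_p) y_(p+1)...y_(p+l) is the pair of the
   sequences (x_1,y_1)...(x_p,y_p) and y_(p+1)...y_(p+l). *)
Definition word (m1 m2 : nat) : Type :=
  (seq (letter m1 * letter m2) * seq (letter m2))%type.

Section Prefixes.
Context (m1 m2 : nat).
Implicit Types (s : Sigma m1 m2) (u v w : word m1 m2).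

Definition cylinder u : set (Sigma m1 m2) :=
  [set s | mkseq s (size u.1) = u.1 /\
           mkseq (fun k => (s (size u.1 + k)%N).2) (size u.2) = u.2].

Context (Omega : set (Sigma m1 m2)).

Definition is_prefix u : bool := `[< Omega `&` cylinder u !=set0 >].

Definition Pref (p l : nat) : set (word m1 m2) :=
  [set u | [/\ size u.1 = p, size u.2 = l & is_prefix u]].

(* With v = (x_1,y_1)...(x_k,y_k) y_(k+1)...y_(k+j), the letters y', y and z
   are y_(k+j+1), y_(k+1) and y_(k+2)...y_(k+j+1); for j = 0, y' = y. *)
Definition follower v w : Prop :=
  exists x y' y z,
    [/\ rcons v.2 y' = y :: z, w = (rcons v.1 (x, y), z) & is_prefix w].

Inductive descendant u : word m1 m2 -> Prop :=
| descendant_refl : descendant u u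
| descendant_follower v w :
    descendant u v -> follower v w -> descendant u w.

End Prefixes.

Section Metric.
Context (R : realType) (m1 m2 : nat).

Definition gamma : R := ln m2%:R / ln m1%:R.

(* m1 ^ (- c * min {k | P k}), which is 0 if there is no such k. *)
Definition decay (c : R) (P : pred nat) : R :=
  if pselect (exists k, P k) is left exP
  then m1%:R `^ (- (c * (ex_minn exP)%:R)) else 0.

Definition dist (s s' : Sigma m1 m2) : R :=
  Num.max (decay 1 [pred k | s k != s' k])
          (decay gamma [pred k | (s k).2 != (s' k).2]).

Definition dim_set : set (Sigma m1 m2) -> \bar R := hausdorff_dim dist.

Definition dim_measure (nu : probability (borel_Sigma m1 m2) R) : \bar R :=
  ereal_inf [set dim_set A | A in
    [set A : set (borel_Sigma m1 m2) | measurable A /\ (0 < nu A)%E]].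

End Metric.

Section Multiplicative.
Context (R : realType) (q m1 m2 : nat) (Omega : set (Sigma m1 m2)).
Implicit Types (mu nu P : probability (borel_Sigma m1 m2) R).

(* The sequence (x_(i q^l), y_(i q^l)), l >= 0. *)
Definition fiber (s : Sigma m1 m2) (i : nat) : Sigma m1 m2 :=
  fun l => s (i * q ^ l).-1.

Definition X_Omega : set (Sigma m1 m2) :=
  [set s | forall i, (0 < i)%N -> ~~ (q %| i)%N -> Omega (fiber s i)].

(* The first n letters of s. *)
Definition initial (s : Sigma m1 m2) (n : nat) : word m1 m2 :=
  (mkseq s n, [::]).

(* Here r = trunc_log q (n %/ i) is such that q^r i <= n < q^(r+1) i. *)
Definition is_P mu P : Prop :=
  forall (s : Sigma m1 m2) (n : nat),
    P (cylinder (initial s n)) =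
    (\prod_(1 <= i < n.+1 | ~~ (q %| i)%N)
       fine (mu (cylinder
         (initial (fiber s i) (trunc_log q (n %/ i)).+1))))%:E.

(* There is exactly one such measure; the default value mu is irrelevant. *)
Definition P_ mu : probability (borel_Sigma m1 m2) R := xget mu (is_P mu).

Definition supported_on mu : Prop := mu Omega = 1%E.

Definition same_measure mu nu : Prop :=
  forall A : set (borel_Sigma m1 m2), measurable A -> mu A = nu A.

Definition optimal mu : Prop :=
  supported_on mu /\
  forall nu, supported_on nu -> (dim_measure (P_ nu) <= dim_measure (P_ mu))%E.

End Multiplicative.

Section OptimalMeasure.
Context (R : realType) (q m1 m2 j : nat) (Omega : set (Sigma m1 m2)).
Context (t : word m1 m2 -> R).
Local Notation gamma := (gamma R m1 m2).
Local Notation is_prefix := (is_prefix Omega).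

(* The sum over x_(k+1) of t_((x_1,y_1)...(x_(k+1),y_(k+1)) y_(k+2)...), where
   w = (x_1,y_1)...(x_k,y_k) and ys = y_(k+1) y_(k+2)... *)
Definition sum_x (w : seq (letter m1 * letter m2)) (ys : seq (letter m2)) : R :=
  if ys is y :: z then
    \sum_(x : letter m1 | is_prefix (rcons w (x, y), z)) t (rcons w (x, y), z)
  else 0.

Definition is_t : Prop :=
  forall u, Pref Omega 1 j u -> forall v, descendant Omega u v ->
    1 <= t v <= m2%:R `^ (2 / (gamma * (q%:R - 1))) /\
    t v `^ (q%:R ^+ j.+1 * gamma) =
      \sum_(y : letter m2 | is_prefix (v.1, rcons v.2 y))
        sum_x v.1 (rcons v.2 y) `^ (q%:R ^+ j * gamma).

Definition sum_y (S : seq (letter m2) -> R) (ys : seq (letter m2)) : R :=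
  \sum_(y : letter m2 | is_prefix ([::], rcons ys y)) S (rcons ys y).

(* S_(j+1) is the innermost sum, and S_i is obtained from it by j + 1 - i
   times summing over the last letter and raising to the power 1/q. *)
Definition S_ (i : nat) : seq (letter m2) -> R :=
  iter (j.+1 - i) (fun S ys => sum_y S ys `^ q%:R^-1)
    (fun ys => sum_x [::] ys `^ (q%:R ^+ j * gamma)).

Definition W_ (i : nat) : seq (letter m2) -> R := sum_y (S_ i.+1).

Lemma S_W (i : nat) (ys : seq (letter m2)) :
  (i <= j)%N -> S_ i ys = W_ i ys `^ q%:R^-1.
Proof. by move=> ij; rewrite /W_ /S_ subSS subSn. Qed.

Definition t_empty : R := sum_y (S_ 1) [::].

Definition cylinder_mass (u : word m1 m2) : R :=
  let k := size u.1 in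
  let ys := map snd u.1 ++ u.2 in
  (* (x_1,y_1)...(x_p,y_p) y_(p+1)...y_(p+j) *)
  let sub p : word m1 m2 := (take p u.1, take j (drop p ys)) in
  (* the sum over x'_p of t at the words obtained from sub p by replacing
     x_p with x'_p, raised to the power q^j gamma - 1 *)
  let X p :=
    sum_x (take p.-1 u.1) (take j.+1 (drop p.-1 ys))
      `^ (q%:R ^+ j * gamma - 1) in
  t (sub 1) * X 1 / t_empty *
  (\prod_(0 <= p < j) W_ (j - p) (take (j - p) ys) `^ ((1 - q%:R) / q%:R)) *
  \prod_(2 <= p < k.+1)
     (t (sub p) * X p / t (sub p.-1) `^ (q%:R ^+ j.+1 * gamma)).

Definition has_cylinder_masses (mu : probability (borel_Sigma m1 m2) R) : Prop :=
  forall k u, (1 <= k)%N -> Pref Omega k j u ->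
    mu (cylinder u) = (cylinder_mass u)%:E.

End OptimalMeasure.

(* Main.v *)
From HB Require Import structures.
Require Import Defs.
From mathcomp Require Import all_boot all_order all_algebra.
From mathcomp Require Import all_classical all_reals all_analysis.
From mathcomp Require Import ring lra zify.

Set Implicit Arguments.
Unset Strict Implicit.
Unset Printing Implicit Defensive.

Import Order.TTheory GRing.Theory Num.Theory.
Import numFieldNormedType.Exports.

Local Open Scope classical_set_scope.
Local Open Scope ring_scope.

(* The mass for P_nu of a ball is a product over the chains i, qi, q^2 i, ... of
   masses for nu of generalized cylinders that fix p letters x and p' letters y,
   where p' - p is j or j + 1 unless p = 0.  The equations for t make the
   prescribed masses additive when letters are revealed in the order
   y_1, ..., y_(j+1), x_1, y_(j+2), x_2, ..., which gives mu.  The logarithm of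
   the mass of such a cylinder for mu is then a sum of one term per letter; summed
   over all chains, the expectations of these terms under any nu cancel between
   scales, except for kap * n + o(n), where kap = (1 - 1/q) ln t_empty / gamma.
   By Gibbs' inequality the entropy of the balls of level n for P_nu is thus at
   most kap * n + o(n), with a linear gain if nu differs from mu.  Covering by the
   balls that are not too light bounds dim_H (P_nu) by the growth rate of the
   entropy.  For nu = mu an exponential moment bound shows that, for lam < kap,
   the points whose ball of level n has mass more than exp (- lam n) have
   exponentially small probability, so sets of positive measure have dimension at
   least kap / ln m1. *)

(** * Cylinders *)

(** The exponents in the equations for t come from counting. About N (q - 1) / q^(k+1) chains have
    more than k points up to N, so a shift by one along the chains divides a weight by q, and
    passing from n to L(n) multiplies it by 1 / gamma. In the logarithm of the mass of a ball, t at
    index r occurs once with the x-letters, with weight q^-r, and once as a denominator at index r +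
    j + 1 of the y-letters up to L(n), with weight q^-(r+j+1) / gamma and coefficient q^(j+1) gamma:
    these cancel. The sums over x cancel in the same way through q^j gamma and a shift by j, and the
    powers 1/q do the same for the first j nested sums. Only the normalization of the first y-letter
    survives. Since only positions on the chains enter, the cancellation persists under the
    expectation for any nu. The two bounds need different strengths. The upper one needs heavy balls
    with probability bounded below at all large levels, which an expectation provides. The lower one
    needs summable probabilities, hence an exponential moment; as logarithms of masses grow with the
    length of a chain, this relies on the squared lengths of the chains having a linear sum. *)

Section TupleSums.
Context (R : nmodType) (A : finType).
Implicit Types F : seq A -> R.

Lemma big_tuple0 F : \sum_(w : 0.-tuple A) F w = F [::].
Proof.
rewrite (eq_bigr (fun _ => F [::])) => [|w _]; last by rewrite tuple0.
by rewrite big_const card_tuple expn0 /= addr0.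
Qed.

Lemma big_tuple_rcons n F :
  \sum_(w : n.+1.-tuple A) F w = \sum_(w : n.-tuple A) \sum_c F (rcons w c).
Proof.
rewrite pair_big /=.
rewrite (reindex (fun u : n.-tuple A * A => [tuple of rcons u.1 u.2])) //=.
exists (fun w => ([tuple of belast (thead w) (behead w)],
                  last (thead w) (behead w))) => [[w c] _|w _] /=.
  have E : rcons w c = thead [tuple of rcons w c] :: behead (rcons w c).
    exact: (congr1 val (tuple_eta [tuple of rcons w c])).
  have := lastI (thead [tuple of rcons w c]) (behead (rcons w c)).
  rewrite -E => /rcons_inj [E1 E2].
  by congr (_, _); [apply/val_inj; rewrite /= -E1 | rewrite -E2].
by apply/val_inj; rewrite /= -lastI {3}(tuple_eta w).
Qed.

End TupleSums.

Section Cylinders.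
Context (m1 m2 : nat).
Local Notation A := (letter m1 * letter m2)%type.
Local Notation Sigma := (Sigma m1 m2).
Implicit Types (s : Sigma) (E : set Sigma) (w : seq A).

(** Padding turns a word into a point, so that functions of sequences can be summed over words; the
    default letters do not affect functions of the first [size w] letters. *)
Definition ext w : Sigma := fun k => nth (ord0, ord0) w k.

Definition agree n s s' := forall k, (k < n)%N -> s k = s' k.

Lemma agree_mkseq n s s' : agree n s s' <-> mkseq s n = mkseq s' n :> seq A.
Proof.
split=> [h|h k kn]; first by apply/eq_in_map => k; rewrite mem_iota => /h.
by have := congr1 (fun w => nth (ord0, ord0) w k) h; rewrite !nth_mkseq.
Qed.

Lemma mkseq_ext w : mkseq (ext w) (size w) = w.
Proof. exact: mkseq_nth. Qed.

Lemma agree_ext s n : agree n (ext (mkseq s n)) s.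
Proof. by move=> k kn; rewrite /ext nth_mkseq. Qed.

Lemma agree_sym n s s' : agree n s s' -> agree n s' s.
Proof. by move=> h k kn; rewrite h. Qed.

Lemma agree_le n n' s s' : (n' <= n)%N -> agree n s s' -> agree n' s s'.
Proof. by move=> le h k kn; apply: h; apply: leq_trans le. Qed.

Lemma open_agree n s : open [set s' | agree n s' s].
Proof.
elim: n => [|n IH].
  rewrite (_ : [set _ | _] = setT); first exact: openT.
  by apply/seteqP; split.
rewrite (_ : [set _ | _] =
  [set s' | agree n s' s] `&` (proj n @^-1` [set s n] : set Sigma)).
  apply: openI => //; apply: open_comp => [s' _|]; first exact: proj_continuous.
  exact: discrete_open.
apply/seteqP; split=> [s' h|s' [h1 h2] k] /=.
  by split=> [k kn|]; [apply: h; rewrite ltnS ltnW|apply: h].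
by rewrite ltnS leq_eqVlt => /orP[/eqP->|/h1].
Qed.

(** A set determined by finitely many letters is a union of cylinders. [measurable_dep] makes this
    the measurability criterion for most events below. *)
Lemma open_dep n E :
  (forall s s', agree n s s' -> E s -> E s') -> open E.
Proof.
move=> h; rewrite (_ : E = \bigcup_(s in E) [set s' | agree n s' s]).
  by apply: bigcup_open => s _; exact: open_agree.
apply/seteqP; split=> [s Es|s [s' Es' /agree_sym /h]]; first by exists s.
exact.
Qed.

Lemma cylinderP u s : cylinder u s <->
  mkseq s (size u.1) = u.1 /\
  forall k, (k < size u.2)%N -> (s (size u.1 + k)%N).2 = nth ord0 u.2 k.
Proof.
rewrite /cylinder /=; split=> -[h1 h2]; split => //.
  by move=> k ku; rewrite -h2 nth_mkseq.
apply: (@eq_from_nth _ ord0); rewrite size_mkseq // => k ku.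
by rewrite nth_mkseq // h2.
Qed.

Lemma open_cylinder u : open (cylinder u : set Sigma).
Proof.
apply: (@open_dep (size u.1 + size u.2)) => s s' h [h1 h2]; split.
  rewrite -[RHS]h1; apply/eq_in_map => k.
  by rewrite mem_iota => /= ku; rewrite h // ltn_addr.
rewrite -[RHS]h2; apply/eq_in_map => k; rewrite mem_iota => /= ku.
by rewrite h // ltn_add2l.
Qed.

(** Otherwise points outside [E], chosen in the cylinders of every length around [s], would converge
    to [s] letter by letter, and the open set [E] would contain some of them. *)
Lemma open_basis E s : open E -> E s -> exists n, [set s' | agree n s' s] `<=` E.
Proof.
move=> oE Es; apply/not_existsP => h.
have {}h n : {s' | agree n s' s /\ ~ E s'}.
  apply: cid; have /existsNP[s' /not_implyP[h1 h2]] := h n.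
  by exists s'.
have : (fun n => sval (h n)) @ \oo --> s.
  apply/cvg_sup => i U [V] [[W] oW <-] Wsi VU.
  exists i.+1 => // n /= ni; apply: VU => /=.
  by have [/(_ i ni) + _] := svalP (h n); rewrite /proj => ->.
move=> /(_ E) []; first by rewrite nbhsE; exists E.
by move=> n _ /(_ n (leqnn n)) /=; case: (svalP (h n)).
Qed.

Lemma measurable_cylinder u :
  measurable (cylinder u : set (borel_Sigma m1 m2)).
Proof. by apply: sub_sigma_algebra; exact: open_cylinder. Qed.

Lemma measurable_dep n E : (forall s s', agree n s s' -> E s -> E s') ->
  measurable (E : set (borel_Sigma m1 m2)).
Proof. by move=> h; apply: sub_sigma_algebra; exact: open_dep h. Qed.

Lemma cylinder_nil : cylinder ([::], [::]) = setT :> set Sigma.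
Proof. by apply/seteqP; split. Qed.

Lemma cylinder_agree w s : cylinder (w, [::]) s <-> mkseq s (size w) = w.
Proof. by split=> [[]|]. Qed.

End Cylinders.

Section FiniteAdditivity.
Context (d : measure_display) (T : measurableType d) (R : realType).
Context (P : probability T R).

Lemma fine_probability E : measurable E -> P E = (fine (P E))%:E.
Proof. by move=> mE; rewrite fineK // fin_num_measure. Qed.

Lemma fine_probability_ge0 E : 0 <= fine (P E).
Proof. by rewrite fine_ge0. Qed.

Lemma fine_probability_fiber (I : finType) (f : T -> I) E : measurable E ->
  (forall i, measurable (f @^-1` [set i])) ->
  fine (P E) = \sum_i fine (P (E `&` f @^-1` [set i])).
Proof.
move=> mE mf.
have mI i : measurable (E `&` f @^-1` [set i]) by exact: measurableI.
have -> : P E = (\sum_i P (E `&` f @^-1` [set i]))%E.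
  rewrite {1}(_ : E = \bigcup_i (E `&` f @^-1` [set i])).
    rewrite measure_fin_bigcup //; first last.
    - by move=> i k _ _ [x [[_ <-] [_ <-]]].
    - exact: finite_finset.
    rewrite (fsbig_seq _ _ (index_enum_uniq I)) (_ : [set` _] = setT) //.
    by apply/seteqP; split=> // i _; rewrite /= mem_index_enum.
  by apply/seteqP; split=> [x Ex|x [i _ []]] //; exists (f x).
rewrite (eq_bigr (fun i => (fine (P (E `&` f @^-1` [set i])))%:E)).
  by rewrite sumEFin.
by move=> i _; exact: fine_probability.
Qed.

End FiniteAdditivity.

Section CylinderMass.
Context (m1 m2 : nat) (R : realType).
Local Notation A := (letter m1 * letter m2)%type.
Local Notation Sigma := (Sigma m1 m2).
Local Notation proba := (probability (borel_Sigma m1 m2) R).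
Implicit Types (s : Sigma) (w v : seq A) (P Q : proba) (u : word m1 m2).

Definition mass P u : R := fine (P (cylinder u)).

Lemma massE P u : P (cylinder u) = (mass P u)%:E.
Proof. by apply: fine_probability; exact: measurable_cylinder. Qed.

Lemma mass_ge0 P u : 0 <= mass P u.
Proof. exact: fine_probability_ge0. Qed.

Lemma mass_nil P : mass P ([::], [::]) = 1.
Proof. by rewrite /mass cylinder_nil probability_setT. Qed.

Lemma mass_tuple P N E : measurable (E : set (borel_Sigma m1 m2)) ->
  fine (P E) = \sum_(w : N.-tuple A) fine (P (E `&` cylinder (val w, [::]))).
Proof.
move=> mE; rewrite (@fine_probability_fiber _ _ _ _ _
  (fun s : borel_Sigma m1 m2 => [tuple of mkseq s N])) //.
  apply: eq_bigr => w _; congr (fine (P (_ `&` _))).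
  apply/seteqP; split=> s /=.
    by move/(congr1 val) => /= <-; rewrite cylinder_agree size_mkseq.
  by rewrite cylinder_agree size_tuple => h; apply/val_inj.
move=> w; apply: (@measurable_dep _ _ N) => s s' /agree_mkseq h /= <-.
by apply/val_inj; rewrite /= h.
Qed.

Lemma mass_tuple_pred P N (Q : seq A -> bool) :
  fine (P [set s | Q (mkseq s N)]) =
  \sum_(w : N.-tuple A) (Q w)%:R * mass P (val w, [::]).
Proof.
rewrite (mass_tuple _ N).
  apply: eq_bigr => w _.
  have [Qw|Qw] := boolP (Q w).
    rewrite mul1r; congr (fine (P _)); apply/seteqP; split=> [s []//|s h].
    by split=> //; move: h => /cylinder_agree /=; rewrite size_tuple => ->.
  rewrite mul0r (_ : _ `&` _ = set0) ?measure0 //.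
  apply/seteqP; split=> // s [/= Qs /cylinder_agree /=].
  by rewrite size_tuple => E; rewrite -E Qs in Qw.
by apply: (@measurable_dep _ _ N) => s s' /agree_mkseq h /=; rewrite h.
Qed.

Lemma sum_mass P N : \sum_(w : N.-tuple A) mass P (val w, [::]) = 1.
Proof.
rewrite -[RHS](_ : fine (P setT) = 1); last by rewrite probability_setT.
rewrite (mass_tuple _ N measurableT); apply: eq_bigr => w _.
by rewrite setTI.
Qed.

(** One step of revealing: the first incomplete position lacks only its x-letter when [z] is
    nonempty, and the whole letter otherwise. *)
Lemma mass_letter P w z : mass P (w, z) =
  if z is y :: z' then \sum_x mass P (rcons w (x, y), z')
  else \sum_c mass P (rcons w c, [::]).
Proof.
case: z => [|y z].
  rewrite /mass (@fine_probability_fiber _ _ _ _ A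
    (fun s : borel_Sigma m1 m2 => s (size w))).
  - apply: eq_bigr => c _; congr (fine (P _)).
    apply/seteqP; split=> s /=.
      move=> [/cylinder_agree h1 h2]; apply/cylinder_agree.
      by rewrite size_rcons mkseqS h1 h2.
    move=> /cylinder_agree; rewrite size_rcons mkseqS => /rcons_inj [h1 h2].
    by split=> //; apply/cylinder_agree.
  - exact: measurable_cylinder.
  - move=> c; apply: (@measurable_dep _ _ (size w).+1) => s s' h /= <-.
    by rewrite h.
rewrite /mass (@fine_probability_fiber _ _ _ _ _
    (fun s : borel_Sigma m1 m2 => (s (size w)).1)).
- apply: eq_bigr => x _; congr (fine (P _)).
  apply/seteqP; split=> s /=.
    move=> [/cylinderP /= [h1 h2] h3]; apply/cylinderP.
    rewrite /= size_rcons mkseqS h1; split.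
      have := h2 0%N erefl; rewrite addn0 /= => h4.
      by rewrite -h3 -h4 -surjective_pairing.
    by move=> k kz; rewrite addSnnS h2.
  move=> /cylinderP /= []; rewrite size_rcons mkseqS => /rcons_inj [h1 h2] h3.
  split; last by rewrite h2.
  apply/cylinderP; split=> //= -[|k] kz; first by rewrite addn0 h2.
  by rewrite -addSnnS h3.
- exact: measurable_cylinder.
- move=> c; apply: (@measurable_dep _ _ (size w).+1) => s s' h /= <-.
  by rewrite h.
Qed.

(** The position behind [z] is reached by revealing the x-letters under [z] one at a time; these
    sums commute with the sum over the new [y]. *)
Lemma mass_letter_snd P w z : mass P (w, z) = \sum_y mass P (w, rcons z y).
Proof.
elim: z w => [|y z IH] w.
  rewrite mass_letter (eq_bigr (fun c => mass P (rcons w (c.1, c.2), [::]))).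
    rewrite -(pair_bigA _ (fun x y => mass P (rcons w (x, y), [::]))) /=.
    rewrite exchange_big; apply: eq_bigr => y _ /=.
    by rewrite mass_letter.
  by case.
rewrite mass_letter (eq_bigr _ (fun x _ => IH _)) exchange_big.
by apply: eq_bigr => y' _; rewrite [RHS]mass_letter.
Qed.

(* The ball of radius m1^-p around a point with initial word v is the cylinder
   of this word, when v has L(p) letters. *)
Definition ball_word p v : word m1 m2 := (take p v, map snd (drop p v)).

Lemma cylinder_ball_word p v s :
  cylinder (ball_word p v) s <->
  ball_word p (mkseq s (size v)) = ball_word p v.
Proof.
have [ps|ps] := leqP (size v) p.
  rewrite /ball_word !take_oversize ?drop_oversize ?size_mkseq //=.
  rewrite cylinder_agree; split=> [->//|[]//].
rewrite /cylinder /ball_word /= size_takel 1?ltnW // size_map size_drop.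
have -> : take p (mkseq s (size v)) = mkseq s p.
  by rewrite /mkseq -map_take take_iota (minn_idPl (ltnW ps)).
have -> : map snd (drop p (mkseq s (size v))) =
    mkseq (fun k => (s (p + k)%N).2) (size v - p).
  rewrite /mkseq -map_drop drop_iota addnC iotaDl -!map_comp.
  by apply: eq_map => k /=; rewrite addnC.
by split=> -[-> ->].
Qed.

Lemma mass_ball_word P p N v : size v = N ->
  mass P (ball_word p v) =
  \sum_(w : N.-tuple A) (ball_word p w == ball_word p v)%:R *
                       mass P (val w, [::]).
Proof.
move=> vN.
rewrite -(mass_tuple_pred P N (fun w => ball_word p w == ball_word p v)).
congr (fine (P _)); apply/seteqP; split=> s.
  by move=> /cylinder_ball_word; rewrite vN => h; apply/eqP.
by move=> /eqP; rewrite -vN => /cylinder_ball_word.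
Qed.

Lemma mass_ball_word_ge P p v : mass P (v, [::]) <= mass P (ball_word p v).
Proof.
rewrite (@mass_ball_word _ _ (size v)) //.
rewrite (bigD1 (in_tuple v)) //= eqxx mul1r lerDl.
by apply: sumr_ge0 => w _; rewrite mulr_ge0 ?mass_ge0.
Qed.

End CylinderMass.

Section Uniqueness.
Context (m1 m2 : nat) (R : realType).
Local Notation A := (letter m1 * letter m2)%type.
Local Notation Sigma := (Sigma m1 m2).
Local Notation proba := (probability (borel_Sigma m1 m2) R).

(** The empty set is added to make the family stable under intersection. *)
Let initial_cylinders : set (set Sigma) :=
  [set E | E = set0 \/ exists w, E = cylinder (w, [::])].

Lemma agree_cylinder n s : [set s' : Sigma | agree n s' s] =
  cylinder (mkseq s n, [::]).
Proof.
apply/seteqP; split=> s' /=.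
  by move=> /agree_mkseq h; apply/cylinder_agree; rewrite size_mkseq.
by move/cylinder_agree; rewrite size_mkseq => /agree_mkseq.
Qed.

Lemma open_bigcup_cylinder (E : set Sigma) : open E ->
  E = \bigcup_(w in [set w | cylinder (w, [::]) `<=` E]) cylinder (w, [::]).
Proof.
move=> oE; apply/seteqP; split=> [s Es|s [w /= h]]; last exact: h.
have [n h] := open_basis oE Es.
exists (mkseq s n); first by rewrite /= -agree_cylinder.
by apply/cylinder_agree; rewrite size_mkseq.
Qed.

(** There are countably many words, so every open set is a countable union of initial cylinders;
    [pickle] indexes this union by the integers. *)
Lemma borel_SigmaE : @measurable _ (borel_Sigma m1 m2) = <<s initial_cylinders >>.
Proof.
apply/seteqP; split.
  apply: smallest_sub; first exact: smallest_sigma_algebra.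
  move=> E oE; rewrite (open_bigcup_cylinder oE) bigcup_mkcond.
  pose F (o : option (seq A)) : set Sigma := if o is Some w then
    if w \in [set w | cylinder (w, [::]) `<=` E] then cylinder (w, [::])
    else set0 else set0.
  rewrite (_ : \bigcup_w _ = \bigcup_i F (unpickle i)); last first.
    apply/seteqP; split=> s [i _ h]; first by exists (pickle i) => //; rewrite pickleK.
    by move: h; rewrite /F; case: (unpickle i) => // w h; exists w.
  apply: sigma_algebra_bigcup => i; apply: sub_gen_smallest.
  rewrite /F; case: (unpickle i : option (seq A)) => [w|]; last by left.
  by case: ifP => _; [right; exists w | left].
apply: smallest_sub; first exact: sigma_algebra_measurable.
move=> E [->|[w ->]]; first exact: measurable0.
exact: measurable_cylinder.
Qed.

Lemma same_measure_mass (P Q : proba) :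
  (forall w, mass P (w, [::]) = mass Q (w, [::])) -> same_measure P Q.
Proof.
move=> h E mE.
apply: (@measure_unique _ R (borel_Sigma m1 m2) initial_cylinders (fun=> setT)) => //.
- exact: borel_SigmaE.
- move=> X Y [->|[w ->]]; first by rewrite set0I; left.
  move=> [->|[w' ->]]; first by rewrite setI0; left.
  (* Two initial cylinders are disjoint or nested. *)
  have [W|/eqP W] := eqVneq (cylinder (w, [::]) `&` cylinder (w', [::]))
                           (set0 : set Sigma); first by left.
  right; move/eqP/set0P: W => [s [/cylinder_agree sw /cylinder_agree sw']].
  wlog le : w w' sw sw' / (size w <= size w')%N.
    by move=> H; case/orP: (leq_total (size w) (size w')) => /H; last
      rewrite setIC; apply.
  exists w'; apply/setIidr => s' /cylinder_agree h'; apply/cylinder_agree.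
  rewrite -[RHS]sw; apply/agree_mkseq; apply: (agree_le le); apply/agree_mkseq.
  by rewrite h' sw'.
- by move=> _; right; exists [::]; rewrite cylinder_nil.
- by rewrite bigcup_const //; exists 0%N.
- move=> X [->|[w ->]]; first by rewrite !measure0.
  transitivity (mass P (w, [::]))%:E; first exact: massE.
  by rewrite h; apply/esym; exact: massE.
- by move=> _; apply: (@le_lt_trans _ _ 1%E); [exact: probability_le1 | exact: ltry].
Qed.

End Uniqueness.

(** * Measures with prescribed cylinder masses *)

Section UnitInterval.
Context (R : realType).

Definition uniform01 :=
  mrestr (@lebesgue_measure R) (measurable_itv (`[0, 1[ : interval R)).

HB.instance Definition _ := Measure.on uniform01.

Let uniform01_setT : uniform01 setT = 1%E.
Proof.
by rewrite /uniform01 /mrestr setTI lebesgue_measure_itv /= lte_fin ltr01 oppr0 adde0.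
Qed.

HB.instance Definition _ := Measure_isProbability.Build _ _ _
  uniform01 uniform01_setT.

End UnitInterval.

Section NestedIntervals.
Context (R : realType) (A : finType) (a0 : A) (m : seq A -> R).
Hypothesis m_ge0 : forall w, 0 <= m w.
Hypothesis m_nil : m [::] = 1.
Hypothesis m_rcons : forall w, m w = \sum_c m (rcons w c).

(* The words w index nested intervals of length m w, so that the sequence of
   letters of a uniform point of [0, 1) has w as a prefix with probability m w. *)
Let cum w k := \sum_(0 <= i < k) m (rcons w (nth a0 (enum A) i)).

Let cum_mono w k k' : (k <= k')%N -> cum w k <= cum w k'.
Proof.
move=> h; rewrite /cum [leRHS](big_cat_nat (leq0n k) h) /= lerDl.
by apply: sumr_ge0 => i _.
Qed.

Let cum_full w : cum w #|A| = m w.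
Proof. by rewrite m_rcons -big_enum /= (big_nth a0) cardE. Qed.

(** Left endpoint: that of the parent plus the lengths of the siblings before the last letter. The
    recursion is on the reversed word, since words grow at their end. *)
Let low_rev := fix low r :=
  if r is c :: r' then low r' + cum (rev r') (index c (enum A)) else 0.

Definition interval_low w : R := low_rev (rev w).

Lemma interval_low_rcons w c :
  interval_low (rcons w c) = interval_low w + cum w (index c (enum A)).
Proof. by rewrite /interval_low rev_rcons /= revK. Qed.

(** With half-open intervals the children of a word partition its interval, and words of mass 0
    receive the empty one. *)
Definition in_interval w x := interval_low w <= x < interval_low w + m w.

Lemma in_interval_nil x : in_interval [::] x = (0 <= x < 1).
Proof. by rewrite /in_interval /interval_low m_nil add0r. Qed.

Let cum_index w c :
  cum w (index c (enum A)).+1 = cum w (index c (enum A)) + m (rcons w c).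
Proof. by rewrite /cum big_nat_recr //= nth_index // mem_enum. Qed.

Lemma in_interval_rcons w c x : in_interval (rcons w c) x -> in_interval w x.
Proof.
rewrite /in_interval interval_low_rcons => /andP[h1 h2]; apply/andP; split.
  by apply: le_trans h1; rewrite lerDl -{1}(_ : cum w 0 = 0) ?cum_mono // /cum big_geq.
apply: lt_le_trans h2 _; rewrite -addrA lerD2l -cum_index -cum_full cum_mono //.
by rewrite cardE index_mem mem_enum.
Qed.

Lemma in_interval_rcons_inj w c c' x :
  in_interval (rcons w c) x -> in_interval (rcons w c') x -> c = c'.
Proof.
rewrite /in_interval !interval_low_rcons.
wlog le : c c' / (index c (enum A) <= index c' (enum A))%N => [H|].
  by move=> h h'; case/orP: (leq_total (index c (enum A)) (index c' (enum A)))
    => /H; [|move=> H'; apply/esym]; auto.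
move=> /andP[_ h2] /andP[h3 _]; move: le; rewrite leq_eqVlt => /orP[/eqP e|lt].
  by rewrite -(nth_index a0 (s := enum A) (x := c)) ?mem_enum // e nth_index // mem_enum.
move: (lt_le_trans (le_lt_trans h3 h2) (lexx _)).
rewrite -addrA -cum_index ltrD2l => /lt_le_trans - /(_ _ (cum_mono w lt)).
by rewrite ltxx.
Qed.

Lemma in_interval_split w x : in_interval w x ->
  exists c, in_interval (rcons w c) x.
Proof.
move=> /andP[h1 h2].
have ex : exists k, x < interval_low w + cum w k.
  by exists #|A|; rewrite cum_full.
(* The least [k] whose cumulative length passes [x] is one more than the index of the letter; it is
   positive because [x] is not below the left endpoint. *)
case: (ex_minnP ex) => -[|k] hk kmin.
  by move: hk; rewrite /cum big_geq // addr0 ltNge h1.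
have kA : (k < size (enum A))%N.
  by rewrite -cardE; apply: kmin; rewrite cum_full.
exists (nth a0 (enum A) k); rewrite /in_interval interval_low_rcons.
rewrite -addrA -cum_index index_uniq ?enum_uniq // hk andbT leNgt.
by apply/negP => /kmin; rewrite ltnn.
Qed.

Lemma in_interval_inj w w' x : size w = size w' ->
  in_interval w x -> in_interval w' x -> w = w'.
Proof.
elim/last_ind: w w' => [|w c IH] w'; first by case: w'.
case/lastP: w' => [|w' c']; first by rewrite size_rcons.
rewrite !size_rcons => -[/IH{}IH] h h'.
have e := IH (in_interval_rcons h) (in_interval_rcons h').
by move: h h'; rewrite e => h h'; rewrite (in_interval_rcons_inj h h').
Qed.

Lemma in_interval_ex n x : 0 <= x < 1 -> exists w, size w = n /\ in_interval w x.
Proof.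
move=> x01; elim: n => [|n [w [<- /in_interval_split[c h]]]].
  by exists [::]; rewrite in_interval_nil.
by exists (rcons w c); rewrite size_rcons.
Qed.

Let address x n : seq A := xget [::] [set w | size w = n /\ in_interval w x].

Let addressP n x : 0 <= x < 1 ->
  size (address x n) = n /\ in_interval (address x n) x.
Proof.
move=> /(in_interval_ex n)[w hw].
by rewrite /address; case: xgetP => // /(_ w); case.
Qed.

(** Letter [n] is read off the address of length n + 1. Addresses of different lengths are
    compatible because the intervals are nested, see [decode_address]. *)
Definition decode x (n : nat) : A := nth a0 (address x n.+1) n.

Lemma decode_address x n : 0 <= x < 1 -> mkseq (decode x) n = address x n.
Proof.
move=> x01; elim: n => [|n IH].
  by have [/size0nil -> _] := addressP 0 x01.
have [h1 h2] := addressP n.+1 x01; have [h3 h4] := addressP n x01.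
rewrite mkseqS IH /decode; move: h1 h2.
case/lastP: (address x n.+1) => [|w c]; first by [].
rewrite size_rcons => -[wn] h2; rewrite nth_rcons wn ltnn eqxx.
by rewrite (in_interval_inj _ h4 (in_interval_rcons h2)) // h3.
Qed.

Lemma decodeP x w : 0 <= x < 1 ->
  mkseq (decode x) (size w) = w <-> in_interval w x.
Proof.
move=> x01; rewrite decode_address //; have [h1 h2] := addressP (size w) x01.
by split=> [<-//|h]; apply: in_interval_inj h2 h.
Qed.

End NestedIntervals.

Section Kolmogorov.
Context (m1 m2 : nat) (R : realType).
Local Notation A := (letter m1 * letter m2)%type.
Context (m : seq A -> R).
Hypothesis m_ge0 : forall w, 0 <= m w.
Hypothesis m_nil : m [::] = 1.
Hypothesis m_rcons : forall w, m w = \sum_c m (rcons w c).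

Let F (x : measurableTypeR R) : borel_Sigma m1 m2 :=
  if 0 <= x < 1 then decode (ord0, ord0) m x else point.

Let F_cylinder w : (F @^-1` cylinder (w, [::])) `&` `[0, 1[%classic =
  `[interval_low (ord0, ord0) m w, interval_low (ord0, ord0) m w + m w[%classic.
Proof.
have sub x : in_interval (ord0, ord0) m w x -> 0 <= x < 1.
  elim/last_ind: w => [|w c IH]; first by rewrite in_interval_nil.
  by move/in_interval_rcons => /(_ m_ge0 m_rcons).
apply/seteqP; split=> x /=; rewrite !in_itv /=.
  move=> [h x01]; apply/(decodeP (ord0, ord0) m_ge0 m_nil m_rcons w x01).
  by move/cylinder_agree: h; rewrite /F x01.
move=> h; have x01 := sub _ h; split=> //; rewrite /F x01.
by apply/cylinder_agree/(decodeP (ord0, ord0) m_ge0 m_nil m_rcons w x01).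
Qed.

Let mF : measurable_fun setT F.
Proof.
apply: (measurability _ (borel_SigmaE m1 m2)) => _ [E [->|[w ->]] <-].
  by rewrite preimage_set0 setI0.
rewrite setTI -[X in measurable X]setIT -(setUv `[0%R, 1%R[%classic) setIUr.
apply: measurableU; first by rewrite F_cylinder; exact: measurable_itv.
have m01 : measurable (~` `[0%R, 1%R[%classic : set (measurableTypeR R)).
  by apply: measurableC; exact: measurable_itv.
(* Off the unit interval [F] is constant, so the preimage contains all of the complement or none of
   it. *)
have [h|h] := pselect (cylinder (w, [::]) (point : Sigma m1 m2)).
  rewrite setIidr // => x /=; rewrite in_itv /= => /negP/negbTE x01.
  by rewrite /F x01.
rewrite (_ : _ `&` _ = set0) //; apply/seteqP; split=> // x [].
by rewrite /= in_itv /F /= => + /negP/negbTE x01; rewrite x01.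
Qed.

(** [P] is the law of the letters decoded from a uniform point of [0, 1). *)
Lemma mass_extension :
  exists P : probability (borel_Sigma m1 m2) R, forall w, mass P (w, [::]) = m w.
Proof.
pose X : {mfun measurableTypeR R >-> borel_Sigma m1 m2} :=
  HB.pack F (isMeasurableFun.Build _ _ _ _ F mF).
exists (distribution (@uniform01 R) X) => w.
rewrite /mass /= /distribution /pushforward /= /uniform01 /mrestr.
rewrite F_cylinder lebesgue_measure_itv /= lte_fin ltrDl.
case: ltP => [_|le]; first by rewrite -EFinB /= addrC addKr.
by apply/eqP; rewrite eq_le m_ge0 le.
Qed.

End Kolmogorov.

(** * The measure P_mu *)

Section Chains.
Context (q : nat) (q_gt1 : (1 < q)%N).

(** The number of l with i q^l <= N, as [ltn_nchain] shows. It is 0 for i > N, so that sums over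
    chains may run over more indices. *)
Definition nchain i N := if (i <= N)%N then (trunc_log q (N %/ i)).+1 else 0%N.

Lemma ltn_nchain i N l : (0 < i)%N -> (l < nchain i N)%N = (i * q ^ l <= N)%N.
Proof.
move=> i0; rewrite /nchain; have [iN|iN] := leqP i N.
  have d0 : (0 < N %/ i)%N by rewrite divn_gt0.
  rewrite ltnS mulnC -leq_divRL //.
  have /andP[h1 h2] := trunc_log_bounds q_gt1 d0.
  apply/idP/idP => h; first by apply: leq_trans h1; rewrite leq_exp2l.
  by rewrite -ltnS -(ltn_exp2l _ _ q_gt1); apply: leq_ltn_trans h2.
apply/esym/negbTE; rewrite -ltnNge; apply: leq_trans iN _.
by rewrite leq_pmulr // expn_gt0 (ltnW q_gt1).
Qed.

Lemma eq_ltn a b : (forall l, (l < a)%N = (l < b)%N) -> a = b.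
Proof.
move=> h; have [lt|lt|//] := ltngtP a b; first by have := h a; rewrite lt ltnn.
by have := h b; rewrite lt ltnn.
Qed.

Lemma nchain_gt i N : (N < i)%N -> nchain i N = 0%N.
Proof. by move=> h; rewrite /nchain leqNgt h. Qed.

(** With [free_part_inj]: the chains partition the positive integers. *)
Lemma free_part n : (0 < n)%N ->
  exists i l, [/\ n = (i * q ^ l)%N, ~~ (q %| i)%N & (0 < i)%N].
Proof.
elim/ltn_ind: n => n IH n0.
have [/dvdnP[k nk]|h] := boolP (q %| n)%N; last first.
  by exists n, 0%N; rewrite muln1.
have k0 : (0 < k)%N by move: n0; rewrite nk muln_gt0 => /andP[].
have [|//|i [l [kE h1 h2]]] := IH k; first by rewrite nk ltn_Pmulr.
by exists i, l.+1; split=> //; rewrite nk kE expnSr mulnA.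
Qed.

Lemma free_part_inj i i' l l' : (0 < i)%N -> ~~ (q %| i)%N -> ~~ (q %| i')%N ->
  (i * q ^ l = i' * q ^ l')%N -> i = i' /\ l = l'.
Proof.
move=> i0 h h'; have q0 : (0 < q)%N by exact: ltnW.
elim: l l' => [|l IH] [|l'].
- by rewrite !muln1.
- by rewrite muln1 => e; move: h; rewrite e expnSr mulnA dvdn_mull.
- by rewrite muln1 => e; move: h'; rewrite -e expnSr mulnA dvdn_mull.
- rewrite !expnSr !mulnA => /eqP; rewrite eqn_pmul2r // => /eqP /IH [-> ->].
  by [].
Qed.

Definition nondiv N := [seq i <- index_iota 1 N.+1 | ~~ (q %| i)%N].

Lemma mem_nondiv i N : (i \in nondiv N) = [&& (0 < i)%N, (i <= N)%N & ~~ (q %| i)%N].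
Proof. by rewrite mem_filter mem_index_iota ltnS andbC andbA. Qed.

Lemma nondiv_uniq N : uniq (nondiv N).
Proof. by rewrite filter_uniq ?iota_uniq. Qed.

Lemma big_nondiv (R : Type) (idx : R) (op : Monoid.com_law idx) (F : nat -> R)
    N M : (N <= M)%N -> (forall i, (N < i)%N -> F i = idx) ->
  \big[op/idx]_(i <- nondiv M) F i = \big[op/idx]_(i <- nondiv N) F i.
Proof.
move=> NM h; rewrite /nondiv !big_filter /= (big_cat_nat _ (n := N.+1)) //=.
rewrite [X in op _ X]big_nat_cond [X in op _ X]big1 ?Monoid.mulm1 //.
by move=> i /andP[/andP[/h]].
Qed.

Section Words.
Context (m1 m2 : nat).
Local Notation A := (letter m1 * letter m2)%type.
Local Notation Sigma := (Sigma m1 m2).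
Implicit Types (s : Sigma) (w : seq A).

Definition chain i N s : seq A := mkseq (fiber q s i) (nchain i N).

Lemma size_chain i N s : size (chain i N s) = nchain i N.
Proof. exact: size_mkseq. Qed.

Lemma nth_chain i N s l : (l < nchain i N)%N ->
  nth (ord0, ord0) (chain i N s) l = s (i * q ^ l).-1.
Proof. by move=> h; rewrite nth_mkseq. Qed.

Lemma chain_agree i N s s' : (0 < i)%N -> agree N s s' ->
  chain i N s = chain i N s'.
Proof.
move=> i0 h; apply/eq_in_map => l; rewrite mem_iota add0n => /andP[_].
rewrite ltn_nchain // => le; apply: h.
by rewrite prednK // muln_gt0 i0 expn_gt0 (ltnW q_gt1).
Qed.

(** The new position N + 1 lies on exactly one chain, at its end; the other chains stay as they
    were. *)
Lemma chain_step N : exists i0,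
  [/\ i0 \in nondiv N.+1, nchain i0 N.+1 = (nchain i0 N).+1,
      forall w c, size w = N ->
        chain i0 N.+1 (ext (rcons w c)) = rcons (chain i0 N (ext w)) c &
      forall i, (0 < i)%N -> ~~ (q %| i)%N -> i != i0 -> nchain i N.+1 = nchain i N /\
        forall w c, size w = N ->
          chain i N.+1 (ext (rcons w c)) = chain i N (ext w)].
Proof.
have [i0 [l0 [NE h1 h2]]] := @free_part N.+1 isT.
have E0 : nchain i0 N = l0.
  apply: eq_ltn => l; rewrite ltn_nchain // -ltnS NE ltn_pmul2l //.
  by rewrite ltn_exp2l.
have E1 : nchain i0 N.+1 = l0.+1.
  by apply: eq_ltn => l; rewrite ltn_nchain // NE leq_pmul2l // leq_exp2l // ltnS.
have agr w c : size w = N -> agree N (ext (rcons w c)) (ext w).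
  by move=> wN k kN; rewrite /ext nth_rcons wN kN.
exists i0; split.
- by rewrite mem_nondiv h1 h2 NE leq_pmulr // expn_gt0 (ltnW q_gt1).
- by rewrite E0 E1.
- move=> w c wN; rewrite -(chain_agree h2 (agr w c wN)) /chain E0 E1 mkseqS.
  by congr rcons; rewrite /fiber -NE /= /ext nth_rcons wN ltnn eqxx.
- move=> i i_gt0 hi ii0.
  have E : nchain i N.+1 = nchain i N.
    apply: eq_ltn => l; rewrite !ltn_nchain // leq_eqVlt ltnS.
    case: eqP => //= e; have [] := free_part_inj i_gt0 hi h1 (l := l) (l' := l0).
      by rewrite e NE.
    by move=> e'; rewrite e' eqxx in ii0.
  split=> // w c wN; rewrite -(chain_agree i_gt0 (agr w c wN)) /chain E.
  by [].
Qed.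

(** Summing out the last letter touches a single factor. [M] is separate from [N] so that the index
    set of the product stays fixed while [N] varies; chains starting after [N] are empty. *)
Lemma sum_prod_chain_rcons (R : comPzRingType) (F : nat -> seq A -> R) N M :
  (N < M)%N -> exists i0, [/\ i0 \in nondiv M,
    nchain i0 N.+1 = (nchain i0 N).+1,
    forall i, i \in nondiv M -> i != i0 -> nchain i N.+1 = nchain i N &
    forall w, size w = N ->
    \sum_c \prod_(i <- nondiv M) F i (chain i N.+1 (ext (rcons w c))) =
    \prod_(i <- nondiv M)
      (if i == i0 then \sum_c F i (rcons (chain i N (ext w)) c)
       else F i (chain i N (ext w)))].
Proof.
move=> NM; have [i0 [h1 h2 h3 h4]] := chain_step N.
have i0M : i0 \in nondiv M.
  move: h1; rewrite !mem_nondiv => /and3P[-> le ->]; rewrite andbT /=.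
  exact: leq_trans NM.
have h4' i : i \in nondiv M -> i != i0 -> nchain i N.+1 = nchain i N /\
        forall w c, size w = N ->
          chain i N.+1 (ext (rcons w c)) = chain i N (ext w).
  by rewrite mem_nondiv => /and3P[i_gt0 _ hi]; exact: h4.
exists i0; split=> // [i iM ii0|w wN]; first by have [] := h4' i iM ii0.
rewrite [RHS](bigD1_seq i0) ?nondiv_uniq //= eqxx mulr_suml.
apply: eq_bigr => c _; rewrite (bigD1_seq i0) ?nondiv_uniq //= h3 //.
congr (_ * _); rewrite big_seq_cond [RHS]big_seq_cond.
apply: eq_bigr => i /andP[iM ii0]; rewrite (negbTE ii0).
by rewrite (h4' i iM ii0).2.
Qed.

(** Independence of the chains in finite form: a word amounts to the family of its chains, so a sum
    of products factors. *)
Lemma sum_prod_chain (R : comPzRingType) (F : nat -> seq A -> R) N M :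
  (N <= M)%N ->
  \sum_(w : N.-tuple A) \prod_(i <- nondiv M) F i (chain i N (ext w)) =
  \prod_(i <- nondiv M) \sum_(v : (nchain i N).-tuple A) F i v.
Proof.
elim: N F => [|N IH] F NM.
  rewrite (big_tuple0 (fun w => \prod_(i <- nondiv M) F i (chain i 0 (ext w)))).
  rewrite big_seq [RHS]big_seq; apply: eq_bigr => i; rewrite mem_nondiv => /and3P[i0 _ _].
  by rewrite /chain nchain_gt // (big_tuple0 (F i)).
have [i0 [h1 h2 h3 h4]] := sum_prod_chain_rcons F NM.
pose F' i v := if i == i0 then \sum_c F i (rcons v c) else F i v.
transitivity (\sum_(w : N.-tuple A) \prod_(i <- nondiv M) F' i (chain i N (ext w))).
  rewrite (big_tuple_rcons N (fun w => \prod_(i <- nondiv M) F i (chain i N.+1 (ext w)))).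
  by apply: eq_bigr => u _; apply: h4; exact: size_tuple.
rewrite (IH F' (ltnW NM)) /F'.
rewrite big_seq [RHS]big_seq; apply: eq_bigr => i iM.
have [->|ii0] := eqVneq i i0; last by rewrite h3.
by rewrite h2 (big_tuple_rcons _ (F i0)).
Qed.

End Words.
End Chains.

Section Support.
Context (m1 m2 : nat) (R : realType).
Local Notation A := (letter m1 * letter m2)%type.
Local Notation Sigma := (Sigma m1 m2).
Local Notation proba := (probability (borel_Sigma m1 m2) R).
Context (Omega : set Sigma) (closedOmega : closed Omega).

Lemma is_prefixP (u : word m1 m2) :
  reflect (exists2 s, Omega s & cylinder u s) (is_prefix Omega u).
Proof.
by apply: (iffP (asboolP _)) => [[s [h1 h2]]|[s h1 h2]]; exists s.
Qed.

Lemma notin_closed s : ~ Omega s -> exists n, ~~ is_prefix Omega (mkseq s n, [::]).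
Proof.
move=> h; have [n hn] := open_basis (closed_openC closedOmega) h.
exists n; apply/is_prefixP => -[s' Os' /cylinder_agree]; rewrite size_mkseq.
by move=> /agree_mkseq /hn; apply.
Qed.

Lemma measurable_closed : measurable (Omega : set (borel_Sigma m1 m2)).
Proof.
rewrite -[X in measurable X]setCK; apply: measurableC.
by apply: sub_sigma_algebra; exact: closed_openC.
Qed.

Lemma null_union (P : proba) (I : countType) (D : pred I) (B : I -> set Sigma)
    (E : set Sigma) :
  (forall i, D i -> measurable (B i : set (borel_Sigma m1 m2))) ->
  (forall i, D i -> P (B i) = 0%E) -> measurable (E : set (borel_Sigma m1 m2)) ->
  (forall s, ~ E s -> exists2 i, D i & B i s) -> P E = 1%E.
Proof.
move=> mB PB mE hE.
pose F k : set (borel_Sigma m1 m2) :=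
  if unpickle k is Some i then if D i then B i else set0 else set0.
have mF k : measurable (F k).
  by rewrite /F; case: unpickle => // i; case: ifP => // /mB.
have PF k : P (F k) = 0%E.
  by rewrite /F; case: unpickle => [i|]; rewrite ?measure0 //;
    case: ifP => [/PB//|_]; rewrite measure0.
have P0 : P (~` E) = 0%E.
  apply/eqP; rewrite eq_le measure_ge0 andbT.
  have sub : ~` E `<=` \bigcup_k F k.
    by move=> s /hE [i Di Bi]; exists (pickle i) => //; rewrite /F pickleK Di.
  apply: le_trans (measure_sigma_subadditive P mF (measurableC mE) sub) _.
  by rewrite eseries0 // => k _ _; exact: PF.
have := probability_setC P (measurableC mE).
by rewrite P0 setCK sube0.
Qed.

(** A point outside the closed set [Omega] has an initial word that is not a prefix of [Omega], and
    there are countably many words. *)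
Lemma supported_mass (P : proba) :
  supported_on Omega P <->
  forall u, ~~ is_prefix Omega u -> mass P u = 0.
Proof.
split=> [h u hu|h].
  have mO := measurable_closed.
  have P0 : P (~` Omega) = 0%E by rewrite probability_setC // h subee.
  have : (P (cylinder u) <= P (~` Omega))%E.
    apply: le_measure; rewrite ?inE; [exact: measurable_cylinder|exact: measurableC|].
    by move=> s us Os; move/is_prefixP: hu; apply; exists s.
  rewrite P0 /mass => le; suff -> : P (cylinder u) = 0%E by [].
  by apply/eqP; rewrite eq_le le measure_ge0.
apply: (@null_union P _ (fun w : seq A => ~~ is_prefix Omega (w, [::]))
  (fun w => cylinder (w, [::]))).
- by move=> w _; exact: measurable_cylinder.
- by move=> w hw; rewrite massE h.
- exact: measurable_closed.
- move=> s /notin_closed[n hn]; exists (mkseq s n) => //.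
  by apply/cylinder_agree; rewrite size_mkseq.
Qed.

End Support.

Section MultiplicativeMeasure.
Context (q : nat) (q_gt1 : (1 < q)%N) (m1 m2 : nat) (R : realType).
Local Notation A := (letter m1 * letter m2)%type.
Local Notation Sigma := (Sigma m1 m2).
Local Notation proba := (probability (borel_Sigma m1 m2) R).
Implicit Types (nu P : proba).

Lemma is_P_mass nu P : is_P q nu P <->
  forall w, mass P (w, [::]) =
    \prod_(i <- nondiv q (size w)) mass nu (chain q i (size w) (ext w), [::]).
Proof.
have eqn s n : \prod_(1 <= i < n.+1 | ~~ (q %| i)%N)
       fine (nu (cylinder
         (initial (fiber q s i) (trunc_log q (n %/ i)).+1))) =
    \prod_(i <- nondiv q n) mass nu (chain q i n s, [::]).
  rewrite /nondiv big_filter big_nat_cond [RHS]big_nat_cond.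
  apply: eq_bigr => i /andP[/andP[i0]]; rewrite ltnS => le _.
  by rewrite /chain /nchain le.
split=> h => [w|s n].
  by have := h (ext w) (size w); rewrite eqn /initial mkseq_ext massE => -[].
rewrite eqn /initial massE h size_mkseq; congr (_%:E).
rewrite big_seq [RHS]big_seq; apply: eq_bigr => i; rewrite mem_nondiv => /and3P[i0 _ _].
by rewrite (chain_agree q_gt1 i0 (@agree_ext _ _ s n)).
Qed.

(** Consistency of the product: one more letter extends one chain, and [mass_letter] sums over
    it. *)
Lemma is_P_exists nu : exists P, is_P q nu P.
Proof.
have [] := @mass_extension m1 m2 R (fun w =>
    \prod_(i <- nondiv q (size w)) mass nu (chain q i (size w) (ext w), [::])).
- by move=> w; apply: prodr_ge0 => i _; exact: mass_ge0.
- by rewrite big_nil.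
- move=> w; have [i0 [h1 _ _ h2]] := sum_prod_chain_rcons q_gt1
    (fun _ v => mass nu (v, [::])) (ltnSn (size w)).
  under [RHS]eq_bigr do rewrite size_rcons.
  rewrite h2 // -(@big_nondiv q _ _ _ _ (size w) (size w).+1) //; last first.
    by move=> i lt; rewrite /chain nchain_gt // mass_nil.
  apply: eq_bigr => i _; case: eqP => // ->.
  by rewrite mass_letter.
- by move=> P h; exists P; apply/is_P_mass.
Qed.

Lemma P_P nu : is_P q nu (P_ q nu).
Proof. by rewrite /P_; case: xgetP => [P _ //|h]; have [P /h] := is_P_exists nu. Qed.

Context (nu P : proba) (nuP : is_P q nu P).

Lemma mass_P N (w : N.-tuple A) : mass P (val w, [::]) =
  \prod_(i <- nondiv q N) mass nu (chain q i N (ext w), [::]).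
Proof. by move/is_P_mass: nuP => ->; rewrite size_tuple. Qed.

(** Under [P] the chain started at [i0] has law [nu], because the factors of the other chains each
    sum to 1. *)
Lemma sum_mass_chain N i0 (phi : seq A -> R) : i0 \in nondiv q N ->
  \sum_(w : N.-tuple A) mass P (val w, [::]) * phi (chain q i0 N (ext w)) =
  \sum_(v : (nchain q i0 N).-tuple A) mass nu (val v, [::]) * phi v.
Proof.
move=> i0N.
pose F i v := mass nu (v, [::]) * (if i == i0 then phi v else 1).
transitivity (\sum_(w : N.-tuple A)
    \prod_(i <- nondiv q N) F i (chain q i N (ext w))).
  apply: eq_bigr => w _; rewrite mass_P /F big_split /=; congr (_ * _).
  rewrite (bigD1_seq i0) ?nondiv_uniq //= eqxx big1 ?mulr1 // => i ii0.
  by rewrite (negbTE ii0).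
rewrite (sum_prod_chain q_gt1 F (leqnn N)) (bigD1_seq i0) ?nondiv_uniq //= /F eqxx.
rewrite [X in _ * X]big1 ?mulr1 // => i ii0; rewrite (negbTE ii0).
by under eq_bigr do rewrite mulr1; exact: sum_mass.
Qed.

Lemma ball_wordP n (w w' : seq A) : size w = size w' ->
  reflect (forall k, (k < size w)%N ->
    ((k < n)%N -> ext w k = ext w' k) /\ (ext w k).2 = (ext w' k).2)
  (ball_word n w == ball_word n w').
Proof.
move=> sw; apply: (iffP eqP) => [[h1 h2] k kw|h].
  have h3 : (k < n)%N -> ext w k = ext w' k.
    by move=> kn; rewrite /ext -(nth_take _ kn) h1 nth_take.
  split=> //; have [/h3 -> //|nk] := ltnP k n.
  have := congr1 (fun z => nth ord0 z (k - n)%N) h2.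
  by rewrite !(nth_map (ord0, ord0)) ?size_drop -?sw ?ltn_sub2r ?(leq_ltn_trans nk) //
    !nth_drop subnKC.
congr (_, _).
  apply: (@eq_from_nth _ (ord0, ord0)); first by rewrite !size_take sw.
  move=> k; rewrite size_take_min ltn_min => /andP[kn kw].
  by rewrite !nth_take //; apply: (h k kw).1.
apply: (@eq_from_nth _ ord0); first by rewrite !size_map !size_drop sw.
move=> k; rewrite size_map size_drop ltn_subRL => kw.
rewrite !(nth_map (ord0, ord0)) ?size_drop -?sw ?ltn_subRL // !nth_drop.
exact: (h _ kw).2.
Qed.

(** Balls split along the chains: on the chain of [i] whole letters are fixed at the [nchain q i n]
    points up to [n], and second coordinates at the further points up to [N]. *)
Lemma ball_word_chain N n (w w' : N.-tuple A) :
  (ball_word n w == ball_word n w') =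
  all (fun i => ball_word (nchain q i n) (chain q i N (ext w)) ==
                ball_word (nchain q i n) (chain q i N (ext w'))) (nondiv q N).
Proof.
have q0 : (0 < q)%N by exact: ltnW.
have sw : size w = size w' by rewrite !size_tuple.
apply/(ball_wordP n sw)/allP => [h i|h k].
  rewrite mem_nondiv => /and3P[i0 iN qi].
  apply/ball_wordP; rewrite !size_chain // => l lN.
  have iql : (0 < i * q ^ l)%N by rewrite muln_gt0 i0 expn_gt0 q0.
  rewrite /ext !nth_chain // ltn_nchain // -[X in (X <= _)%N]prednK //.
  apply: h; rewrite size_tuple prednK //.
  by rewrite -ltn_nchain.
rewrite size_tuple => kN.
have [i [l [kE qi i0]]] := free_part q_gt1 (isT : 0 < k.+1)%N.
have iN : i \in nondiv q N.
  rewrite mem_nondiv i0 qi andbT; apply: leq_trans kN; rewrite kE.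
  by rewrite leq_pmulr // expn_gt0 q0.
have lN : (l < nchain q i N)%N by rewrite ltn_nchain // -kE.
have := h i iN; move/ball_wordP; rewrite !size_chain => /(_ erefl l lN).
by rewrite /ext !nth_chain // ltn_nchain // -kE.
Qed.

Lemma mass_P_ball N n (w : N.-tuple A) : mass P (ball_word n w) =
  \prod_(i <- nondiv q N)
    mass nu (ball_word (nchain q i n) (chain q i N (ext w))).
Proof.
rewrite (mass_ball_word _ _ (size_tuple w)).
pose F i v := (ball_word (nchain q i n) v ==
    ball_word (nchain q i n) (chain q i N (ext w)))%:R * mass nu (v, [::]).
transitivity (\sum_(w' : N.-tuple A)
    \prod_(i <- nondiv q N) F i (chain q i N (ext w'))).
  apply: eq_bigr => w' _; rewrite mass_P big_split /= ball_word_chain.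
  congr (_ * _); elim: (nondiv q N) => [|i r IH]; first by rewrite big_nil.
  by rewrite big_cons -IH /= -natrM mulnb.
rewrite (sum_prod_chain q_gt1 F (leqnn N)); apply: eq_bigr => i _.
by rewrite (mass_ball_word _ _ (size_chain q i N (ext w))).
Qed.

Lemma measurable_X_Omega (Omega : set Sigma) : closed Omega ->
  measurable (X_Omega q Omega : set (borel_Sigma m1 m2)).
Proof.
move=> cO; rewrite (_ : X_Omega q Omega = \bigcap_i (if (0 < i)%N && ~~ (q %| i)%N
    then \bigcap_k [set s | is_prefix Omega (mkseq (fiber q s i) k, [::])] else setT)).
  apply: bigcapT_measurable => i; case: ifP => // /andP[i0 _].
  apply: bigcapT_measurable => k.
  apply: (@measurable_dep _ _ (i * q ^ k)) => s s' h /=.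
  suff -> : mkseq (fiber q s i) k = mkseq (fiber q s' i) k by [].
  apply/agree_mkseq => l lk; apply: h.
  rewrite prednK ?muln_gt0 ?i0 ?expn_gt0 ?(ltnW q_gt1) //.
  by rewrite leq_pmul2l // leq_exp2l // ltnW.
apply/seteqP; split=> s h.
  move=> i _; case: ifP => // /andP[i0 qi] k _ /=.
  apply/is_prefixP; exists (fiber q s i); first exact: h.
  by apply/cylinder_agree; rewrite size_mkseq.
move=> i i0 qi; apply: contrapT => hO.
have [n] := notin_closed cO hO.
by have := h i Logic.I; rewrite i0 qi => /(_ n Logic.I) /= ->.
Qed.

Lemma P_X_Omega (Omega : set Sigma) : closed Omega -> supported_on Omega nu ->
  P (X_Omega q Omega) = 1%E.
Proof.
move=> cO hnu.
apply: (@null_union _ _ _ P (nat * nat)%type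
  (fun ik => (0 < ik.1)%N && ~~ (q %| ik.1)%N)
  (fun ik => [set s | ~~ is_prefix Omega (chain q ik.1 (ik.1 * q ^ ik.2) s, [::])])).
- move=> [i k] /= /andP[i0 _]; apply: (@measurable_dep _ _ (i * q ^ k)) => s s' h /=.
  by rewrite (chain_agree q_gt1 i0 h).
- move=> [i k] /= /andP[i0 qi]; set N := (i * q ^ k)%N.
  have iN : i \in nondiv q N.
    by rewrite mem_nondiv i0 qi leq_pmulr // expn_gt0 (ltnW q_gt1).
  rewrite fine_probability; last first.
    by apply: (@measurable_dep _ _ N) => s s' h /=; rewrite (chain_agree q_gt1 i0 h).
  congr (_%:E); pose Q v := ~~ is_prefix Omega (v, [::]).
  transitivity (fine (P [set s | Q (chain q i N (ext (mkseq s N)))])).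
    congr (fine (P _)); apply/seteqP; split=> s /=.
      by rewrite /Q (chain_agree q_gt1 i0 (@agree_ext _ _ s N)).
    by rewrite /Q (chain_agree q_gt1 i0 (@agree_ext _ _ s N)).
  rewrite (mass_tuple_pred P N (fun w => Q (chain q i N (ext w)))).
  under eq_bigr do rewrite mulrC.
  rewrite (sum_mass_chain (fun v => (Q v)%:R) iN) big1 // => v _.
  case: (boolP (Q v)) => hv; last by rewrite mulr0.
  by rewrite ((supported_mass cO nu).1 hnu) // mul0r.
- exact: measurable_X_Omega.
- move=> s /existsNP[i] /not_implyP[i0] /not_implyP[qi] hO.
  have [n] := notin_closed cO hO; case: n => [|n] hn.
    (* The null events concern words of at least one letter. If even the empty word is rejected, so
       is the word of length 1. *)
    exists (i, 0%N); rewrite /= ?i0 //; apply: contra hn => /is_prefixP[s' Os' _].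
    by apply/is_prefixP; exists s'.
  have e : nchain q i (i * q ^ n) = n.+1.
    by apply: eq_ltn => l; rewrite ltn_nchain // leq_pmul2l // leq_exp2l.
  by exists (i, n); rewrite /= ?i0 ?qi // /chain e.
Qed.

End MultiplicativeMeasure.

(** * The optimal measure *)

Section OptimalTree.
Context (R : realType) (q m1 m2 j : nat).
Local Notation A := (letter m1 * letter m2)%type.
Local Notation Sigma := (Sigma m1 m2).
Local Notation proba := (probability (borel_Sigma m1 m2) R).
Context (Omega : set Sigma) (t : word m1 m2 -> R).
Hypothesis q_gt1 : (1 < q)%N.
Hypothesis Omega0 : Omega !=set0.
Hypothesis ht : is_t q j Omega t.
Local Notation is_prefix := (is_prefix Omega).
Local Notation g := (gamma R m1 m2).
Local Notation e1 := (q%:R ^+ j * g).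
Local Notation e2 := (q%:R ^+ j.+1 * g).
Local Notation sum_x := (sum_x Omega t).
Local Notation cmass := (cylinder_mass q j Omega t).
Local Notation W := (W_ q j Omega t).
Local Notation S := (S_ q j Omega t).
Local Notation t0 := (t_empty q j Omega t).

(* The letters y_(p+1)...y_(p+l) of s, and the word
   (x_1,y_1)...(x_p,y_p)y_(p+1)...y_(p+l). *)
Definition ys_word (s : Sigma) p l := mkseq (fun k => (s (p + k)%N).2) l.
Definition prefix_word (s : Sigma) p l : word m1 m2 := (mkseq s p, ys_word s p l).

Lemma ys_wordS s p l : ys_word s p l.+1 = (s p).2 :: ys_word s p.+1 l.
Proof.
apply: (@eq_from_nth _ ord0) => [|i]; first by rewrite size_mkseq /= size_mkseq.
rewrite size_mkseq => il; rewrite nth_mkseq //; case: i il => [|i] il.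
  by rewrite addn0.
by rewrite /= nth_mkseq // addSnnS.
Qed.

Lemma ys_word_rcons s p l :
  ys_word s p l.+1 = rcons (ys_word s p l) (s (p + l)%N).2.
Proof. exact: mkseqS. Qed.

Lemma cylinder_prefix_word s p l : cylinder (prefix_word s p l) s.
Proof. by split; rewrite /= !size_mkseq. Qed.

Lemma is_prefix_word s p l : Omega s -> is_prefix (prefix_word s p l).
Proof.
by move=> Os; apply/is_prefixP; exists s => //; exact: cylinder_prefix_word.
Qed.

Lemma prefix_wordP (u : word m1 m2) : is_prefix u ->
  exists2 s, Omega s & u = prefix_word s (size u.1) (size u.2).
Proof.
case: u => w z /is_prefixP[s Os [/= h1 h2]]; exists s => //=.
by apply/esym; congr (_, _).
Qed.

Lemma Pref_prefix_word s p l : Omega s -> Pref Omega p l (prefix_word s p l).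
Proof. by move=> Os; split; rewrite /= ?size_mkseq //; exact: is_prefix_word. Qed.

Lemma descendant_prefix_word s p : Omega s ->
  descendant Omega (prefix_word s 1 j) (prefix_word s p.+1 j).
Proof.
move=> Os; elim: p => [|p IH]; first exact: descendant_refl.
apply: descendant_follower IH _.
exists (s p.+1).1, (s (p.+1 + j)%N).2, (s p.+1).2, (ys_word s p.+2 j); split.
- by rewrite -ys_word_rcons ys_wordS.
- by rewrite /prefix_word [in LHS]mkseqS -surjective_pairing.
- have := is_prefix_word p.+2 j Os.
  by rewrite /prefix_word mkseqS [X in rcons _ X]surjective_pairing.
Qed.

Lemma t_prefix_word s p : Omega s ->
  1 <= t (prefix_word s p.+1 j) <= m2%:R `^ (2 / (g * (q%:R - 1))) /\
  t (prefix_word s p.+1 j) `^ e2 =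
    \sum_(y | is_prefix (mkseq s p.+1, rcons (ys_word s p.+1 j) y))
       sum_x (mkseq s p.+1) (rcons (ys_word s p.+1 j) y) `^ e1.
Proof.
move=> Os; exact: (ht (Pref_prefix_word 1 j Os) (descendant_prefix_word p Os)).
Qed.

Lemma t_ge1 w z : is_prefix (w, z) -> (0 < size w)%N -> size z = j -> 1 <= t (w, z).
Proof.
move=> /prefix_wordP[s Os ->] /=; case: (size w) => // p _ ->.
by have [/andP[]] := t_prefix_word p Os.
Qed.

(** [p] counts the letters before the summed one: the sum runs over x'_(p+1), all other letters
    being those of [s]. *)
Definition sum_xs s p := sum_x (mkseq s p) (ys_word s p j.+1).

Lemma sum_xsE s p : sum_xs s p =
  \sum_(x | is_prefix (rcons (mkseq s p) (x, (s p).2), ys_word s p.+1 j))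
     t (rcons (mkseq s p) (x, (s p).2), ys_word s p.+1 j).
Proof. by rewrite /sum_xs ys_wordS. Qed.

Lemma sum_xs_ge1 s p : Omega s -> 1 <= sum_xs s p.
Proof.
move=> Os; rewrite sum_xsE (bigD1 (s p).1) /=; last first.
  by rewrite -surjective_pairing -mkseqS; exact: is_prefix_word.
have [/andP[h _] _] := t_prefix_word p Os.
rewrite -surjective_pairing -mkseqS -[X in X <= _]addr0 lerD //.
apply: sumr_ge0 => x /andP[hx _]; apply: le_trans ler01 _; apply: t_ge1 => //.
  by rewrite size_rcons.
by rewrite size_mkseq.
Qed.

Lemma S_last ys : S j.+1 ys = sum_x [::] ys `^ e1.
Proof. by rewrite /S_ subnn. Qed.

Hypothesis e1_gt0 : 0 < e1.

Lemma sum_xs_gt0 s p : Omega s -> 0 < sum_xs s p.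
Proof. by move=> /(sum_xs_ge1 p); exact: lt_le_trans. Qed.

Lemma S_ge0 i ys : 0 <= S i ys.
Proof.
by rewrite /S_; case: (j.+1 - i)%N => [|n]; rewrite ?iterS /=; exact: powR_ge0.
Qed.

Lemma sum_yE (F : seq (letter m2) -> R) s l : Omega s ->
  (forall ys, 0 <= F ys) -> 0 < F (ys_word s 0 l.+1) ->
  0 < sum_y Omega F (ys_word s 0 l).
Proof.
move=> Os F0 Fs; rewrite /sum_y (bigD1 (s l).2) /=; last first.
  by rewrite -[l]add0n -ys_word_rcons; exact: (is_prefix_word 0 l.+1 Os).
rewrite -{1}[l]add0n -ys_word_rcons; apply: ltr_pwDl => //.
by apply: sumr_ge0.
Qed.

(** Downward induction from S_(j+1): a nested sum taken along a point of [Omega] has a positive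
    term, the one that keeps following this point. *)
Lemma S_W_gt0 s i : Omega s ->
  ((0 < i <= j.+1)%N -> 0 < S i (ys_word s 0 i)) /\
  ((i <= j)%N -> 0 < W i (ys_word s 0 i)).
Proof.
move=> Os.
have WS k : 0 < S k.+1 (ys_word s 0 k.+1) -> 0 < W k (ys_word s 0 k).
  by move=> h; apply: sum_yE => // ys; exact: S_ge0.
suff H n k : (k + n = j.+1)%N -> 0 < S k (ys_word s 0 k).
  split=> [/andP[i0 ij]|ij]; first by apply: (H (j.+1 - i)%N); rewrite subnKC.
  by apply: WS; apply: (H (j - i)%N); rewrite addSn subnKC.
elim: n k => [|n IH] k.
  rewrite addn0 => ->; rewrite S_last.
  by apply: powR_gt0; exact: (sum_xs_gt0 0 Os).
move=> e; rewrite S_W; first by apply/powR_gt0/WS/IH; rewrite -e addSnnS.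
by rewrite -ltnS -e addnS ltnS leq_addr.
Qed.

Lemma W_gt0 s i : Omega s -> (i <= j)%N -> 0 < W i (ys_word s 0 i).
Proof. by move=> Os ij; apply: (S_W_gt0 i Os).2. Qed.

Lemma W0 : W 0 [::] = t0.
Proof. by []. Qed.

Lemma t0_gt0 : 0 < t0.
Proof. by case: Omega0 => s /W_gt0 - /(_ 0%N isT). Qed.

(** The factor of W_l in the mass of the cylinder of y_1...y_l, see [node_sum_head]; for l = j it is
    also the factor of S_(j+1) in the mass of y_1...y_(j+1). *)
Definition head_mass l (ys : seq (letter m2)) : R :=
  (\prod_(1 <= r < l.+1) W r (take r ys) `^ ((1 - q%:R) / q%:R)) / t0.

Lemma take_ys_word s p l k : (k <= l)%N ->
  take k (ys_word s p l) = ys_word s p k.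
Proof. by move=> h; rewrite /ys_word /mkseq -map_take take_iota (minn_idPl h). Qed.

Lemma drop_ys_word s p l k :
  drop k (ys_word s p l) = ys_word s (p + k) (l - k).
Proof.
apply: (@eq_from_nth _ ord0); rewrite ?size_drop !size_mkseq // => i il.
by rewrite nth_drop !nth_mkseq ?addnA // -ltn_subRL.
Qed.

Lemma prefix_word_snd s p l :
  map snd (prefix_word s p l).1 ++ (prefix_word s p l).2 = ys_word s 0 (p + l).
Proof.
rewrite /prefix_word /=; elim: l => [|l IH].
  by rewrite addn0 cats0 /ys_word /mkseq -map_comp.
by rewrite addnS !ys_word_rcons -IH -rcons_cat add0n.
Qed.

Lemma size_prefix_word s p l : size (prefix_word s p l).1 = p.
Proof. exact: size_mkseq. Qed.

Lemma sub_prefix_word s l p : (p <= l)%N ->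
  (take p (prefix_word s l j).1, take j (drop p (ys_word s 0 (l + j)))) =
  prefix_word s p j.
Proof.
move=> pl; rewrite drop_ys_word take_ys_word; last by lia.
by rewrite /prefix_word /= /mkseq -map_take take_iota (minn_idPl pl).
Qed.

Lemma sub_sum_xs s l p : (p < l)%N ->
  sum_x (take p (prefix_word s l j).1)
    (take j.+1 (drop p (ys_word s 0 (l + j)))) = sum_xs s p.
Proof.
move=> pl; rewrite drop_ys_word take_ys_word; last by lia.
by rewrite /sum_xs /= /mkseq -map_take take_iota (minn_idPl (ltnW pl)).
Qed.

Lemma cylinder_mass1 s : cmass (prefix_word s 1 j) =
  t (prefix_word s 1 j) * sum_xs s 0 `^ (e1 - 1) * head_mass j (ys_word s 0 j).
Proof.
rewrite /cylinder_mass prefix_word_snd size_prefix_word sub_prefix_word //.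
rewrite sub_sum_xs // [X in _ * X]big_geq // mulr1 -!mulrA; congr (_ * (_ * _)).
rewrite /head_mass mulrC; congr (_ / _).
rewrite big_add1 big_nat_rev big_nat_cond [RHS]big_nat_cond.
apply: eq_bigr => i /andP[/andP[_ ij] _]; rewrite add0n.
have -> : (j - (j - i.+1) = i.+1)%N by rewrite subKn.
by rewrite !take_ys_word ?add1n // ltnW.
Qed.

Lemma cylinder_massS s k : cmass (prefix_word s k.+2 j) =
  cmass (prefix_word s k.+1 j) * (t (prefix_word s k.+2 j) *
     sum_xs s k.+1 `^ (e1 - 1) / t (prefix_word s k.+1 j) `^ e2).
Proof.
rewrite /cylinder_mass !prefix_word_snd !size_prefix_word.
rewrite !sub_prefix_word // !sub_sum_xs //.
rewrite big_nat_recr // !sub_prefix_word // !sub_sum_xs // -[RHS]mulrA.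
congr (_ * _ * (_ * _)).
  rewrite big_nat_cond [RHS]big_nat_cond; apply: eq_bigr => p /andP[/andP[_ pj] _].
  by rewrite !take_ys_word //; lia.
rewrite big_nat_cond [RHS]big_nat_cond; apply: eq_bigr => p /andP[/andP[p2 pk] _].
by rewrite !sub_prefix_word ?sub_sum_xs //; lia.
Qed.

(** Used for [ys] of length j + 1: summing out the first x-letter under [ys] leads back to words
    with j trailing y-letters, where the masses [G] are known. *)
Definition next_sum (G : word m1 m2 -> R) w (ys : seq (letter m2)) : R :=
  if ys is y :: z then \sum_x G (rcons w (x, y), z) else 0.

(* The mass of the cylinder of (w, z) for size z = j. The theorem prescribes it
   for nonempty w only; for empty w it is forced by additivity. *)
Definition node_mass (u : word m1 m2) : R :=
  if is_prefix u then
    if u.1 is [::] then \sum_y next_sum (fun u' =>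
      if is_prefix u' then cmass u' else 0) [::] (rcons u.2 y)
    else cmass u
  else 0.

Lemma is_prefix_rcons_fst w x y z :
  is_prefix (rcons w (x, y), z) -> is_prefix (w, y :: z).
Proof.
move=> /is_prefixP[s Os /cylinderP[/= h1 h2]]; apply/is_prefixP; exists s => //.
move: h1; rewrite size_rcons mkseqS => /rcons_inj[h1 h3].
apply/cylinderP; split=> //= -[|k] kz; first by rewrite addn0 h3.
by rewrite -addSnnS -(size_rcons w (x, y)) h2.
Qed.

Lemma is_prefix_rcons_snd w z y : is_prefix (w, rcons z y) -> is_prefix (w, z).
Proof.
move=> /is_prefixP[s Os /cylinderP[/= h1 h2]]; apply/is_prefixP; exists s => //.
apply/cylinderP; split=> //= k kz.
by rewrite h2 ?size_rcons ?ltnS 1?ltnW // nth_rcons kz.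
Qed.

Lemma next_sum_prefix (G : word m1 m2 -> R) w ys :
  (forall u, ~~ is_prefix u -> G u = 0) -> ~~ is_prefix (w, ys) ->
  next_sum G w ys = 0.
Proof.
case: ys => [|y z] // h hp; rewrite /next_sum big1 // => x _; apply: h.
by apply: contra hp; exact: is_prefix_rcons_fst.
Qed.

Lemma node_massN u : ~~ is_prefix u -> node_mass u = 0.
Proof. by rewrite /node_mass => /negbTE ->. Qed.

Lemma node_massS s p : Omega s ->
  node_mass (prefix_word s p.+1 j) = cmass (prefix_word s p.+1 j).
Proof. by move=> Os; rewrite /node_mass is_prefix_word. Qed.

Lemma node_mass_rcons w c z :
  node_mass (rcons w c, z) = if is_prefix (rcons w c, z) then cmass (rcons w c, z) else 0.
Proof. by rewrite /node_mass; case: ifP => //; case: w. Qed.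

Lemma powR_split (a r : R) : 0 < a -> 0 < r -> a * a `^ (r - 1) = a `^ r.
Proof. by move=> a0 r0; rewrite mulr_powRB1 // ltW. Qed.

(** All terms share the factor [sum_xs s p] to the power e1 - 1, and the values of t in front add up
    to [sum_xs s p]. The resulting power e1 is the summand in the equation for t if p > 0, and
    S_(j+1) if p = 0. *)
Lemma next_sum_xs s p : Omega s ->
  next_sum node_mass (mkseq s p) (ys_word s p j.+1) =
  sum_xs s p `^ e1 *
  (if p is p'.+1 then node_mass (prefix_word s p j) / t (prefix_word s p j) `^ e2
   else head_mass j (ys_word s 0 j)).
Proof.
move=> Os; rewrite ys_wordS /next_sum.
have E x : node_mass (rcons (mkseq s p) (x, (s p).2), ys_word s p.+1 j) =
  (if is_prefix (rcons (mkseq s p) (x, (s p).2), ys_word s p.+1 j)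
  then t (rcons (mkseq s p) (x, (s p).2), ys_word s p.+1 j) else 0) *
  (sum_xs s p `^ (e1 - 1) *
  (if p is p'.+1 then node_mass (prefix_word s p j) / t (prefix_word s p j) `^ e2
   else head_mass j (ys_word s 0 j))).
  rewrite node_mass_rcons; case: ifPn => [h|_]; last by rewrite mul0r.
  (* The formulas are stated along points: take [s'] in [Omega] with this prefix and transfer to
     [s'] the quantities that depend only on the letters shared with [s]. *)
  have [s' Os'] := prefix_wordP h.
  rewrite /= size_rcons !size_mkseq => E.
  have [E1 E2] : mkseq s p = mkseq s' p /\ ys_word s p j.+1 = ys_word s' p j.+1.
    have := congr1 fst E; rewrite /= mkseqS => /rcons_inj[-> E2].
    by split=> //; rewrite !ys_wordS -E2 /=; have /= -> := congr1 snd E.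
  have E3 : sum_xs s p = sum_xs s' p by rewrite /sum_xs E1 E2.
  have E4 l : (l <= j.+1)%N -> prefix_word s p l = prefix_word s' p l.
    by move=> lj; rewrite /prefix_word E1 -(take_ys_word s p lj) E2 take_ys_word.
  rewrite E E3 E4 //; case: p E1 E2 E3 E4 E {h} => [|p] E1 E2 E3 E4 E.
    rewrite cylinder_mass1 -mulrA; congr (_ * (_ * _)).
    by have /= -> := congr1 snd (E4 j (leqnSn _)).
  by rewrite cylinder_massS node_massS //; ring.
rewrite (eq_bigr _ (fun x _ => E x)) -mulr_suml -big_mkcond -sum_xsE.
by rewrite mulrA powR_split // sum_xs_gt0.
Qed.

(** Additivity over the next [y]. For nonempty [w] it is the equation for t, whose left-hand side is
    the common denominator of the terms; for empty [w] it is how [node_mass] was defined. *)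
Lemma node_mass_next w z : size z = j ->
  node_mass (w, z) = \sum_y next_sum node_mass w (rcons z y).
Proof.
move=> zj; have [h|h] := boolP (is_prefix (w, z)); last first.
  rewrite node_massN // big1 // => y _; apply: next_sum_prefix.
    exact: node_massN.
  by apply: contra h; exact: is_prefix_rcons_snd.
case: w h => [|c w] h.
  rewrite {1}/node_mass h; apply: eq_bigr => y _; case: (rcons z y) => [//|y' z'].
  rewrite /next_sum.
  by apply: eq_bigr => x _; rewrite (node_mass_rcons [::]).
have [s Os E] := prefix_wordP h; move: E; rewrite /= zj => E.
rewrite E (bigID (fun y => is_prefix (mkseq s (size w).+1, rcons z y))) /=.
rewrite [X in _ + X]big1 ?addr0; last first.
  move=> y hy; have /= -> := congr1 fst E; apply: next_sum_prefix => //; exact: node_massN.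
have [Ew Ez] : c :: w = mkseq s (size w).+1 /\ z = ys_word s (size w).+1 j.
  by split; [exact: (congr1 fst E) | exact: (congr1 snd E)].
have [_ Et] := t_prefix_word (size w) Os.
have tp : 0 < t (prefix_word s (size w).+1 j) `^ e2.
  apply: powR_gt0; have [/andP[h1 _] _] := t_prefix_word (size w) Os.
  exact: lt_le_trans h1.
rewrite Ew Ez; move: Et tp; set p := (size w).+1 => Et tp.
transitivity (\sum_(y | is_prefix (mkseq s p, rcons (ys_word s p j) y))
   sum_x (mkseq s p) (rcons (ys_word s p j) y) `^ e1 *
   (node_mass (prefix_word s p j) / t (prefix_word s p j) `^ e2)).
  by rewrite -mulr_suml -Et mulrC divfK // gt_eqF.
apply: eq_bigr => y hy.
have [s' Os'] := prefix_wordP hy.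
have -> : size (mkseq s p, rcons (ys_word s p j) y).1 = p by exact: size_mkseq.
have -> : size (mkseq s p, rcons (ys_word s p j) y).2 = j.+1.
  by rewrite size_rcons size_mkseq.
move=> E'; have E1 : mkseq s p = mkseq s' p := congr1 fst E'.
have E2 : rcons (ys_word s p j) y = ys_word s' p j.+1 := congr1 snd E'.
have E3 : ys_word s p j = ys_word s' p j.
  by move: E2; rewrite ys_word_rcons => /rcons_inj[].
by rewrite E2 /prefix_word E1 E3 next_sum_xs.
Qed.

(** The mass that additivity forces on the cylinder of [(w, z)] when [z] is [n] letters short of
    [j]. *)
Fixpoint node_sum n w z : R :=
  if n is n'.+1 then \sum_y node_sum n' w (rcons z y) else node_mass (w, z).

Lemma node_sum_fst n w y z : (size z + n.+1)%N = j ->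
  node_sum n w (y :: z) = \sum_x node_sum n.+1 (rcons w (x, y)) z.
Proof.
elim: n z => [|n IH] z zj.
  rewrite /= node_mass_next /=; last by rewrite -zj addn1.
  by rewrite exchange_big.
rewrite /= (eq_bigr _ (fun y' _ => IH (rcons z y') _)) => [|y' _ /=].
  by rewrite exchange_big.
by rewrite size_rcons -zj addSnnS.
Qed.

Lemma node_sum0 n w z : ~~ is_prefix (w, z) -> node_sum n w z = 0.
Proof.
elim: n z => [|n IH] z h /=; first exact: node_massN.
rewrite big1 // => y _; apply: IH; apply: contra h.
exact: is_prefix_rcons_snd.
Qed.

(** W_l to the power (1 - q) / q in [head_mass] turns W_l into its power 1 / q, which is S_l;
    summing S_l over y_l gives W_(l-1). *)
Lemma node_sum_head n s : (n <= j)%N -> Omega s ->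
  node_sum n [::] (ys_word s 0 (j - n)) =
  W (j - n) (ys_word s 0 (j - n)) * head_mass (j - n) (ys_word s 0 (j - n)).
Proof.
elim: n s => [|n IH] s nj Os.
  rewrite subn0 /= node_mass_next ?size_mkseq //.
  rewrite (bigID (fun y => is_prefix ([::], rcons (ys_word s 0 j) y))) /=.
  rewrite [X in _ + X]big1 ?addr0; last first.
    by move=> y hy; apply: next_sum_prefix => //; exact: node_massN.
  rewrite /W_ /sum_y mulr_suml; apply: eq_bigr => y hy.
  have [s' Os'] := prefix_wordP hy.
  have -> : size (Nil A, rcons (ys_word s 0 j) y).2 = j.+1.
    by rewrite size_rcons size_mkseq.
  move=> E'; have E2 : rcons (ys_word s 0 j) y = ys_word s' 0 j.+1 := congr1 snd E'.
  have E3 : ys_word s 0 j = ys_word s' 0 j.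
    by move: E2; rewrite ys_word_rcons => /rcons_inj[].
  by rewrite E2 E3 S_last; exact: (next_sum_xs 0 Os').
have -> : node_sum n.+1 [::] (ys_word s 0 (j - n.+1)) =
  \sum_y node_sum n [::] (rcons (ys_word s 0 (j - n.+1)) y) by [].
set l := (j - n.+1)%N; have lE : (j - n = l.+1)%N by rewrite /l subnSK.
rewrite (bigID (fun y => is_prefix ([::], rcons (ys_word s 0 l) y))) /=.
rewrite [X in _ + X]big1 ?addr0; last by move=> y; exact: node_sum0.
rewrite /W_ {1}/sum_y mulr_suml; apply: eq_bigr => y hy.
have [s' Os'] := prefix_wordP hy.
have -> : size (Nil A, rcons (ys_word s 0 l) y).2 = l.+1.
  by rewrite size_rcons size_mkseq.
move=> E'; have E2 : rcons (ys_word s 0 l) y = ys_word s' 0 l.+1 := congr1 snd E'.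
have E3 : ys_word s 0 l = ys_word s' 0 l.
  by move: E2; rewrite ys_word_rcons => /rcons_inj[].
have lj : (l < j)%N by rewrite -lE leq_subr.
rewrite E2 E3 -lE IH // ?(ltnW nj) // lE S_W // /head_mass big_nat_recr //.
rewrite take_ys_word //; have W0 := W_gt0 Os' lj.
have -> : \prod_(1 <= i < l.+1) W i (take i (ys_word s' 0 l.+1)) `^ ((1 - q%:R) / q%:R) =
    \prod_(1 <= i < l.+1) W i (take i (ys_word s' 0 l)) `^ ((1 - q%:R) / q%:R).
  rewrite big_nat_cond [RHS]big_nat_cond; apply: eq_bigr => i /andP[/andP[_ il] _].
  by rewrite !take_ys_word // ltnW.
have -> : W l.+1 (ys_word s' 0 l.+1) `^ q%:R^-1 =
    W l.+1 (ys_word s' 0 l.+1) * W l.+1 (ys_word s' 0 l.+1) `^ ((1 - q%:R) / q%:R).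
  rewrite (_ : (1 - q%:R) / q%:R = q%:R^-1 - 1) ?powR_split ?invr_gt0 ?ltr0n ?(ltnW q_gt1) //.
  by rewrite mulrBl mul1r divff // pnatr_eq0 -lt0n ltnW.
by rewrite /=; ring.
Qed.

Lemma node_sum_total : node_sum j [::] [::] = 1.
Proof.
have [s Os] := Omega0; have := node_sum_head (leqnn j) Os.
rewrite subnn => ->; rewrite /head_mass big_geq // W0 div1r divff //.
by rewrite gt_eqF // t0_gt0.
Qed.

Lemma head_mass_gt0 s l : Omega s -> (l <= j)%N -> 0 < head_mass l (ys_word s 0 l).
Proof.
move=> Os lj; rewrite /head_mass divr_gt0 ?t0_gt0 // big_nat_cond.
apply: prodr_gt0 => i /andP[/andP[_ il] _].
by rewrite take_ys_word //; apply/powR_gt0/W_gt0 => //; lia.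
Qed.

Lemma t_word_gt0 s p : Omega s -> 0 < t (prefix_word s p.+1 j).
Proof.
by move=> Os; have [/andP[h _] _] := t_prefix_word p Os; exact: lt_le_trans h.
Qed.

Lemma cylinder_mass_gt0 s p : Omega s -> 0 < cmass (prefix_word s p.+1 j).
Proof.
move=> Os; have tp k := t_word_gt0 k Os; have xp k := sum_xs_gt0 k Os.
elim: p => [|p IH].
  rewrite cylinder_mass1; apply: mulr_gt0; last exact: head_mass_gt0.
  by apply: mulr_gt0 => //; exact: powR_gt0.
rewrite cylinder_massS; apply: mulr_gt0 => //.
by apply: divr_gt0; [apply: mulr_gt0 => //|]; exact: powR_gt0.
Qed.

Lemma node_mass_ge0 u : size u.2 = j -> 0 <= node_mass u.
Proof.
case: u => w z /= zj; have [h|h] := boolP (is_prefix (w, z)); last by rewrite node_massN.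
case: w h => [|c w] h.
  rewrite node_mass_next //; apply: sumr_ge0 => y _.
  have zyj : (size (rcons z y) = j.+1)%N by rewrite size_rcons zj.
  case: (rcons z y) zyj => // y' z' [zj']; apply: sumr_ge0 => x _.
  rewrite node_mass_rcons; case: ifPn => // /prefix_wordP[s Os ->].
  by rewrite /= zj' ltW // cylinder_mass_gt0.
rewrite /node_mass h; have [s Os ->] := prefix_wordP h.
by rewrite /= zj ltW // cylinder_mass_gt0.
Qed.

Lemma node_sum_ge0 n w z : (size z + n = j)%N -> 0 <= node_sum n w z.
Proof.
elim: n z => [|n IH] z; first by rewrite addn0 => zj; exact: node_mass_ge0.
by move=> zj /=; apply: sumr_ge0 => y _; apply: IH; rewrite size_rcons addSnnS.
Qed.

(** The extension theorem fixes the masses of initial words; those of words with trailing y-letters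
    follow since [node_sum_fst] and [mass_letter] are the same recursion. *)
Lemma optimal_tree_exists : exists mu : proba, forall w z, (size z <= j)%N ->
  mass mu (w, z) = node_sum (j - size z) w z.
Proof.
have [] := @mass_extension m1 m2 R (fun w => node_sum j w [::]).
- by move=> w; exact: node_sum_ge0.
- exact: node_sum_total.
- move=> w; rewrite (eq_bigr (fun c : A => node_sum j (rcons w (c.1, c.2)) [::])); last by case.
  rewrite -(pair_bigA _ (fun x y => node_sum j (rcons w (x, y)) [::])) /=.
  rewrite exchange_big /=.
  case E : j => [|n]; last first.
    by rewrite /=; apply: eq_bigr => y _; rewrite node_sum_fst // E.
  by rewrite /= node_mass_next ?E.
move=> mu hmu; exists mu => w z; elim: z w => [|y z IH] w zj.
  by rewrite subn0 hmu.
rewrite mass_letter (eq_bigr _ (fun x _ => IH _ (ltnW zj))).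
have -> : (j - size z = (j - (size z).+1).+1)%N by rewrite subnSK.
by rewrite -node_sum_fst // subnSK // subnKC // ltnW.
Qed.

(** Summing over the trailing y-letters recovers the masses of all nonempty initial words, and these
    determine the measure. *)
Lemma same_mass_node (P Q : proba) :
  (forall w z, (0 < size w)%N -> size z = j -> mass P (w, z) = mass Q (w, z)) ->
  same_measure P Q.
Proof.
move=> h; apply: same_measure_mass => -[|c w]; first by rewrite !mass_nil.
suff H n z : (size z + n = j)%N -> mass P (c :: w, z) = mass Q (c :: w, z).
  exact: (H j).
elim: n z => [|n IH] z; first by rewrite addn0; exact: h.
move=> zj; rewrite !(mass_letter_snd _ _ z); apply: eq_bigr => y _.
by apply: IH; rewrite size_rcons addSnnS.
Qed.

Lemma mass_nonprefix (mu : proba) (u : word m1 m2) :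
  (forall w, ~~ is_prefix (w, [::]) -> mass mu (w, [::]) = 0) ->
  ~~ is_prefix u -> mass mu u = 0.
Proof.
move=> h; case: u => w z; elim: z w => [|y z IH] w hu; first exact: h.
rewrite mass_letter big1 // => x _; apply: IH; apply: contra hu.
exact: is_prefix_rcons_fst.
Qed.

Section Optimal.
Hypothesis closedOmega : closed Omega.
Context (mu : proba).
Hypothesis mu_node : forall w z, (size z <= j)%N ->
  mass mu (w, z) = node_sum (j - size z) w z.

Lemma mass_node w z : size z = j -> mass mu (w, z) = node_mass (w, z).
Proof. by move=> zj; rewrite mu_node ?zj // subnn. Qed.

Lemma optimal_supported : supported_on Omega mu.
Proof.
apply/supported_mass => // u; apply: mass_nonprefix => w hw.
by rewrite mu_node // node_sum0.
Qed.

Lemma optimal_has_masses : has_cylinder_masses q j Omega t mu.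
Proof.
move=> [//|k] [w z] _ [/= wk zj hp]; rewrite massE mass_node // /node_mass hp.
by case: w wk {hp}.
Qed.

Lemma has_masses_unique (nu : proba) : supported_on Omega nu ->
  has_cylinder_masses q j Omega t nu -> same_measure nu mu.
Proof.
move=> nuO hnu; apply: same_mass_node => w z w0 zj.
have [h|h] := boolP (is_prefix (w, z)); last first.
  by rewrite mass_node // node_massN // ((supported_mass closedOmega nu).1 nuO).
have hP : Pref Omega (size w) j (w, z) by [].
have := hnu _ _ w0 hP; rewrite massE => -[->].
by have := optimal_has_masses w0 hP; rewrite massE => -[->].
Qed.

(* Writing the mass of a cylinder in the order in which letters are revealed,
   y_1, ..., y_(j+1), x_1, y_(j+2), x_2, ..., its logarithm becomes a sum of one
   term per letter; ln_num is for the y and ln_den is the normalization. *)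
Definition ln_t s r := ln (t (prefix_word s r.+1 j)).
Definition ln_x s r := ln (sum_xs s r).
Definition ln_den s a :=
  if (a <= j)%N then ln (W a (ys_word s 0 a)) else e2 * ln_t s (a - j.+1).
Definition ln_num s a :=
  if (a < j)%N then ln_den s a.+1 / q%:R else e1 * ln_x s (a - j).
Definition ln_word s p p' :=
  \sum_(0 <= r < p) (ln_t s r - ln_x s r) +
  \sum_(0 <= a < p') (ln_num s a - ln_den s a).

Let q_neq0 : q%:R != 0 :> R.
Proof. by rewrite pnatr_eq0 -lt0n ltnW. Qed.

Lemma ln_head_mass s l : Omega s -> (l <= j)%N ->
  ln (head_mass l (ys_word s 0 l)) = ln_word s 0 l - ln_den s l.
Proof.
move=> Os; elim: l => [|l IH] lj.
  rewrite /ln_word !big_geq // /ln_den leq0n /head_mass big_geq // div1r W0.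
  by rewrite lnV ?posrE ?t0_gt0 // addr0 sub0r.
have -> : head_mass l.+1 (ys_word s 0 l.+1) = head_mass l (ys_word s 0 l) *
    W l.+1 (ys_word s 0 l.+1) `^ ((1 - q%:R) / q%:R).
  rewrite /head_mass big_nat_recr // take_ys_word // -!mulrA; congr (_ * _).
    rewrite big_nat_cond [RHS]big_nat_cond; apply: eq_bigr => i /andP[/andP[_ il] _].
    by rewrite !take_ys_word // ltnW.
  by rewrite mulrC.
have W0 := W_gt0 Os lj.
rewrite lnM ?posrE ?head_mass_gt0 ?powR_gt0 ?(ltnW lj) // ln_powR IH ?(ltnW lj) //.
rewrite /ln_word big_nat_recr //= /ln_num lj /ln_den lj (ltnW lj).
by field.
Qed.

(** With [ln_mass_eq] and [ln_mass_next] this covers the shapes cut out by a ball on a chain: no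
    x-letter, or p of them with j or j + 1 further y-letters. *)
Lemma ln_mass_head s l : Omega s -> (l <= j)%N ->
  0 < mass mu (prefix_word s 0 l) /\
  ln (mass mu (prefix_word s 0 l)) = ln_word s 0 l.
Proof.
move=> Os lj; rewrite mu_node ?size_mkseq //.
have := node_sum_head (leq_subr l j) Os; rewrite subKn // => ->.
have h1 := W_gt0 Os lj; have h2 := head_mass_gt0 Os lj.
split; first by rewrite mulr_gt0.
rewrite lnM ?posrE // ln_head_mass //.
rewrite {1}(_ : ln (W l _) = ln_den s l); last by rewrite /ln_den lj.
by rewrite addrC subrK.
Qed.

Lemma ln_word_y s p p' :
  ln_word s p p'.+1 = ln_word s p p' + (ln_num s p' - ln_den s p').
Proof. by rewrite /ln_word big_nat_recr //= addrA. Qed.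

Lemma ln_word_x s p p' :
  ln_word s p.+1 p' = ln_word s p p' + (ln_t s p - ln_x s p).
Proof. by rewrite /ln_word big_nat_recr //= addrAC. Qed.

Lemma ln_num_ge s p : ln_num s (p + j) = e1 * ln_x s p.
Proof. by rewrite /ln_num ltnNge leq_addl addnK. Qed.

Lemma ln_den_gt s p : ln_den s (p.+1 + j) = e2 * ln_t s p.
Proof. by rewrite /ln_den leqNgt addSn ltnS leq_addl -addnS addnK. Qed.

Lemma mass_next s p : Omega s -> mass mu (prefix_word s p j.+1) =
  sum_xs s p `^ e1 *
  (if p is p'.+1 then cmass (prefix_word s p j) / t (prefix_word s p j) `^ e2
   else head_mass j (ys_word s 0 j)).
Proof.
move=> Os; transitivity (next_sum node_mass (mkseq s p) (ys_word s p j.+1)).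
  rewrite /prefix_word ys_wordS mass_letter; apply: eq_bigr => x _.
  by rewrite mass_node // size_mkseq.
by rewrite next_sum_xs //; case: p => // p; rewrite node_massS.
Qed.

Lemma lnM_gt0 (x y : R) : 0 < x -> 0 < y -> ln (x * y) = ln x + ln y.
Proof. by move=> x0 y0; rewrite lnM ?posrE. Qed.

Lemma ln_div_gt0 (x y : R) : 0 < x -> 0 < y -> ln (x / y) = ln x - ln y.
Proof. by move=> x0 y0; rewrite ln_div ?posrE. Qed.

Lemma ln_cylinder_mass s p : Omega s ->
  ln (cmass (prefix_word s p.+1 j)) = ln_word s p.+1 (p.+1 + j).
Proof.
move=> Os; have tp k := t_word_gt0 k Os; have xp k := sum_xs_gt0 k Os.
have xe k e : 0 < sum_xs s k `^ e by exact: powR_gt0.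
have te k : 0 < t (prefix_word s k.+1 j) `^ e2 by exact: powR_gt0.
elim: p => [|p IH].
  have hm := head_mass_gt0 Os (leqnn j).
  rewrite cylinder_mass1 lnM_gt0 // ?mulr_gt0 // lnM_gt0 // ln_powR ln_head_mass //.
  have := ln_num_ge s 0; rewrite add0n => E0.
  rewrite ln_word_x add1n ln_word_y E0 /ln_t /ln_x.
  by ring.
have cp := cylinder_mass_gt0 p Os.
rewrite cylinder_massS lnM_gt0 // ?divr_gt0 // ?mulr_gt0 // IH.
rewrite ln_div_gt0 // ?mulr_gt0 // lnM_gt0 // !ln_powR.
rewrite (ln_word_x s p.+1) (addSn p.+1) ln_word_y ln_num_ge ln_den_gt /ln_t /ln_x.
by ring.
Qed.

Lemma ln_mass_eq s p : Omega s -> (0 < p)%N ->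
  0 < mass mu (prefix_word s p j) /\
  ln (mass mu (prefix_word s p j)) = ln_word s p (p + j).
Proof.
case: p => // p Os _; rewrite mass_node ?size_mkseq // -/(prefix_word s p.+1 j).
rewrite node_massS //; split; first exact: cylinder_mass_gt0.
exact: ln_cylinder_mass.
Qed.

Lemma ln_mass_next s p : Omega s ->
  0 < mass mu (prefix_word s p j.+1) /\
  ln (mass mu (prefix_word s p j.+1)) = ln_word s p (p + j.+1).
Proof.
move=> Os; rewrite mass_next //.
have tp k := t_word_gt0 k Os; have xp k := sum_xs_gt0 k Os.
have xe k e : 0 < sum_xs s k `^ e by exact: powR_gt0.
have te k : 0 < t (prefix_word s k.+1 j) `^ e2 by exact: powR_gt0.
rewrite addnS ln_word_y ln_num_ge; case: p => [|p].
  have hm := head_mass_gt0 Os (leqnn j).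
  split; first by rewrite mulr_gt0.
  rewrite lnM_gt0 // ln_powR ln_head_mass // /ln_x add0n.
  by ring.
have cp := cylinder_mass_gt0 p Os.
split; first by rewrite mulr_gt0 // divr_gt0.
rewrite lnM_gt0 // ?divr_gt0 // ln_div_gt0 // !ln_powR.
by rewrite ln_cylinder_mass // ln_den_gt /ln_t /ln_x; ring.
Qed.

End Optimal.

End OptimalTree.

(** * Entropy *)

Section ChainSums.
Context (R : realType) (q : nat) (q_gt1 : (1 < q)%N).
Implicit Types (f : nat -> R) (N : nat) (M : R).

Definition chain_sum f N : R :=
  \sum_(i <- nondiv q N) \sum_(0 <= r < nchain q i N) f r.

Let q_gt0 : (0 < q)%N. Proof. exact: ltnW. Qed.
Let qR_gt1 : 1 < q%:R :> R. Proof. by rewrite ltr1n. Qed.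
Let qR_gt0 : 0 < q%:R :> R. Proof. by rewrite ltr0n. Qed.

Lemma size_nondiv N : (size (nondiv q N) + N %/ q)%N = N.
Proof.
elim: N => [|N IH]; first by rewrite div0n.
have -> : nondiv q N.+1 = nondiv q N ++ if (q %| N.+1)%N then [::] else [:: N.+1].
  rewrite /nondiv /index_iota !subSS !subn0.
  have -> : iota 1 N.+1 = iota 1 N ++ [:: N.+1] by have := iotaD 1 N 1; rewrite addn1.
  by rewrite filter_cat /=; case: ifP => /= [/negbTE ->|/negbFE ->].
rewrite divnS // size_cat; case: (q %| N.+1)%N => /=.
  by rewrite addn0 addnCA IH.
by rewrite add0n addnAC IH addn1.
Qed.

Lemma nchain_div i N : i \in nondiv q N -> nchain q i N = (nchain q i (N %/ q)).+1.
Proof.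
rewrite mem_nondiv => /and3P[i0 iN qi]; apply: eq_ltn => -[|l]; rewrite ltn_nchain //.
  by rewrite muln1 iN.
by rewrite ltnS ltn_nchain // leq_divRL // expnSr mulnA.
Qed.

(** Removing the first point of every chain turns the chains up to N into those up to N / q, and
    there are N - N / q first points. *)
Lemma chain_sum_rec f N : chain_sum f N =
  f 0%N * (N - N %/ q)%:R + chain_sum (fun r => f r.+1) (N %/ q).
Proof.
rewrite /chain_sum -(@big_nondiv q _ _ _ _ (N %/ q) N) ?leq_div //; last first.
  by move=> i lt; rewrite nchain_gt // big_geq.
have -> : (N - N %/ q)%N = size (nondiv q N) by rewrite -{1}(size_nondiv N) addnK.
rewrite big_seq (eq_bigr (fun i => f 0%N +
    \sum_(0 <= r < nchain q i (N %/ q)) f r.+1)); last first.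
  by move=> i iN; rewrite nchain_div // big_nat_recl.
rewrite -big_seq big_split /= big_const_seq count_predT iter_addr_0.
by rewrite mulr_natr.
Qed.

Lemma chain_sum_le_range f n N : (n <= N)%N ->
  \sum_(i <- nondiv q N) \sum_(0 <= r < nchain q i n) f r = chain_sum f n.
Proof.
by move=> nN; rewrite (@big_nondiv q _ _ _ _ n N) // => i lt; rewrite nchain_gt // big_geq.
Qed.

(* (q - 1) / q^(k+1) is the limit of 1/N times the number of chains with more
   than k points up to N. *)
Let dterm f k := (q%:R - 1) / q%:R ^+ k.+1 * f k.

Definition density f := limn (series (dterm f)).

Let dterm_bound M f : (forall r, `|f r| <= M) -> forall k,
  `|dterm f k| <= geometric (M * (q%:R - 1) / q%:R) (q%:R^-1) k.
Proof.
move=> h k; rewrite /dterm /geometric /= normrM.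
rewrite (ger0_norm (x := (q%:R - 1) / q%:R ^+ k.+1)); last first.
  by rewrite divr_ge0 ?exprn_ge0 ?subr_ge0 // ltW.
rewrite exprS invfM exprVn -!mulrA [leRHS]mulrC -!mulrA ler_pM2l ?subr_gt0 //.
by rewrite ler_pM2l ?invr_gt0 // ler_pM2l ?invr_gt0 ?exprn_gt0.
Qed.

Lemma cvg_density M f : (forall r, `|f r| <= M) ->
  series (dterm f) @ \oo --> density f.
Proof.
move=> h; apply: normed_cvg.
apply: series_le_cvg (dterm_bound h) _ => [n|n|]; first exact: normr_ge0.
  exact: le_trans (dterm_bound h n).
apply: is_cvg_geometric_series.
by rewrite normfV ger0_norm ?ltW // invf_lt1.
Qed.

Lemma density_rec M f : (forall r, `|f r| <= M) ->
  density f = (1 - q%:R^-1) * f 0%N + density (fun r => f r.+1) / q%:R.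
Proof.
move=> h; apply/cvg_lim => //.
rewrite -cvg_shiftS.
rewrite (_ : (fun n => _) = (fun n => (1 - q%:R^-1) * f 0%N +
    series (dterm (fun r => f r.+1)) n / q%:R)).
  apply: cvgD; first exact: cvg_cst.
  by apply: cvgMr_tmp; apply: (@cvg_density M).
apply/funext => n; rewrite /series /= big_nat_recl //; congr (_ + _).
  rewrite /dterm expr1 mulrBl divff ?mul1r // gt_eqF //.
rewrite mulr_suml; apply: eq_bigr => i _; rewrite /dterm exprS invfM.
by ring.
Qed.

Lemma densityZ M a f : (forall r, `|f r| <= M) ->
  density (fun r => a * f r) = a * density f.
Proof.
move=> h; apply/cvg_lim => //.
rewrite (_ : series _ = (fun n => a * series (dterm f) n)).
  by apply: cvgMl_tmp; apply: (@cvg_density M).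
apply/funext => n; rewrite /series /= mulr_sumr; apply: eq_bigr => i _.
by rewrite /dterm; ring.
Qed.

Lemma densityB M f h : (forall r, `|f r| <= M) -> (forall r, `|h r| <= M) ->
  density (fun r => f r - h r) = density f - density h.
Proof.
move=> hf hh; apply/cvg_lim => //.
rewrite (_ : series _ = (fun n => series (dterm f) n - series (dterm h) n)).
  by apply: cvgB; apply: (@cvg_density M).
apply/funext => n; rewrite /series /= -sumrB; apply: eq_bigr => i _.
by rewrite /dterm; ring.
Qed.

Lemma density_bound M f : (forall r, `|f r| <= M) -> `|density f| <= M.
Proof.
move=> h.
have M0 : 0 <= M by apply: le_trans (h 0%N).
suff H n : `|series (dterm f) n| <= M.
  apply: (@closed_cvg _ _ _ _ (fun n => `|series (dterm f) n|) (fun x => x <= M)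
    _ _ _ (cvg_norm (cvg_density h))); first exact: closed_le.
  by apply: nearW => n; exact: H.
have geo k : \sum_(0 <= i < k) (q%:R - 1) / q%:R ^+ i.+1 = 1 - q%:R ^- k :> R.
  elim: k => [|k IH]; first by rewrite big_geq // expr0 invr1 subrr.
  rewrite big_nat_recr //= IH exprS; field.
  by rewrite expf_neq0 ?gt_eqF.
apply: le_trans (ler_norm_sum _ _ _) _.
apply: (@le_trans _ _ (\sum_(0 <= i < n) ((q%:R - 1) / q%:R ^+ i.+1) * M)).
  apply: ler_sum => i _.
  have cp : 0 < (q%:R - 1) / q%:R ^+ i.+1 :> R.
    by rewrite divr_gt0 ?exprn_gt0 ?subr_gt0.
  by rewrite /dterm normrM gtr0_norm // ler_pM2l.
by rewrite -mulr_suml geo -[leRHS]mul1r ler_wpM2r // lerBlDr lerDl invr_ge0.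
Qed.

(** One use of [chain_sum_rec] costs at most 2 M and at least halves N, so e N absorbs the cost once
    e N >= 4 M. [K] depends on f only through [M]. *)
Lemma chain_sum_density M e : 0 < e -> exists K, forall f, (forall r, `|f r| <= M) ->
  forall N, `|chain_sum f N - density f * N%:R| <= e * N%:R + K.
Proof.
move=> e0; pose B := Num.bound (4 * M / e); exists (2 * M * B%:R) => f hf N.
have M0 : 0 <= M by apply: le_trans (hf 0%N).
have hB : 4 * M / e < B%:R.
  by apply: le_lt_trans (archi_boundP _); rewrite // ?divr_ge0 ?mulr_ge0 // ltW.
(* The crude bound 2 M N is carried along to settle N <= B. *)
suff : `|chain_sum f N - density f * N%:R| <= 2 * M * N%:R /\
       `|chain_sum f N - density f * N%:R| <= e * N%:R + 2 * M * B%:R by case.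
elim/ltn_ind: N f hf => N IH f hf.
have [->|N0] := posnP N.
  rewrite /chain_sum big_nil !mulr0 subrr normr0 add0r; split=> //.
  by rewrite !mulr_ge0.
set d := `|_|.
have hf' r : `|f r.+1| <= M by [].
have Nq : (N %/ q < N)%N by rewrite ltn_Pdiv.
have [IH1 IH2] := IH _ Nq (fun r => f r.+1) hf'.
set d' := `|chain_sum (fun r => f r.+1) (N %/ q) - _| in IH1 IH2.
(* The fractional part of N / q: [chain_sum_rec] rounds N / q down, [density_rec] does not. *)
pose fr : R := (N %% q)%:R / q%:R.
have fr0 : 0 <= fr by rewrite divr_ge0.
have fr1 : fr <= 1 by rewrite ler_pdivrMr // mul1r ler_nat ltnW // ltn_mod.
have NE : N%:R = q%:R * ((N %/ q)%:R + fr) :> R.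
  rewrite mulrDr /fr mulrC [q%:R * (_ / _)]mulrC divfK ?gt_eqF //.
  by rewrite -natrM -natrD -divn_eq.
have step : d <= 2 * M + d'.
  have -> : d = `|(f 0%N - density (fun r => f r.+1)) * fr +
      (chain_sum (fun r => f r.+1) (N %/ q) -
       density (fun r => f r.+1) * (N %/ q)%:R)|.
    rewrite /d chain_sum_rec (density_rec hf) natrB ?leq_div // NE; congr (`|_|).
    by field; rewrite gt_eqF.
  apply: le_trans (ler_normD _ _) _; rewrite lerD2r normrM (ger0_norm fr0).
  rewrite -[leRHS]mulr1 ler_pM // mulr_natl mulr2n.
  by apply: le_trans (ler_normB _ _) _; rewrite lerD // density_bound.
have Nq1 : (N %/ q)%:R + 1 <= N%:R :> R by rewrite natr1 ler_nat.
have h1 : d <= 2 * M * N%:R.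
  apply: le_trans step _; apply: (@le_trans _ _ (2 * M * ((N %/ q)%:R + 1))).
    by rewrite mulrDr mulr1 addrC lerD2r.
  by rewrite ler_wpM2l // mulr_ge0.
split=> //; have [NB|BN] := leqP N B.
  apply: le_trans h1 _; rewrite -[leLHS]add0r lerD // ?mulr_ge0 // ?(ltW e0) //.
  by rewrite ler_wpM2l ?mulr_ge0 // ler_nat.
have Nq2 : 2 * (N %/ q)%:R <= N%:R :> R.
  rewrite -natrM ler_nat; apply: leq_trans (leq_trunc_div N q).
  by rewrite mulnC leq_mul2l q_gt1 orbT.
have BN' : 4 * M <= e * N%:R.
  have : 4 * M / e <= N%:R by rewrite ltW // (lt_trans hB) // ltr_nat.
  by rewrite ler_pdivrMr // [N%:R * e]mulrC.
apply: le_trans step _; move: IH2; move: (2 * M * B%:R) => K hK.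
have : e * (2 * (N %/ q)%:R) <= e * N%:R by rewrite ler_pM2l.
by lra.
Qed.

(* The three relations make the densities of T, X, den and num cancel, except
   for the first term of den. *)
Lemma chain_sum_telescope (j : nat) (g : R) (L : nat -> nat)
    (T X den num : nat -> R) M e :
  0 < g -> (forall n, n%:R / g <= (L n)%:R <= n%:R / g + 1) ->
  (forall n, (n <= L n)%N) ->
  (forall r, `|T r| <= M) -> (forall r, `|X r| <= M) ->
  (forall r, `|den r| <= M) -> (forall r, `|num r| <= M) ->
  (forall a, den (a + j.+1)%N = q%:R ^+ j.+1 * g * T a) ->
  (forall a, (a < j)%N -> num a = den a.+1 / q%:R) ->
  (forall a, num (a + j)%N = q%:R ^+ j * g * X a) ->
  0 < e -> exists K, forall n,
  `|\sum_(i <- nondiv q (L n))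
      (\sum_(0 <= r < nchain q i n) (T r - X r) +
       \sum_(0 <= a < nchain q i (L n)) (num a - den a))
    + (1 - q%:R^-1) * den 0%N / g * n%:R| <= e * n%:R + K.
Proof.
move=> g0 hL nL hT hX hd hn den_ge num_lt num_ge e0.
have M0 : 0 <= M by apply: le_trans (hT 0%N).
have bnd (f h : nat -> R) : (forall r, `|f r| <= M) -> (forall r, `|h r| <= M) ->
    forall r, `|f r - h r| <= 2 * M.
  move=> hf hh r; apply: le_trans (ler_normB _ _) _.
  by rewrite mulr_natl mulr2n lerD.
have dens : density (fun a => num a - den a) =
    - g * density (fun r => T r - X r) - (1 - q%:R^-1) * den 0%N.
  rewrite (densityB hn hd) (density_rec hd).
  have hd' r : `|den r.+1| <= M by [].
  have -> : density (fun r => den r.+1) / q%:R =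
      density (fun r => den r.+1 / q%:R).
    rewrite mulrC -(densityZ q%:R^-1 hd'); congr density.
    by apply/funext => r; rewrite mulrC.
  have hd2 r : `|den r.+1 / q%:R| <= M.
    rewrite normrM normfV (gtr0_norm qR_gt0) ler_pdivrMr //.
    by rewrite (le_trans (hd' r)) // ler_peMr // ltW.
  rewrite opprD addrCA -(densityB hn hd2) addrC; congr (_ - _).
  (* A function that vanishes below [i] has the density of its shift by [i], divided by q^i. *)
  have shift i (h : nat -> R) (B : R) : (forall r, `|h r| <= B) ->
      (forall a, (a < i)%N -> h a = 0) ->
      density h = density (fun a => h (a + i)%N) / q%:R ^+ i.
    elim: i h => [|i IH] h hh h0.
      rewrite expr0 divr1; congr density; apply/funext => a; by rewrite addn0.
    rewrite (density_rec hh) h0 // mulr0 add0r (IH (fun r => h r.+1)) //; last first.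
      by move=> a ai; exact: h0.
    rewrite exprSr invfM mulrA; congr (_ * _ * _).
    by congr density; apply/funext => a; rewrite addnS.
  rewrite (shift j _ (2 * M)); last first.
  - by move=> a aj; rewrite num_lt // subrr.
  - exact: bnd.
  rewrite (_ : (fun a => _) = (fun a => (q%:R ^+ j * g * -1) * (T a - X a))).
    rewrite (densityZ _ (bnd _ _ hT hX)); field.
    by rewrite expf_neq0 // gt_eqF.
  apply/funext => a; rewrite num_ge -addnS den_ge exprSr; field.
  by rewrite gt_eqF.
set c := density (fun r => T r - X r) in dens.
set c0 := (1 - q%:R^-1) * den 0%N in dens *.
(* The errors arise at levels n and L(n), the latter being n / g up to 1. *)
pose e' := e / (2 + g^-1).
have gi0 : 0 < g^-1 by rewrite invr_gt0.
have e'0 : 0 < e' by rewrite divr_gt0 // ltr_wpDl.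
have [K hK] := chain_sum_density (2 * M) e'0.
exists (2 * K + e' + `|- g * c - c0|) => n.
have h1 := hK _ (bnd _ _ hT hX) n.
have h2 := hK _ (bnd _ _ hn hd) (L n).
rewrite dens in h2.
rewrite big_split /= chain_sum_le_range //.
rewrite -[X in `|_ + X + _|]/(chain_sum (fun a => num a - den a) (L n)).
move: h1 h2; set S1 := chain_sum _ n; set S2 := chain_sum _ (L n) => h1 h2.
have /andP[L1 L2] := hL n.
(* Level n contributes c n and level L(n) about (- g c - c0) n / g, so c cancels and - c0 n / g
   remains. *)
have -> : S1 + S2 + c0 / g * n%:R =
  (S1 - c * n%:R) + (S2 - (- g * c - c0) * (L n)%:R) +
  (- g * c - c0) * ((L n)%:R - n%:R / g).
  by field; rewrite gt_eqF.
apply: le_trans (ler_normD _ _) _; apply: le_trans (lerD (ler_normD _ _) (lexx _)) _.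
have h3 : `|(- g * c - c0) * ((L n)%:R - n%:R / g)| <= `|- g * c - c0|.
  rewrite normrM [X in _ * X]ger0_norm ?subr_ge0 //.
  by rewrite ler_piMr // lerBlDl.
have h4 : e' * (L n)%:R <= e' * (n%:R / g) + e'.
  by rewrite -[X in _ <= _ + X]mulr1 -mulrDr ler_pM2l.
have h5 : e * n%:R = 2 * (e' * n%:R) + e' * (n%:R / g).
  rewrite /e'; field; rewrite !gt_eqF //.
  by rewrite addr_gt0 // mulr_gt0.
have h6 : 0 <= e' * n%:R by rewrite mulr_ge0 // ltW.
rewrite h5; move: h1 h2 h3 h4 h6.
move: (`|S1 - _|) (`|S2 - _|) (`|_ * (_ - _)|) (`|- g * c - c0|) => a1 a2 a3 a4.
move: (e' * (L n)%:R) (e' * n%:R) (e' * (n%:R / g)) => b1 b2 b3.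
by lra.
Qed.

End ChainSums.

Section Gibbs.
Context (R : realType) (I : finType) (a b : I -> R).
Hypothesis a_ge0 : forall i, 0 <= a i.
Hypothesis b_ge0 : forall i, 0 <= b i.
Hypothesis ab : forall i, b i = 0 -> a i = 0.

(** This is 1 + x <= exp x at x = ln (b / a), strict for x <> 0. Summed over i, the left-hand sides
    cancel. *)
Let gibbs_term i : a i - b i <= a i * (ln (a i) - ln (b i)) /\
  (a i != b i -> a i - b i < a i * (ln (a i) - ln (b i))).
Proof.
have := a_ge0 i; rewrite le_eqVlt => /orP[/eqP e|a0].
  rewrite -e mul0r sub0r oppr_le0 oppr_lt0 b_ge0; split=> //.
  by rewrite eq_sym => h; rewrite lt_neqAle eq_sym h b_ge0.
have b0 : 0 < b i.
  by rewrite lt_neqAle b_ge0 andbT eq_sym; apply/eqP => /ab e; rewrite e ltxx in a0.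
have e : a i * (ln (a i) - ln (b i)) = - (a i * ln (b i / a i)).
  by rewrite ln_div ?posrE //; ring.
have e' : a i - b i = - (a i * (b i / a i - 1)).
  by field; rewrite gt_eqF.
have ba : 0 < b i / a i by rewrite divr_gt0.
have E : b i / a i = expR (ln (b i / a i)) by rewrite lnK ?posrE.
rewrite e e' lerN2 ltrN2 ler_pM2l // ltr_pM2l //; split.
  by rewrite {2}E lerBrDl expR_ge1Dx.
move=> ne; rewrite {2}E ltrBrDl expR_gt1Dx //.
rewrite ln_eq0 //; apply: contra ne => /eqP h.
by rewrite eq_sym -[b i](divfK (lt0r_neq0 a0)) h mul1r.
Qed.

Lemma gibbs : \sum_i a i = 1 -> \sum_i b i = 1 ->
  0 <= \sum_i a i * (ln (a i) - ln (b i)) /\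
  ((exists i, a i != b i) -> 0 < \sum_i a i * (ln (a i) - ln (b i))).
Proof.
move=> sa sb; have E : \sum_i (a i - b i) = 0 by rewrite sumrB sa sb subrr.
split.
  by rewrite -[leLHS]E; apply: ler_sum => i _; have [] := gibbs_term i.
move=> [i ne]; rewrite -[ltLHS]E (bigD1 i) //= [ltRHS](bigD1 i) //=.
apply: ltr_leD; first by have [_] := gibbs_term i; apply.
by apply: ler_sum => k _; have [] := gibbs_term k.
Qed.

End Gibbs.

Section Expectation.
Context (m1 m2 : nat) (R : realType).
Local Notation A := (letter m1 * letter m2)%type.
Local Notation Sigma := (Sigma m1 m2).
Local Notation proba := (probability (borel_Sigma m1 m2) R).
Context (Omega : set Sigma) (closedOmega : closed Omega).
Context (nu : proba) (nuO : supported_on Omega nu).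
Implicit Types (F G : Sigma -> R) (N : nat).

Definition expect N F := \sum_(w : N.-tuple A) mass nu (val w, [::]) * F (ext w).

Definition depends N F := forall s s', agree N s s' -> F s = F s'.

Lemma expect_le N N' F : (N <= N')%N -> depends N F -> expect N' F = expect N F.
Proof.
move=> le h; rewrite -(subnKC le); elim: (N' - N)%N => [|k IH]; first by rewrite addn0.
rewrite addnS -IH /expect.
rewrite (big_tuple_rcons (N + k) (fun w => mass nu (w, [::]) * F (ext w))).
apply: eq_bigr => w _; rewrite mass_letter mulr_suml; apply: eq_bigr => c _.
congr (_ * _); apply: h => i iN; rewrite /ext nth_rcons size_tuple.
by rewrite (leq_trans iN (leq_addr _ _)).
Qed.

Lemma mass_supp w : mass nu (w, [::]) != 0 ->
  exists2 s, Omega s & w = mkseq s (size w).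
Proof.
move=> h; have : is_prefix Omega (w, [::]).
  by apply: contraNT h => h; rewrite ((supported_mass closedOmega nu).1 nuO) ?eqxx.
by move=> /is_prefixP[s Os /cylinder_agree E]; exists s.
Qed.

Lemma expect_eq_le N F G : depends N F -> depends N G ->
  (forall s, Omega s -> F s <= G s) -> expect N F <= expect N G.
Proof.
move=> dF dG h; apply: ler_sum => w _.
have [->|/mass_supp[s Os E]] := eqVneq (mass nu (val w, [::])) 0; first by rewrite !mul0r.
apply: ler_wpM2l; first exact: mass_ge0.
have agr : agree N (ext w) s.
  by move: E; rewrite size_tuple /= => ->; exact: agree_ext.
by rewrite (dF _ _ agr) (dG _ _ agr) h.
Qed.

Lemma expect_eq N F G : depends N F -> depends N G ->
  (forall s, Omega s -> F s = G s) -> expect N F = expect N G.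
Proof.
by move=> dF dG h; apply/eqP; rewrite eq_le !expect_eq_le // => s Os; rewrite h.
Qed.

Lemma expect_cst N c : expect N (fun=> c) = c.
Proof. by rewrite /expect -mulr_suml sum_mass mul1r. Qed.

Lemma expectD N F G : expect N (fun s => F s + G s) = expect N F + expect N G.
Proof. by rewrite /expect -big_split; apply: eq_bigr => w _; rewrite mulrDr. Qed.

Lemma expectZ N c F : expect N (fun s => c * F s) = c * expect N F.
Proof. by rewrite /expect mulr_sumr; apply: eq_bigr => w _; rewrite mulrCA. Qed.

Lemma expectN N F : expect N (fun s => - F s) = - expect N F.
Proof. by rewrite /expect -sumrN; apply: eq_bigr => w _; rewrite mulrN. Qed.

Lemma expectB N F G : expect N (fun s => F s - G s) = expect N F - expect N G.
Proof. by rewrite expectD expectN. Qed.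

Lemma expect_sum N n (F : nat -> Sigma -> R) :
  expect N (fun s => \sum_(0 <= i < n) F i s) = \sum_(0 <= i < n) expect N (F i).
Proof. by rewrite /expect exchange_big; apply: eq_bigr => w _; rewrite mulr_sumr. Qed.

Lemma expect_bound N F M : depends N F -> (forall s, Omega s -> `|F s| <= M) ->
  `|expect N F| <= M.
Proof.
move=> dF h; rewrite ler_norml -[X in X <= _ <= _](expect_cst N) -[X in _ <= _ <= X](expect_cst N).
by rewrite !expect_eq_le // => s /h; rewrite ler_norml => /andP[].
Qed.

Let letter0 p k (c : A) : A := if (k < p)%N then c else (ord0, c.2).

(** A canonical word of each ball, with x-letters reset after position [p]. It partitions words by
    balls, so that Gibbs' inequality applies to the finite probability vectors [weight]. *)
Let rep p N (v : N.-tuple A) : N.-tuple A :=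
  [tuple of mkseq (fun k => letter0 p k (ext v k)) N].

Let rep_ball p N (v : N.-tuple A) : ball_word p (rep p v) = ball_word p v.
Proof.
apply/eqP/ball_wordP; first by rewrite !size_tuple.
move=> k; rewrite size_tuple => kN; rewrite {1 3}/ext nth_mkseq // /letter0.
by case: ifP.
Qed.

Let repP p N (v w : N.-tuple A) :
  (rep p v == rep p w) = (ball_word p v == ball_word p w).
Proof.
apply/eqP/eqP => [h|/eqP /ball_wordP]; first by rewrite -rep_ball h rep_ball.
rewrite !size_tuple => /(_ erefl) h; apply/val_inj => /=.
apply/eq_in_map => k; rewrite mem_iota add0n => /andP[_ kN].
have [h1 h2] := h k kN; rewrite /letter0; case: ifP => [/h1 //|_].
by rewrite h2.
Qed.

Let weight (P : proba) p N (u : N.-tuple A) : R :=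
  \sum_(v | rep p v == u) mass P (val v, [::]).

Let weightE P p N (v : N.-tuple A) :
  weight P p (rep p v) = mass P (ball_word p v).
Proof.
rewrite (mass_ball_word _ _ (size_tuple v)) /weight big_mkcond.
apply: eq_bigr => w _; rewrite repP.
by case: ifP; rewrite ?mul1r ?mul0r.
Qed.

Let weight_sum P p N : \sum_(u : N.-tuple A) weight P p u = 1.
Proof.
by rewrite -(sum_mass P N) [RHS](partition_big (@rep p N) xpredT).
Qed.

(** Relative entropy of [nu] with respect to [mu] on the partition into cylinders fixing N y-letters
    and the first p x-letters. *)
Definition divergence (mu : proba) p N := expect N (fun s =>
  ln (mass nu (ball_word p (mkseq s N))) - ln (mass mu (ball_word p (mkseq s N)))).

Lemma divergence_ge0 (mu : proba) p N :
  (forall v : N.-tuple A, mass mu (ball_word p v) = 0 -> mass nu (ball_word p v) = 0) ->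
  0 <= divergence mu p N /\
  ((exists v : N.-tuple A, mass nu (ball_word p v) != mass mu (ball_word p v)) ->
    0 < divergence mu p N).
Proof.
move=> ac.
have w0 P u : 0 <= @weight P p N u by apply: sumr_ge0 => v _; exact: mass_ge0.
have wac u : @weight mu p N u = 0 -> @weight nu p N u = 0.
  have [[v /eqP <-]|h] := pselect (exists v, rep p v == u).
    by rewrite !weightE; exact: ac.
  by move=> _; rewrite /weight big1 // => v hv; case: h; exists v.
have [g1 g2] := gibbs (w0 nu) (w0 mu) wac (weight_sum nu p N) (weight_sum mu p N).
have -> : divergence mu p N = \sum_u @weight nu p N u *
    (ln (@weight nu p N u) - ln (@weight mu p N u)).
  rewrite /divergence /expect (partition_big (@rep p N) xpredT) //=.
  apply: eq_bigr => u _; rewrite {1}/weight mulr_suml; apply: eq_bigr => v /eqP <-.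
  rewrite !weightE; have -> : mkseq (ext v) N = v by rewrite -{2}(size_tuple v) mkseq_ext.
  by [].
split=> // -[v hv]; apply: g2; exists (rep p v); by rewrite !weightE.
Qed.

End Expectation.

Section Entropy.
Context (m1 m2 : nat) (R : realType) (q j : nat) (q_gt1 : (1 < q)%N).
Local Notation A := (letter m1 * letter m2)%type.
Local Notation Sigma := (Sigma m1 m2).
Local Notation proba := (probability (borel_Sigma m1 m2) R).
Context (g : R) (g_gt0 : 0 < g) (L : nat -> nat).
Hypothesis L_bound : forall n, n%:R / g <= (L n)%:R <= n%:R / g + 1.
Hypothesis L_ge : forall n, (q ^ j * n <= L n)%N.
Hypothesis L_lt : forall n, (L n < q ^ j.+1 * n.+1)%N.
Context (Omega : set Sigma) (closedOmega : closed Omega).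

(* The numbers of x and y letters which a ball fixes on a chain. *)
Definition chain_type p p' :=
  [|| (0 < p)%N && (p' == p + j)%N, p' == (p + j.+1)%N | (p == 0)%N && (p' <= j)%N].

Let q_gt0 : (0 < q)%N. Proof. exact: ltnW. Qed.

Lemma L_le n : (n <= L n)%N.
Proof. by apply: leq_trans (L_ge n); rewrite leq_pmull // expn_gt0 q_gt0. Qed.

(** If i q^(p-1) <= n then i q^(p-1+j) <= q^j n <= L n; if n < i q^p then L n < q^(j+1) (n+1) <= i
    q^(p+j+1). The first bound needs p > 0. *)
Lemma nchain_type n i : i \in nondiv q (L n) ->
  chain_type (nchain q i n) (nchain q i (L n)).
Proof.
rewrite mem_nondiv => /and3P[i0 iL qi].
set p := nchain q i n; set p' := nchain q i (L n).
have le1 : (p' <= p + j.+1)%N.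
  rewrite leqNgt ltn_nchain // -ltnNge; apply: leq_trans (L_lt n) _.
  rewrite expnD mulnA mulnC leq_pmul2r ?expn_gt0 ?q_gt0 // ltnNge -ltn_nchain //.
  by rewrite ltnn.
rewrite /chain_type; case: (posnP p) => [p0|p0] /=.
  rewrite p0 add0n /= in le1 *; move: le1; rewrite leq_eqVlt ltnS.
  by case/orP => [->|->]; rewrite ?orbT.
have le2 : (p + j <= p')%N.
  rewrite -(prednK p0) addSn ltn_nchain //; apply: leq_trans (L_ge n).
  by rewrite expnD mulnA mulnC leq_pmul2l ?expn_gt0 ?q_gt0 // -ltn_nchain // ltn_predL.
move: le1; rewrite leq_eqVlt => /orP[/eqP ->|]; first by rewrite eqxx orbT.
by rewrite addnS ltnS => le1; rewrite eqn_leq le1 le2.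
Qed.

Lemma chain_type_le p p' : chain_type p p' -> (p <= p')%N.
Proof.
case/or3P => [/andP[_ /eqP->]|/eqP->|/andP[/eqP-> _]] //; exact: leq_addr.
Qed.

Lemma chain_type_ltn p p' r : chain_type p p' -> (r < p)%N -> (r + j < p')%N.
Proof.
case/or3P => [/andP[_ /eqP->]|/eqP->|/andP[/eqP-> _]] // h; first by rewrite ltn_add2r.
by rewrite addnS ltnS leq_add2r ltnW.
Qed.

Lemma ball_word_mkseq (s : Sigma) p N : (p <= N)%N ->
  ball_word p (mkseq s N) = prefix_word s p (N - p).
Proof.
move=> pN; rewrite /ball_word /prefix_word /mkseq -map_take take_iota (minn_idPl pN).
congr (_, _); apply: (@eq_from_nth _ ord0).
  by rewrite size_map size_drop !size_map !size_iota.
move=> k; rewrite size_map size_drop size_map size_iota => kl.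
rewrite (nth_map (ord0, ord0)) ?size_drop ?size_map ?size_iota // nth_drop.
by rewrite !nth_mkseq // -ltn_subRL.
Qed.

Lemma mkseq_ext_tuple N (v : N.-tuple A) : mkseq (ext v) N = v.
Proof. by have := mkseq_ext v; rewrite size_tuple. Qed.

Section Cross.
Context (mu nu P : proba) (nuO : supported_on Omega nu) (nuP : is_P q nu P).
(** In the application these are [ln_t], [ln_x], [ln_den] and [ln_num]; the argument rests on their
    locality, their bounds and their relations. [nu] is any competitor, and [mu] itself when
    [exp_moment] is applied. *)
Context (T X den num : Sigma -> nat -> R) (M d0 : R).
Hypothesis T_dep : forall r, depends (r + j.+1) (T^~ r).
Hypothesis X_dep : forall r, depends (r + j.+1) (X^~ r).
Hypothesis den_dep : forall a, depends a (den^~ a).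
Hypothesis num_dep : forall a, depends a.+1 (num^~ a).
Hypothesis T_bound : forall s r, Omega s -> `|T s r| <= M.
Hypothesis X_bound : forall s r, Omega s -> `|X s r| <= M.
Hypothesis den_bound : forall s r, Omega s -> `|den s r| <= M.
Hypothesis num_bound : forall s r, Omega s -> `|num s r| <= M.
Hypothesis den_ge : forall s a, den s (a + j.+1)%N = q%:R ^+ j.+1 * g * T s a.
Hypothesis num_lt : forall s a, (a < j)%N -> num s a = den s a.+1 / q%:R.
Hypothesis num_ge : forall s a, num s (a + j)%N = q%:R ^+ j * g * X s a.
Hypothesis den0 : forall s, den s 0%N = d0.
Hypothesis mu_ln : forall s p p', Omega s -> chain_type p p' ->
  0 < mass mu (prefix_word s p (p' - p)) /\
  ln (mass mu (prefix_word s p (p' - p))) =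
  \sum_(0 <= r < p) (T s r - X s r) + \sum_(0 <= a < p') (num s a - den s a).

Let ET r := expect nu (r + j.+1) (T^~ r).
Let EX r := expect nu (r + j.+1) (X^~ r).
Let Eden a := expect nu a (den^~ a).
Let Enum a := expect nu a.+1 (num^~ a).

Lemma depends_ball (Q : proba) p N : depends N
  (fun s : Sigma => ln (mass Q (ball_word p (mkseq s N)))).
Proof. by move=> s s' /agree_mkseq ->. Qed.

Definition log_mass s p p' :=
  \sum_(0 <= r < p) (T s r - X s r) + \sum_(0 <= a < p') (num s a - den s a).

Lemma depends_log_mass p p' : chain_type p p' -> depends p' (fun s => log_mass s p p').
Proof.
move=> h s s' agr; rewrite /log_mass; congr (_ + _).
  rewrite big_nat_cond [RHS]big_nat_cond; apply: eq_bigr => r /andP[/andP[_ rp] _].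
  have le : (r + j.+1 <= p')%N by rewrite addnS (chain_type_ltn h).
  by rewrite (T_dep (agree_le le agr)) (X_dep (agree_le le agr)).
rewrite big_nat_cond [RHS]big_nat_cond; apply: eq_bigr => a /andP[/andP[_ ap] _].
by rewrite (num_dep (agree_le ap agr)) (den_dep (agree_le (ltnW ap) agr)).
Qed.

Lemma log_mass_bound s p p' : Omega s -> (p <= p')%N ->
  `|log_mass s p p'| <= 4 * M * p'%:R.
Proof.
move=> Os pp'; have M0 : 0 <= M by apply: le_trans (T_bound 0 Os).
have bnd k (f h : nat -> R) : (forall r, `|f r| <= M) -> (forall r, `|h r| <= M) ->
    `|\sum_(0 <= r < k) (f r - h r)| <= 2 * M * k%:R.
  move=> hf hh; apply: le_trans (ler_norm_sum _ _ _) _.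
  rewrite -[k in leRHS]subn0 mulr_natr -sumr_const_nat; apply: ler_sum => r _.
  by apply: le_trans (ler_normB _ _) _; rewrite mulr_natl mulr2n lerD.
apply: le_trans (ler_normD _ _) _.
have h1 := bnd p _ _ (fun r => T_bound r Os) (fun r => X_bound r Os).
have h2 := bnd p' _ _ (fun r => num_bound r Os) (fun r => den_bound r Os).
apply: le_trans (lerD h1 h2) _.
have h3 : 2 * M * p%:R <= 2 * M * p'%:R by rewrite ler_wpM2l ?mulr_ge0 // ler_nat.
by apply: le_trans (lerD h3 (lexx _)) _; rewrite -mulrDl -mulrDl -natrD.
Qed.

Lemma cross_chain p p' : chain_type p p' ->
  expect nu p' (fun s => ln (mass mu (ball_word p (mkseq s p')))) =
  \sum_(0 <= r < p) (ET r - EX r) + \sum_(0 <= a < p') (Enum a - Eden a).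
Proof.
move=> h; rewrite (expect_eq closedOmega nuO (G := fun s => log_mass s p p')).
- rewrite /log_mass expectD !expect_sum; congr (_ + _).
    rewrite big_nat_cond [RHS]big_nat_cond; apply: eq_bigr => r /andP[/andP[_ rp] _].
    have le : (r + j.+1 <= p')%N by rewrite addnS (chain_type_ltn h).
    by rewrite expectB (expect_le nu le (@T_dep r)) (expect_le nu le (@X_dep r)).
  rewrite big_nat_cond [RHS]big_nat_cond; apply: eq_bigr => a /andP[/andP[_ ap] _].
  by rewrite expectB (expect_le nu ap (@num_dep a)) (expect_le nu (ltnW ap) (@den_dep a)).
- exact: depends_ball.
- exact: depends_log_mass.
- move=> s Os; rewrite ball_word_mkseq ?chain_type_le //.
  by have [_] := mu_ln Os h.
Qed.

(** By linearity the expectations inherit the relations required by [chain_sum_telescope]. The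
    surviving term is the expectation of the constant [den s 0], which makes the rate independent of
    [nu]. *)
Lemma cross_asymptotics e : 0 < e -> exists K, forall n,
  `|\sum_(i <- nondiv q (L n)) expect nu (nchain q i (L n))
      (fun s => ln (mass mu (ball_word (nchain q i n) (mkseq s (nchain q i (L n))))))
    + (1 - q%:R^-1) * d0 / g * n%:R| <= e * n%:R + K.
Proof.
move=> e0; have Eden0 : Eden 0 = d0.
  rewrite -[RHS](expect_cst nu 0); apply: (expect_eq closedOmega nuO) => //.
have [] := @chain_sum_telescope R q q_gt1 j g L ET EX Eden Enum M e g_gt0 L_bound L_le.
- by move=> r; apply: (expect_bound closedOmega nuO) => // s; exact: T_bound.
- by move=> r; apply: (expect_bound closedOmega nuO) => // s; exact: X_bound.
- by move=> r; apply: (expect_bound closedOmega nuO) => // s; exact: den_bound.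
- by move=> r; apply: (expect_bound closedOmega nuO) => // s; exact: num_bound.
- move=> a; rewrite /Eden /ET -expectZ; apply: (expect_eq closedOmega nuO) => //.
  by move=> s s' h; rewrite (T_dep h).
- move=> a aj; rewrite /Eden /Enum mulrC -expectZ; apply: (expect_eq closedOmega nuO) => //.
    by move=> s s' h; rewrite (den_dep h).
  by move=> s _; rewrite num_lt // mulrC.
- move=> a; rewrite /Enum /EX -expectZ -addnS; apply: (expect_eq closedOmega nuO) => //.
  + by rewrite addnS; exact: num_dep.
  + by move=> s s' h; rewrite (X_dep h).
- exact: e0.
move=> K; rewrite Eden0 => hK; exists K => n; have := hK n.
congr (`|_ + _| <= _); rewrite big_seq [RHS]big_seq; apply: eq_bigr => i iL.
by rewrite cross_chain // nchain_type.
Qed.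

(** Shannon entropy of the partition into balls of level [n]. *)
Definition entropy n := expect P (L n)
  (fun s => - ln (mass P (ball_word n (mkseq s (L n))))).

Lemma expect_sum_seq (Q : proba) N (r : seq nat) (F : nat -> Sigma -> R) :
  expect Q N (fun s => \sum_(i <- r) F i s) = \sum_(i <- r) expect Q N (F i).
Proof. by rewrite /expect exchange_big; apply: eq_bigr => w _; rewrite mulr_sumr. Qed.

Lemma ln_prod (I : eqType) (r : seq I) (F : I -> R) : (forall i, i \in r -> 0 < F i) ->
  ln (\prod_(i <- r) F i) = \sum_(i <- r) ln (F i).
Proof.
elim: r => [|i r IH] h; first by rewrite !big_nil ln1.
have h' k : k \in r -> 0 < F k by move=> kr; apply: h; rewrite inE kr orbT.
rewrite !big_cons lnM ?posrE ?IH // ?h ?inE ?eqxx //.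
by rewrite big_seq; apply: prodr_gt0.
Qed.

Lemma entropy_chains n : entropy n =
  - \sum_(i <- nondiv q (L n)) expect nu (nchain q i (L n))
    (fun s => ln (mass nu (ball_word (nchain q i n) (mkseq s (nchain q i (L n)))))).
Proof.
rewrite /entropy expectN; congr (- _).
pose F i (v : seq A) := ln (mass nu (ball_word (nchain q i n) v)).
transitivity (expect P (L n) (fun s => \sum_(i <- nondiv q (L n)) F i (chain q i (L n) s))).
  apply: eq_bigr => w _.
  (* Words of mass 0 drop out; on the others every factor is positive, as taking the logarithm of
     the product requires. *)
  have [->|h] := eqVneq (mass P (val w, [::])) 0; first by rewrite !mul0r.
  congr (_ * _).
  have -> : mkseq (ext w) (L n) = w by rewrite -{2}(size_tuple w) mkseq_ext.
  rewrite (mass_P_ball q_gt1 nuP) ln_prod // => i iL.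
  apply: lt_le_trans (mass_ball_word_ge _ _ _).
  rewrite lt_neqAle mass_ge0 andbT eq_sym; apply: contra h => /eqP h.
  by rewrite (mass_P q_gt1 nuP) prodf_seq_eq0; apply/hasP; exists i => //=; rewrite h.
rewrite expect_sum_seq big_seq [RHS]big_seq; apply: eq_bigr => i iL.
rewrite /expect (sum_mass_chain q_gt1 nuP (F i) iL).
apply: eq_bigr => v _; congr (_ * _); rewrite /F.
by have -> : mkseq (ext v) (nchain q i (L n)) = v by rewrite -{2}(size_tuple v) mkseq_ext.
Qed.

(** [mu] charges every such cylinder that meets [Omega], and [nu] is carried by [Omega]. *)
Lemma chain_mass_ac p p' : chain_type p p' -> forall v : p'.-tuple A,
  mass mu (ball_word p v) = 0 -> mass nu (ball_word p v) = 0.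
Proof.
move=> h v.
have -> : ball_word p v = prefix_word (ext v) p (p' - p).
  rewrite -ball_word_mkseq ?chain_type_le //; congr ball_word.
  by rewrite mkseq_ext_tuple.
have [hp|hp _] := boolP (is_prefix Omega (prefix_word (ext v) p (p' - p))); last first.
  exact: ((supported_mass closedOmega nu).1 nuO).
have [s Os] := prefix_wordP hp.
rewrite size_prefix_word [size (prefix_word _ _ _).2]size_mkseq => -> h0.
by have [] := mu_ln Os h; rewrite h0 ltxx.
Qed.

(** Entropy is cross entropy with respect to [mu] minus relative entropy. *)
Lemma entropyE n : entropy n =
  - \sum_(i <- nondiv q (L n)) expect nu (nchain q i (L n))
    (fun s => ln (mass mu (ball_word (nchain q i n) (mkseq s (nchain q i (L n)))))) -
  \sum_(i <- nondiv q (L n)) divergence nu mu (nchain q i n) (nchain q i (L n)).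
Proof.
rewrite entropy_chains -opprD -big_split; congr (- _); apply: eq_bigr => i _ /=.
by rewrite /divergence expectB addrC subrK.
Qed.

Lemma divergence_nchain_ge0 n i : i \in nondiv q (L n) ->
  0 <= divergence nu mu (nchain q i n) (nchain q i (L n)).
Proof.
by move=> iL; have [] := divergence_ge0 (chain_mass_ac (nchain_type iL)).
Qed.

Lemma entropy_le e : 0 < e -> exists K, forall n,
  entropy n <= ((1 - q%:R^-1) * d0 / g + e) * n%:R + K.
Proof.
move=> e0; have [K hK] := cross_asymptotics e0; exists K => n.
have := hK n; rewrite entropyE ler_norml => /andP[+ _].
have : 0 <= \sum_(i <- nondiv q (L n)) divergence nu mu (nchain q i n) (nchain q i (L n)).
  by rewrite big_seq; apply: sumr_ge0 => i iL; exact: divergence_nchain_ge0.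
move: (\sum_(i <- _) expect _ _ _) (\sum_(i <- _) divergence _ _ _ _) => a b.
rewrite [(_ + e) * _]mulrDl; move: (_ / g * _) (e * _) => c d.
by lra.
Qed.

Lemma size_nondiv_bounds N :
  N%:R * (1 - q%:R^-1) <= (size (nondiv q N))%:R :> R /\
  (size (nondiv q N))%:R <= N%:R * (1 - q%:R^-1) + 1 :> R.
Proof.
have qR : 0 < q%:R :> R by rewrite ltr0n.
have := size_nondiv q_gt1 N => /(congr1 (fun n => n%:R : R)).
rewrite natrD => E.
have h1 : (N %/ q)%:R <= N%:R / q%:R :> R.
  by rewrite ler_pdivlMr // -natrM ler_nat leq_trunc_div.
have h2 : N%:R / q%:R <= (N %/ q)%:R + 1 :> R.
  rewrite ler_pdivrMr // natr1 -natrM ler_nat ltnW //.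
  by rewrite ltn_ceil.
by rewrite mulrBr mulr1; split; lra.
Qed.

(* The chains with exactly size w points up to n each contribute the same
   positive divergence, and they have positive density. *)
Lemma entropy_lt w z : g^-1 < q%:R ^+ j.+1 -> (0 < size w)%N -> size z = j ->
  mass nu (w, z) <> mass mu (w, z) ->
  exists c K : R, 0 < c /\ forall n,
    entropy n <= ((1 - q%:R^-1) * d0 / g - c) * n%:R + K.
Proof.
move=> gq w0 zj ne; set p := size w in w0 *.
have qR : 0 < q%:R :> R by rewrite ltr0n.
have tp : chain_type p (p + j) by rewrite /chain_type w0 eqxx.
have [v vE] : exists v : (p + j).-tuple A, ball_word p v = (w, z).
  have sv : size (w ++ [seq (ord0, y) | y <- z]) == (p + j)%N.
    by rewrite size_cat size_map zj.
  exists (Tuple sv); rewrite /ball_word /= take_size_cat // drop_size_cat //.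
  by rewrite -map_comp map_id.
have D0 : 0 < divergence nu mu p (p + j).
  have [_] := divergence_ge0 (chain_mass_ac tp); apply.
  by exists v; rewrite vE; apply/eqP.
set D := divergence nu mu p (p + j) in D0.
pose r : R := 1 - q%:R^-1.
have r0 : 0 < r by rewrite subr_gt0 invf_lt1 // ltr1n.
have r1 : r <= 1 by rewrite lerBlDr lerDl invr_ge0 ltW.
(* The density of the chains with p points up to n and p + j up to L(n); it is positive because 1 /
   g < q^(j+1). *)
pose c' : R := r * (q%:R ^- p.-1 - g^-1 / q%:R ^+ (p + j)).
have c'0 : 0 < c'.
  rewrite mulr_gt0 // subr_gt0 ltr_pdivrMr ?exprn_gt0 //.
  rewrite (_ : (p + j = p.-1 + j.+1)%N); last by rewrite addnS -addSn prednK.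
  by rewrite exprD mulKf // expf_neq0 // gt_eqF.
(* Half of the gain D c' pays for the error of [cross_asymptotics]; the constant 3 below absorbs
   roundings. *)
have e0 : 0 < D * c' / 2 by rewrite divr_gt0 // mulr_gt0.
have [K hK] := cross_asymptotics e0.
exists (D * c' / 2), (K + D * 3); split=> // n.
suff hD : D * (c' * n%:R - 3) <=
    \sum_(i <- nondiv q (L n)) divergence nu mu (nchain q i n) (nchain q i (L n)).
  have := hK n; rewrite entropyE ler_norml => /andP[+ _]; move: hD.
  move: (\sum_(i <- _) expect _ _ _) (\sum_(i <- _) divergence _ _ _ _) => a b.
  rewrite [(_ - _) * n%:R]mulrBl; move: (_ / g * _) => d.
  by lra.
(* For a < i <= b the chain has at least p points up to n and at most p + j up to L(n), hence by
   [nchain_type] exactly these numbers. *)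
set b := (n %/ q ^ p.-1)%N; set a := (L n %/ q ^ (p + j))%N.
have bL : (b <= L n)%N by apply: leq_trans (leq_div _ _) (L_le n).
pose S := [seq i <- nondiv q (L n) | (i <= b)%N && (a < i)%N].
have cnt : (size (nondiv q b))%:R - (size (nondiv q a))%:R <= (size S)%:R :> R.
  rewrite lerBlDr -natrD ler_nat -(size_cat).
  apply: uniq_leq_size; first exact: nondiv_uniq.
  move=> i; rewrite mem_cat mem_nondiv => /and3P[i0 ib qi]; apply/orP.
  have [ia|ia] := leqP i a; [right | left]; first by rewrite mem_nondiv i0 ia qi.
  by rewrite /S mem_filter mem_nondiv i0 ib ia qi (leq_trans ib bL).
apply: (@le_trans _ _ (D * (size S)%:R)).
  rewrite ler_pM2l //; apply: le_trans cnt.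
  have [h1 _] := size_nondiv_bounds b; have [_ h2] := size_nondiv_bounds a.
  apply: le_trans (lerB h1 h2); rewrite -/r.
  have h3 : n%:R / q%:R ^+ p.-1 - 1 <= b%:R :> R.
    rewrite lerBlDr ler_pdivrMr ?exprn_gt0 // natr1 -natrX -natrM ler_nat ltnW //.
    by rewrite ltn_ceil // expn_gt0 q_gt0.
  have h4 : a%:R <= g^-1 / q%:R ^+ (p + j) * n%:R + 1 :> R.
    have a1 : a%:R <= (L n)%:R / q%:R ^+ (p + j) :> R.
      by rewrite ler_pdivlMr ?exprn_gt0 // -natrX -natrM ler_nat leq_trunc_div.
    apply: le_trans a1 _; have /andP[_ /ler_wpM2r h] := L_bound n.
    apply: le_trans (h (q%:R ^+ (p + j))^-1 _) _; first by rewrite invr_ge0 exprn_ge0 // ltW.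
    rewrite mulrDl mul1r lerD //; last by rewrite invf_le1 ?exprn_gt0 // exprn_ege1 // ler1n.
    by rewrite mulrC mulrA [_^-1 * _]mulrC mulrAC [_ / g]mulrC mulrAC lexx.
  have h5 : r * (n%:R / q%:R ^+ p.-1 - 1) <= r * b%:R by rewrite ler_pM2l.
  have h6 : r * a%:R <= r * (g^-1 / q%:R ^+ (p + j) * n%:R + 1) by rewrite ler_pM2l.
  have E : c' * n%:R = r * (n%:R / q%:R ^+ p.-1) - r * (g^-1 / q%:R ^+ (p + j) * n%:R).
    by rewrite /c'; ring.
  rewrite E; move: h5 h6; rewrite mulrBr mulrDr mulr1.
  rewrite [b%:R * r]mulrC [a%:R * r]mulrC.
  move: (r * (_ / _)) (r * b%:R) (r * a%:R) (r * (_ * n%:R)) => x1 x2 x3 x4.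
  by move: r1; lra.
have -> : D * (size S)%:R = \sum_(i <- S) D.
  by rewrite big_const_seq count_predT iter_addr_0 mulr_natr.
rewrite big_filter big_seq_cond big_mkcond [leRHS]big_seq_cond [leRHS]big_mkcond /=.
apply: ler_sum => i _; case: ifP => [/andP[iL /andP[ib ai]]|_]; last first.
  by rewrite andbT; case: ifP => // iL; exact: divergence_nchain_ge0.
rewrite iL /=; have := nchain_type iL.
move: iL; rewrite mem_nondiv => /and3P[i0 iL qi].
have p1 : (p.-1 < nchain q i n)%N.
  by rewrite ltn_nchain // -leq_divRL ?expn_gt0 ?q_gt0.
have p2 : (nchain q i (L n) <= p + j)%N.
  by rewrite leqNgt ltn_nchain // -leq_divRL ?expn_gt0 ?q_gt0 // -ltnNge.
rewrite prednK // in p1.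
case/or3P => [/andP[_ /eqP e]|/eqP e|/andP[/eqP e _]].
- have pE : nchain q i n = p.
    by apply/eqP; rewrite eqn_leq p1 andbT -(leq_add2r j) -e.
  by rewrite e pE.
- by move: p2; rewrite e addnS ltn_add2r ltnNge p1.
- by move: p1 w0; rewrite e leqn0 => /eqP ->.
Qed.

Lemma sum_nchain N : (\sum_(i <- nondiv q N) nchain q i N = N)%N.
Proof.
elim/ltn_ind: N => N IH; have [->|N0] := posnP N; first by rewrite big_nil.
have := IH _ (ltn_Pdiv q_gt1 N0).
rewrite -(@big_nondiv q _ _ _ _ (N %/ q) N) ?leq_div //; last by move=> i; exact: nchain_gt.
move=> h; have -> : (\sum_(i <- nondiv q N) nchain q i N =
    \sum_(i <- nondiv q N) (nchain q i (N %/ q) + 1))%N.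
  rewrite big_seq [RHS]big_seq; apply: eq_bigr => i iN.
  by rewrite nchain_div // addn1.
by rewrite big_split /= h sum1_size addnC (size_nondiv q_gt1).
Qed.

(** Lengths grow by one from N / q to N, so the sum of squares is at most 3 (N / q) + 2 (N / q) + (N
    - N / q), which is at most 3 N since 2 (N / q) <= N. *)
Lemma sum_nchain2 N : (\sum_(i <- nondiv q N) nchain q i N ^ 2 <= 3 * N)%N.
Proof.
elim/ltn_ind: N => N IH; have [->|N0] := posnP N; first by rewrite big_nil.
have := IH _ (ltn_Pdiv q_gt1 N0); have := sum_nchain (N %/ q).
rewrite -!(@big_nondiv q _ _ _ _ (N %/ q) N) ?leq_div //; last 2 first.
- by move=> i h; rewrite nchain_gt.
- by move=> i; exact: nchain_gt.
move=> h1 h2; have -> : (\sum_(i <- nondiv q N) nchain q i N ^ 2 =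
    \sum_(i <- nondiv q N)
      (nchain q i (N %/ q) ^ 2 + (nchain q i (N %/ q) + nchain q i (N %/ q) + 1)))%N.
  rewrite big_seq [RHS]big_seq; apply: eq_bigr => i iN.
  by rewrite nchain_div //; lia.
rewrite !big_split /= sum1_size h1.
have := size_nondiv q_gt1 N; have : (2 * (N %/ q) <= N)%N.
  by apply: leq_trans (leq_trunc_div N q); rewrite mulnC leq_mul2l q_gt1 orbT.
have {}h2 : (\sum_(i <- nondiv q N) nchain q i (N %/ q) ^ 2 <= 3 * (N %/ q))%N.
  exact: h2.
by lia.
Qed.

(** From exp (- x) >= 1 - x and (1 + x + x^2) (1 - x) = 1 - x^3 >= 1. *)
Lemma expR_le_quadratic (x : R) : x <= 0 -> expR x <= 1 + x + x ^+ 2.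
Proof.
move=> x0; have h := expR_ge1Dx (- x); rewrite expRN in h.
have e0 := expR_gt0 x.
have x1 : 0 < 1 - x by lra.
have : expR x * (1 - x) <= 1 by rewrite -ler_pdivlMl // mulr1.
move: e0; set E := expR x => e0 h1.
rewrite -(ler_pM2r x1); apply: le_trans h1 _.
rewrite (_ : (1 + x + x ^+ 2) * (1 - x) = 1 - x ^+ 3); last by ring.
rewrite lerDl oppr_ge0 exprS -[x * _]mulrC.
by rewrite mulr_ge0_le0 // sqr_ge0.
Qed.

Lemma powR_prod (I : Type) (r : seq I) (F : I -> R) e : (forall i, 0 <= F i) ->
  (\prod_(i <- r) F i) `^ e = \prod_(i <- r) F i `^ e.
Proof.
move=> F0; elim: r => [|i r IH]; first by rewrite !big_nil powR1.
by rewrite !big_cons powRM ?IH // prodr_ge0.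
Qed.

Lemma mass_le1 (Q : proba) u : mass Q u <= 1.
Proof. by rewrite -lee_fin -massE; apply: probability_le1; exact: measurable_cylinder. Qed.

(** The power is exp (e ln mass), with ln mass <= 0 and |ln mass| <= 4 M p'. Expand to second order,
    take expectations, and bound 1 + x by exp x. *)
Lemma moment_chain p p' e : chain_type p p' -> 0 <= e ->
  expect nu p' (fun s => mass mu (ball_word p (mkseq s p')) `^ e) <=
  expR (e * expect nu p' (fun s => ln (mass mu (ball_word p (mkseq s p')))) +
    (e * (4 * M)) ^+ 2 * (p' ^ 2)%:R).
Proof.
move=> h e0; apply: le_trans (expR_ge1Dx _).
set E := expect nu p' (fun s => ln _).
have -> : 1 + (e * E + (e * (4 * M)) ^+ 2 * (p' ^ 2)%:R) =
    expect nu p' (fun s => (1 + (e * (4 * M)) ^+ 2 * (p' ^ 2)%:R) +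
      e * ln (mass mu (ball_word p (mkseq s p')))).
  by rewrite expectD expect_cst expectZ -/E; ring.
apply: (expect_eq_le closedOmega nuO).
- by move=> s s' /agree_mkseq ->.
- by move=> s s' /agree_mkseq ->.
move=> s Os; rewrite ball_word_mkseq ?chain_type_le //.
have [m0 mE] := mu_ln Os h.
have lb := log_mass_bound Os (chain_type_le h).
rewrite -/(log_mass s p p') in mE.
have ln0 : ln (mass mu (prefix_word s p (p' - p))) <= 0.
  by rewrite ln_le0 // mass_le1.
rewrite /powR gt_eqF //; move: ln0; rewrite mE => ln0.
apply: le_trans (expR_le_quadratic _) _; first by rewrite mulr_ge0_le0.
have M0 : 0 <= M by apply: le_trans (T_bound 0 Os); exact: normr_ge0.
rewrite [leLHS]addrAC lerD2r lerD2l natrX -exprMn -[leLHS]real_normK ?num_real //.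
rewrite ler_pXn2r ?nnegrE ?normr_ge0 ?mulr_ge0 //.
by rewrite normrM (ger0_norm e0) -mulrA ler_wpM2l.
Qed.

(* Chernoff's bound with a small exponent e: the quadratic errors of moment_chain
   add up to O(e^2 n) by sum_nchain2. *)
Lemma exp_moment lam : lam < (1 - q%:R^-1) * d0 / g ->
  exists c K : R, 0 < c /\ forall n,
  \sum_(w : (L n).-tuple A) mass P (val w, [::]) *
    (expR (- (lam * n%:R)) < \prod_(i <- nondiv q (L n))
      mass mu (ball_word (nchain q i n) (chain q i (L n) (ext w))))%R%:R
  <= expR (K - c * n%:R).
Proof.
set kap := _ / g => lk.
pose d := kap - lam; have d0' : 0 < d by rewrite subr_gt0.
have d4 : 0 < d / 4 by rewrite divr_gt0.
have [K hK] := cross_asymptotics d4.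
pose B := (4 * M) ^+ 2 * 3.
have B0 : 0 <= B by rewrite mulr_ge0 // sqr_ge0.
pose e := d / 4 / (B / g + 1).
have Bg : 0 <= B / g by rewrite divr_ge0 // ltW.
have e0 : 0 < e by rewrite divr_gt0 // ltr_wpDl.
have eB : e * (B / g) <= d / 4.
  rewrite /e mulrAC ler_pdivrMr ?ltr_wpDl // ler_pM2l // lerDl //.
exists (e * (d / 2)), (e * K + e ^+ 2 * B); split; first by rewrite mulr_gt0 // divr_gt0.
move=> n; set V := fun w : seq A => \prod_(i <- nondiv q (L n))
      mass mu (ball_word (nchain q i n) (chain q i (L n) (ext w))).
have V0 w : 0 <= V w by apply: prodr_ge0 => i _; exact: mass_ge0.
(* Markov's inequality for V^e: where the indicator is 1, exp (e lam n) V^e >= 1. *)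
apply: (@le_trans _ _ (\sum_(w : (L n).-tuple A) expR (e * (lam * n%:R)) *
    (mass P (val w, [::]) * V w `^ e))).
  apply: ler_sum => w _; rewrite mulrCA ler_wpM2l ?mass_ge0 //.
  case: (ltP (expR _) (V w)) => [lt|_]; last first.
    by rewrite mulr_ge0 ?expR_ge0 ?powR_ge0.
  have V1 : 0 < V w by apply: lt_trans lt; exact: expR_gt0.
  have h : - (lam * n%:R) < ln (V w) by rewrite -ltr_expR lnK ?posrE.
  rewrite /powR gt_eqF // -expRD -[leLHS]expR0 ler_expR -mulrDr mulr_ge0 ?ltW //.
  by rewrite -ltrBlDl sub0r.
rewrite -mulr_sumr.
have -> : \sum_(w : (L n).-tuple A) mass P (val w, [::]) * V w `^ e =
    \prod_(i <- nondiv q (L n)) expect nu (nchain q i (L n))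
      (fun s => mass mu (ball_word (nchain q i n) (mkseq s (nchain q i (L n)))) `^ e).
  pose F i v := mass nu (v, [::]) * mass mu (ball_word (nchain q i n) v) `^ e.
  transitivity (\sum_(w : (L n).-tuple A)
      \prod_(i <- nondiv q (L n)) F i (chain q i (L n) (ext w))).
    apply: eq_bigr => w _; rewrite (mass_P q_gt1 nuP) powR_prod; last first.
      by move=> i; exact: mass_ge0.
    by rewrite -big_split.
  rewrite (sum_prod_chain q_gt1 F (leqnn _)); apply: eq_bigr => i _.
  by apply: eq_bigr => v _; rewrite /F mkseq_ext_tuple.
apply: (@le_trans _ _ (expR (e * (lam * n%:R)) * \prod_(i <- nondiv q (L n))
    expR (e * expect nu (nchain q i (L n)) (fun s => ln (mass mu
       (ball_word (nchain q i n) (mkseq s (nchain q i (L n)))))) +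
    (e * (4 * M)) ^+ 2 * (nchain q i (L n) ^ 2)%:R))).
  rewrite ler_pM2l ?expR_gt0 // big_seq [leRHS]big_seq; apply: ler_prod => i iL.
  apply/andP; split; last exact: moment_chain (nchain_type iL) (ltW e0).
  by apply: sumr_ge0 => v _; rewrite mulr_ge0 ?mass_ge0 ?powR_ge0.
rewrite -expR_sum -expRD ler_expR big_split /= -!mulr_sumr -natr_sum.
have := hK n; rewrite ler_norml => /andP[_].
move: (\sum_(i <- _) expect _ _ _) => E hE.
have h2 : (e * (4 * M)) ^+ 2 * (\sum_(i <- nondiv q (L n)) nchain q i (L n) ^ 2)%:R <=
    e ^+ 2 * B * (n%:R / g + 1).
  rewrite exprMn (_ : e ^+ 2 * B * _ = e ^+ 2 * (4 * M) ^+ 2 * (3 * (n%:R / g + 1))).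
    apply: ler_wpM2l; first by rewrite mulr_ge0 // sqr_ge0.
    apply: (@le_trans _ _ (3 * (L n)%:R)); first by rewrite -natrM ler_nat sum_nchain2.
    by rewrite ler_pM2l //; have /andP[] := L_bound n.
  by rewrite /B; ring.
have h2' : e ^+ 2 * B * (n%:R / g + 1) = e * (e * (B / g) * n%:R) + e ^+ 2 * B.
  by field; rewrite gt_eqF.
rewrite h2' in h2.
have h3 : e * E <= e * (d / 4 * n%:R + K - kap * n%:R).
  by rewrite ler_pM2l // lerBrDr.
have h4 : e * (e * (B / g) * n%:R) <= e * (d / 4 * n%:R).
  by rewrite ler_pM2l // ler_wpM2r.
have lamE : lam = kap - d by rewrite /d; ring.
move: h2 h3 h4; rewrite lamE.
move: (\sum_(i <- _) _)%:R (e * (e * (B / g) * n%:R)) (e ^+ 2 * B) => x y z.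
move: ((e * _) ^+ 2 * x) n%:R => x' u.
by lra.
Qed.

End Cross.
End Entropy.

(** * Hausdorff dimension *)

Section Tail.
Context (R : realType).

Lemma nneseries_le (u : nat -> \bar R) (M : \bar R) : (forall n, (0 <= u n)%E) ->
  (forall n, (\sum_(0 <= i < n) u i <= M)%E) -> (\sum_(0 <= i <oo) u i <= M)%E.
Proof.
move=> u0 h; apply: lime_le; first exact: is_cvg_nneseries.
by apply: nearW => n; exact: h.
Qed.

(** Half of the rate makes the tail geometric with ratio [r]; the other half makes its constant [C]
    small. *)
Lemma exp_tail (K eta e : R) : 0 < eta -> 0 < e -> exists N : nat,
  (\sum_(0 <= n <oo) (if (N <= n)%N then expR (K - eta * n%:R) else 0)%:E <= e%:E)%E.
Proof.
move=> eta0 e0; pose r := expR (- (eta / 2)).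
have r0 : 0 < r by exact: expR_gt0.
have r1 : 0 < 1 - r by rewrite subr_gt0 expR_lt1 oppr_lt0 divr_gt0.
(* The solution of exp (K - eta x / 2) = e (1 - r). *)
pose x := (K - ln (e * (1 - r))) * 2 / eta.
exists (Num.bound `|x|); set N := Num.bound _.
have Nx : x <= N%:R.
  by apply: le_trans (ler_norm x) _; rewrite ltW // archi_boundP.
pose C := expR (K - eta / 2 * N%:R).
have Ce : C <= e * (1 - r).
  rewrite -[leRHS]lnK ?posrE ?mulr_gt0 // ler_expR lerBlDr -lerBlDl.
  have := ler_wpM2l (ltW (divr_gt0 eta0 (ltr0n _ 2))) Nx.
  by apply: le_trans; rewrite /x le_eqVlt; apply/orP; left; apply/eqP; field; rewrite gt_eqF.
have bnd n : (if (N <= n)%N then expR (K - eta * n%:R) else 0) <= C * r ^+ n.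
  case: ifP => [Nn|_]; last by rewrite mulr_ge0 ?exprn_ge0 ?expR_ge0.
  rewrite /C /r -expRM_natr -expRD ler_expR.
  have : eta / 2 * N%:R <= eta / 2 * n%:R by rewrite ler_pM2l ?divr_gt0 // ler_nat.
  have : eta * n%:R = eta / 2 * n%:R + eta / 2 * n%:R by field.
  rewrite mulNr; move: (eta / 2 * _) (eta / 2 * _) (eta * _) => a b c.
  by lra.
apply: nneseries_le => [n|n].
  by rewrite lee_fin; case: ifP => // _; exact: expR_ge0.
rewrite sumEFin lee_fin.
apply: (@le_trans _ _ (\sum_(0 <= i < n) C * r ^+ i)); first by apply: ler_sum.
have geo : (1 - r) * \sum_(0 <= i < n) C * r ^+ i = C * (1 - r ^+ n).
  elim: n => [|n IH]; first by rewrite big_geq // expr0 subrr !mulr0.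
  by rewrite big_nat_recr //= mulrDr IH exprS; ring.
rewrite -(ler_pM2l r1) geo mulrC [leRHS]mulrC; apply: le_trans Ce.
rewrite mulrC ler_piMr ?expR_ge0 // lerBlDr lerDl exprn_ge0 //.
exact: expR_ge0.
Qed.

End Tail.

Section Distance.
Context (m1 m2 : nat) (R : realType).
Hypothesis m2_gt1 : (2 <= m2)%N.
Hypothesis m21 : (m2 < m1)%N.
Local Notation A := (letter m1 * letter m2)%type.
Local Notation Sigma := (Sigma m1 m2).
Local Notation g := (gamma R m1 m2).
Local Notation lm := (ln (m1%:R : R)).
Context (L : nat -> nat).
Hypothesis L_bound : forall n, n%:R / g <= (L n)%:R :> R.
Hypothesis L_lt : forall n, (L n)%:R < n%:R / g + 1 :> R.

Lemma m1_gt1 : 1 < m1%:R :> R.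
Proof. by rewrite ltr1n; apply: ltn_trans m21. Qed.

Lemma lm_gt0 : 0 < lm.
Proof. by rewrite ln_gt0 // m1_gt1. Qed.

Lemma gamma_gt0 : 0 < g.
Proof. by rewrite /gamma divr_gt0 ?lm_gt0 // ln_gt0 // ltr1n. Qed.

Lemma gamma_lt1 : g < 1.
Proof.
rewrite /gamma ltr_pdivrMr ?lm_gt0 // mul1r ltr_ln ?posrE ?ltr_nat ?ltr0n //.
  exact: ltn_trans m2_gt1.
by apply: ltn_trans m21; apply: ltn_trans m2_gt1.
Qed.

Lemma powR_m1 x : m1%:R `^ x = expR (x * lm).
Proof. by rewrite /powR gt_eqF // (lt_trans ltr01 m1_gt1). Qed.

Lemma decay_le (c : R) (Pd : pred nat) x : 0 < c ->
  decay m1 c Pd <= expR (- (x * lm)) <-> forall k, Pd k -> x <= c * k%:R.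
Proof.
move=> c0; rewrite /decay; case: pselect => [ex|nex]; last first.
  split=> [_ k Pk|_]; last exact: expR_ge0.
  by case: nex; exists k.
case: ex_minnP => k Pk kmin; rewrite powR_m1 ler_expR mulNr lerN2 ler_pM2r ?lm_gt0 //.
split=> [h k' /kmin kk|h]; last exact: h.
by apply: le_trans h _; rewrite ler_pM2l // ler_nat.
Qed.

Lemma L_ge_id n : (n <= L n)%N.
Proof.
rewrite -(ler_nat R); apply: le_trans (L_bound n).
by rewrite ler_pdivlMr ?gamma_gt0 // ler_piMr // ltW // gamma_lt1.
Qed.

(** For integers k, gamma k >= n holds exactly when k >= L n, because [L n] is n / gamma rounded
    up. *)
Lemma dist_le (s s' : Sigma) n : dist R s s' <= expR (- (n%:R * lm)) <->
  ball_word n (mkseq s (L n)) = ball_word n (mkseq s' (L n)).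
Proof.
have nL := L_ge_id n.
have g0 := gamma_gt0.
rewrite /dist ge_max; split=> [/andP[/decay_le h1 /decay_le h2]|/eqP h].
  apply/eqP/ball_wordP; rewrite !size_mkseq // => k kL.
  rewrite /ext !nth_mkseq //; split=> [kn|].
    apply/eqP; apply: contraTT kn => /h1 - /(_ ltr01); rewrite mul1r ler_nat.
    by rewrite -leqNgt.
  apply/eqP; apply: contraTT kL => /h2 - /(_ g0) h3; rewrite -leqNgt.
  rewrite -ltnS -(ltr_nat R); apply: lt_le_trans (L_lt n) _.
  by rewrite -[leRHS]natr1 lerD2r ler_pdivrMr // mulrC.
have {}h k : (k < L n)%N -> ((k < n)%N -> s k = s' k) /\ (s k).2 = (s' k).2.
  move: h => /ball_wordP; rewrite !size_mkseq => /(_ erefl k) h kL.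
  by have := h kL; rewrite /ext !nth_mkseq.
apply/andP; split; apply/decay_le => // k /= /eqP sk.
  rewrite mul1r ler_nat leqNgt; apply/negP => kn; apply: sk.
  by apply: (h k _).1 => //; apply: leq_trans nL.
have kL : (L n <= k)%N by rewrite leqNgt; apply/negP => kL; apply: sk; apply: (h k kL).2.
rewrite mulrC -ler_pdivrMr //; apply: le_trans (L_bound n) _.
by rewrite ler_nat.
Qed.

Lemma dist_ge0 (s s' : Sigma) : 0 <= dist R s s'.
Proof.
rewrite /dist le_max; apply/orP; left; rewrite /decay.
by case: pselect => // ex; exact: powR_ge0.
Qed.

Definition ball (s : Sigma) n : set Sigma := cylinder (ball_word n (mkseq s (L n))).

Lemma ballP (s s' : Sigma) n : ball s n s' <-> dist R s s' <= expR (- (n%:R * lm)).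
Proof.
rewrite /ball cylinder_ball_word size_mkseq dist_le.
by split=> ->.
Qed.

Lemma diam_ge0 (U : set Sigma) : U !=set0 -> (0 <= diam (@dist R m1 m2) U)%E.
Proof.
move=> [x Ux]; apply: (@le_trans _ _ (dist R x x)%:E); first by rewrite lee_fin dist_ge0.
by apply: ereal_sup_ubound; exists (x, x).
Qed.

Lemma dist_diam (U : set Sigma) (s s' : Sigma) : U s -> U s' ->
  ((dist R s s')%:E <= diam (@dist R m1 m2) U)%E.
Proof. by move=> Us Us'; apply: ereal_sup_ubound; exists (s, s'). Qed.

End Distance.

(** * Upper bound for the dimension by the entropy rate *)

Section UpperBound.
Context (m1 m2 : nat) (R : realType).
Hypothesis m2_gt1 : (2 <= m2)%N.
Hypothesis m21 : (m2 < m1)%N.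
Local Notation A := (letter m1 * letter m2)%type.
Local Notation Sigma := (Sigma m1 m2).
Local Notation g := (gamma R m1 m2).
Local Notation lm := (ln (m1%:R : R)).
Context (L : nat -> nat).
Hypothesis L_bound : forall n, n%:R / g <= (L n)%:R :> R.
Hypothesis L_lt : forall n, (L n)%:R < n%:R / g + 1 :> R.
Context (P : probability (borel_Sigma m1 m2) R).

Definition heavy (D : R) n : set (borel_Sigma m1 m2) :=
  [set s | expR (- (D * n%:R)) < mass P (ball_word n (mkseq s (L n)))].

Lemma measurable_heavy D n : measurable (heavy D n).
Proof.
by apply: (@measurable_dep _ _ (L n)) => s s' /agree_mkseq h; rewrite /heavy /= h.
Qed.

Lemma heavy_mass D n : fine (P (heavy D n)) =
  \sum_(w : (L n).-tuple A) mass P (val w, [::]) *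
    (expR (- (D * n%:R)) < mass P (ball_word n w))%R%:R.
Proof.
rewrite (mass_tuple_pred P (L n) (fun w => expR (- (D * n%:R)) < mass P (ball_word n w))).
by apply: eq_bigr => w _; rewrite mulrC.
Qed.

(* Markov's inequality for - ln (mass P (ball_word n w)). *)
Lemma heavy_markov D n : 0 <= D ->
  D * n%:R * (1 - fine (P (heavy D n))) <= entropy L P n.
Proof.
move=> D0; rewrite heavy_mass -[X in X - _](sum_mass P (L n)) -sumrB mulr_sumr.
apply: ler_sum => w _; rewrite mkseq_ext_tuple.
have m0 := mass_ge0 P (val w, [::]).
have [h|h] := ltP (expR (- (D * n%:R))) (mass P (ball_word n w)).
  rewrite mulr1 subrr mulr0 mulr_ge0 // oppr_ge0 ln_le0 //; exact: mass_le1.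
rewrite mulr0 subr0 mulrC.
have [->|w0] := eqVneq (mass P (val w, [::])) 0; first by rewrite !mul0r.
apply: ler_wpM2l => //.
have b0 : 0 < mass P (ball_word n w).
  by apply: lt_le_trans (mass_ball_word_ge P n w); rewrite lt_neqAle eq_sym w0.
by rewrite lerNr -ler_expR lnK ?posrE.
Qed.

Lemma entropy_ge0 n : 0 <= entropy L P n.
Proof.
apply: sumr_ge0 => w _; rewrite mulr_ge0 ?mass_ge0 // oppr_ge0 ln_le0 //.
exact: mass_le1.
Qed.

(** Continuity from above along the decreasing tail unions. *)
Lemma limsup_ge (G : nat -> set (borel_Sigma m1 m2)) (d : R) N1 :
  (forall n, measurable (G n)) -> (forall n, (N1 <= n)%N -> d <= fine (P (G n))) ->
  measurable (\bigcap_N \bigcup_(n in [set n | (N <= n)%N]) G n) /\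
  (d%:E <= P (\bigcap_N \bigcup_(n in [set n | (N <= n)%N]) G n))%E.
Proof.
move=> mG hG; pose F N := \bigcup_(n in [set n | (N <= n)%N]) G n.
have mF N : measurable (F N) by apply: bigcup_measurable => n _.
have mA : measurable (\bigcap_N F N) by exact: bigcapT_measurable.
split=> //.
have dF : {homo F : n m / (n <= m)%N >-> (m <= n)%O}.
  move=> n m nm; apply/subsetPset => s [k /= mk Gk].
  by exists k => //=; apply: leq_trans mk.
have Fy : (P (F 0%N) < +oo)%E.
  by apply: (@le_lt_trans _ _ 1%E); [exact: probability_le1 | exact: ltry].
have cv := nonincreasing_cvg_mu Fy mF mA dF.
have lim : lim ((P \o F) x @[x --> \oo]) = P (\bigcap_N F N) by apply/cvg_lim.
rewrite -lim; apply: lime_ge; first by apply/cvg_ex; exists (P (\bigcap_N F N)).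
apply: nearW => N /=.
apply: (@le_trans _ _ (P (G (maxn N N1)))).
  by rewrite fine_probability // lee_fin hG // leq_maxr.
by apply: le_measure; rewrite ?inE // => s Gs; exists (maxn N N1) => //=; exact: leq_maxl.
Qed.

Lemma ball_word_cylinder n (w : word m1 m2) (y : Sigma) :
  size w.1 = n -> size w.2 = (L n - n)%N -> cylinder w y ->
  ball_word n (mkseq y (L n)) = w.
Proof.
move=> w1 w2 [h1 h2]; rewrite ball_word_mkseq ?(L_ge_id m2_gt1 m21 L_bound) //.
by rewrite /prefix_word -{1}w1 h1 /ys_word -w2 -{1}w1 h2 -surjective_pairing.
Qed.

Lemma diam_ball n (w : word m1 m2) : size w.1 = n -> size w.2 = (L n - n)%N ->
  (diam (@dist R m1 m2) (cylinder w) <= (expR (- (n%:R * lm)))%:E)%E.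
Proof.
move=> w1 w2; apply: ge_ereal_sup => _ [[y z] [/= yw zw] <-]; rewrite lee_fin.
by apply/(dist_le m2_gt1 m21 L_bound L_lt); rewrite !(ball_word_cylinder w1 w2).
Qed.

Lemma gauge_ge0 s (U : set Sigma) : (0 <= gauge (@dist R m1 m2) s U)%E.
Proof. by rewrite /gauge; case: asboolP => // _; exact: poweR_ge0. Qed.

Lemma gauge_ball (s : R) n (w : word m1 m2) : 0 < s ->
  size w.1 = n -> size w.2 = (L n - n)%N ->
  (gauge (@dist R m1 m2) s (cylinder w) <= (expR (- (s * lm * n%:R)))%:E)%E.
Proof.
move=> s0 w1 w2; rewrite /gauge; case: asboolP => [_|h].
  by rewrite lee_fin expR_ge0.
have [x xw] : cylinder w !=set0 by apply/set0P/eqP.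
have D0 := diam_ge0 R (ex_intro _ x xw).
apply: le_trans (gt0_ler_poweR (ltW s0) _ _ (diam_ball w1 w2)) _.
- by rewrite in_itv /= D0 leey.
- by rewrite in_itv /= lee_fin expR_ge0 leey.
rewrite poweR_EFin lee_fin -expRM ler_expR.
by rewrite le_eqVlt; apply/orP; left; apply/eqP; ring.
Qed.

(* The cylinders of level n and mass larger than exp (- D n); as their masses
   add up to at most 1, the sum of their gauges decays exponentially in n. *)
Lemma hausdorff_limsup D s : 0 < s -> D < s * lm ->
  hausdorff_measure (@dist R m1 m2) s
    (\bigcap_N \bigcup_(n in [set n | (N <= n)%N]) heavy D n) = 0%E.
Proof.
move=> s0 Ds; set E := \bigcap_N _.
have eta0 : 0 < s * lm - D by rewrite subr_gt0.
set eta := s * lm - D in eta0.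
apply/eqP; rewrite eq_le; apply/andP; split; last first.
  apply: le_ereal_sup_tmp; exists (hausdorff_premeasure (@dist R m1 m2) s 1 E).
    by exists 1 => //=.
  apply: le_ereal_inf_tmp => _ [U _ <-].
  by apply: nneseries_ge0 => k _ _; exact: gauge_ge0.
apply: ge_ereal_sup => _ [delta /= delta0 <-].
apply/lee_addgt0Pr => e e0; rewrite add0e.
have [N hN] := exp_tail 0 eta0 e0.
(* Levels from [N'] on give both a small tail, through [N], and covering sets of diameter at most
   [delta]. *)
pose N' := maxn N (Num.bound `|- ln delta / lm|).
have N'delta n : (N' <= n)%N -> expR (- (n%:R * lm)) <= delta.
  move=> h; rewrite -[leRHS]lnK ?posrE // ler_expR lerNl -ler_pdivrMr ?(lm_gt0 R m2_gt1 m21) //.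
  have : (Num.bound `|- ln delta / lm| <= n)%N by apply: leq_trans h; exact: leq_maxr.
  rewrite -(ler_nat R); apply: le_trans; apply: le_trans (ler_norm _) _.
  by rewrite ltW // archi_boundP.
pose good (u : word m1 m2) := [&& (N' <= size u.1)%N, size u.2 == (L (size u.1) - size u.1)%N &
  expR (- (D * (size u.1)%:R)) < mass P u].
pose dec k : option (seq A * seq (letter m2)) := pickle_inv k.
pose U k : set Sigma := if dec k is Some u then
  if good u then cylinder u else set0 else set0.
(* Sorting the cover by levels: at a fixed level the cylinders are disjoint, so their probabilities
   add up to at most 1. *)
pose V k n : set (borel_Sigma m1 m2) := if dec k is Some u then
  if good u && (size u.1 == n) then cylinder u else set0 else set0.
have mV k n : measurable (V k n).
  by rewrite /V; case: (dec k) => // u; case: ifP => // _; exact: measurable_cylinder.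
have sV n : (\sum_(0 <= k <oo) P (V k n) <= 1)%E.
  rewrite -measure_semi_bigcup //.
  - by apply: probability_le1; exact: bigcupT_measurable.
  - move=> k k' _ _ [y []]; rewrite /V.
    case E1 : (dec k) => [u|//]; case: ifP => // /andP[/and3P[_ /eqP u2 _] /eqP un] yu.
    case E2 : (dec k') => [u'|//]; case: ifP => // /andP[/and3P[_ /eqP u2' _] /eqP un'] yu'.
    rewrite un in u2; rewrite un' in u2'.
    have uu' : u = u'.
      by rewrite -(ball_word_cylinder un u2 yu) (ball_word_cylinder un' u2' yu').
    have := @pickle_invK (seq A * seq (letter m2))%type k; rewrite -/(dec k) E1 /= => <-.
    by have := @pickle_invK (seq A * seq (letter m2))%type k';
      rewrite -/(dec k') E2 /= uu' => ->.
  - exact: bigcupT_measurable.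
pose b n : R := if (N <= n)%N then expR (0 - eta * n%:R) else 0.
have b0 n : 0 <= b n by rewrite /b; case: ifP => // _; exact: expR_ge0.
apply: (@le_trans _ _ (\sum_(0 <= k <oo) gauge (@dist R m1 m2) s (U k))%E).
  apply: ereal_inf_lbound; exists U => //=; split.
    move=> y Ey; have [n /= Nn yn] := Ey N' Logic.I.
    exists (pickle (ball_word n (mkseq y (L n)))) => //.
    rewrite /U /dec pickleK_inv; have nL := L_ge_id m2_gt1 m21 L_bound n.
    have -> : good (ball_word n (mkseq y (L n))).
      rewrite /good; move: (yn : expR _ < _); rewrite ball_word_mkseq //.
      by rewrite !size_mkseq Nn eqxx.
    by apply/cylinder_ball_word; rewrite size_mkseq.
  move=> k; rewrite /U; case: (dec k) => [u|]; last first.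
    by rewrite /diam setX0 image_set0 ereal_sup0 leNye.
  case: ifP => [/and3P[h1 /eqP h2 _]|_]; last by rewrite /diam setX0 image_set0 ereal_sup0 leNye.
  by apply: le_trans (diam_ball erefl h2) _; rewrite lee_fin N'delta.
(* A good cylinder of level n has gauge at most exp (- s lm n) = exp (- eta n) exp (- D n), and exp
   (- D n) is below its mass. *)
apply: (@le_trans _ _ (\sum_(0 <= k <oo) \sum_(0 <= n <oo) (b n)%:E * P (V k n))%E).
  apply: lee_nneseries => [k _ _|k _]; first exact: gauge_ge0.
  have pos n : (0 <= (b n)%:E * P (V k n))%E by rewrite mule_ge0 // lee_fin.
  rewrite {1}/U; case Ek : (dec k) => [u|]; last first.
    rewrite /gauge; case: asboolP => // _; exact: nneseries_ge0.
  case: ifP => gu; last first.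
    rewrite /gauge; case: asboolP => // _; exact: nneseries_ge0.
  have /and3P[h1 /eqP h2 h3] := gu.
  apply: le_trans (nneseries_lim_ge (size u.1).+1 _) => //.
  rewrite big_nat_recr //=; apply: (@le_trans _ _ ((b (size u.1))%:E * P (V k (size u.1)))%E).
    rewrite /V Ek gu eqxx massE -EFinM; apply: le_trans (gauge_ball s0 erefl h2) _.
    rewrite lee_fin /b (leq_trans (leq_maxl _ _) h1).
    apply: (@le_trans _ _ (expR (0 - eta * (size u.1)%:R) * expR (- (D * (size u.1)%:R)))).
      by rewrite -expRD ler_expR le_eqVlt; apply/orP; left; apply/eqP; rewrite /eta; ring.
    by rewrite ler_wpM2l ?expR_ge0 // ltW.
  by rewrite leeDr // sume_ge0.
rewrite nneseries_interchange; last first.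
  by move=> k n; rewrite mule_ge0 // lee_fin.
apply: le_trans hN; apply: lee_nneseries => [n _ _|n _].
  by apply: nneseries_ge0 => k _ _; rewrite mule_ge0 // lee_fin.
rewrite nneseriesZl //.
by rewrite -[leRHS]mule1 lee_wpmul2l // lee_fin.
Qed.

(** For D slightly above D0, Markov's inequality makes the heavy sets have probability bounded
    below, so their limsup is a set of positive measure, to which [hausdorff_limsup] applies. *)
Lemma dim_measure_le D0 K s : (forall n, entropy L P n <= D0 * n%:R + K) ->
  D0 < s * lm -> (dim_measure P <= s%:E)%E.
Proof.
move=> hE Ds.
have lm0 := lm_gt0 R m2_gt1 m21.
(* Entropies are nonnegative, so a negative rate would fail for large n. *)
have D00 : 0 <= D0.
  rewrite leNgt; apply/negP => D0n.
  pose n := (Num.bound (`|K| / - D0)).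
  have : `|K| / - D0 < n%:R by apply: archi_boundP; rewrite divr_ge0 // oppr_ge0 ltW.
  rewrite ltr_pdivrMr ?oppr_gt0 // => h.
  have := le_trans (entropy_ge0 n) (hE n); have := ler_norm K.
  by move: h; rewrite mulrN [D0 * _]mulrC; move: (n%:R * D0) => x; lra.
have [D [DD0 Ds']] : exists D, D0 < D /\ D < s * lm.
  by exists ((D0 + s * lm) / 2); split; lra.
have Dp : 0 < D by apply: le_lt_trans DD0.
have s0 : 0 < s by rewrite -(pmulr_lgt0 _ lm0); apply: lt_trans Ds'.
(* Half of the limiting bound 1 - D0 / D; the other half absorbs [K] for n >= N1. *)
pose d : R := (D - D0) / (2 * D).
have d0 : 0 < d by rewrite divr_gt0 ?subr_gt0 // mulr_gt0.
pose N1 := (Num.bound (`|K| * 2 / (D - D0))).+1.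
have hG n : (N1 <= n)%N -> d <= fine (P (heavy D n)).
  move=> Nn; have n0 : 0 < n%:R :> R by rewrite ltr0n; apply: leq_trans Nn.
  have := le_trans (heavy_markov n (ltW Dp)) (hE n).
  have h1 : `|K| * 2 / (D - D0) <= n%:R.
    apply: le_trans (_ : (Num.bound (`|K| * 2 / (D - D0)))%:R <= _).
      by rewrite ltW // archi_boundP // divr_ge0 ?mulr_ge0 // subr_ge0 ltW.
    by rewrite ler_nat ltnW.
  rewrite ler_pdivrMr ?subr_gt0 // in h1.
  move=> h2; have h3 := ler_norm K.
  rewrite /d ler_pdivrMr ?mulr_gt0 //.
  have : (D - D0) * n%:R <= fine (P (heavy D n)) * (2 * D) * n%:R.
    by move: h1 h2 h3; move: (fine _) n%:R => p x; lra.
  by rewrite ler_pM2r.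
have [mE PE] := limsup_ge (measurable_heavy D) hG.
pose E := \bigcap_N \bigcup_(n in [set n | (N <= n)%N]) heavy D n.
apply: (@le_trans _ _ (dim_set R E)).
  apply: ereal_inf_lbound; exists E => //.
  by split=> //; apply: lt_le_trans PE; rewrite lte_fin.
apply: ereal_inf_lbound; exists s => //; split; first exact: ltW.
exact: hausdorff_limsup.
Qed.

End UpperBound.

(** * Lower bound by a mass distribution principle *)

Section LowerBound.
Context (m1 m2 : nat) (R : realType).
Hypothesis m2_gt1 : (2 <= m2)%N.
Hypothesis m21 : (m2 < m1)%N.
Local Notation A := (letter m1 * letter m2)%type.
Local Notation Sigma := (Sigma m1 m2).
Local Notation g := (gamma R m1 m2).
Local Notation lm := (ln (m1%:R : R)).
Context (L : nat -> nat).
Hypothesis L_bound : forall n, n%:R / g <= (L n)%:R :> R.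
Hypothesis L_lt : forall n, (L n)%:R < n%:R / g + 1 :> R.
Context (P : probability (borel_Sigma m1 m2) R).

Let lm0 : 0 < lm. Proof. exact: (lm_gt0 R m2_gt1 m21). Qed.

Lemma heavy_ball lam n (x y : Sigma) : ball L x n y -> heavy L P lam n x -> heavy L P lam n y.
Proof. by move=> /cylinder_ball_word; rewrite size_mkseq /heavy /= => ->. Qed.

Lemma mass_light lam n (x : Sigma) : ~ heavy L P lam n x ->
  (P (ball L x n) <= (expR (- (lam * n%:R)))%:E)%E.
Proof. by move=> /negP; rewrite -leNgt massE lee_fin. Qed.

Let le_heavy (C Bad : set (borel_Sigma m1 m2)) (B : set (borel_Sigma m1 m2)) :
  measurable C -> measurable Bad -> measurable B -> C `<=` B ->
  (P (C `\` Bad) <= P B)%E.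
Proof.
move=> mC mBad mB CB; apply: le_measure; rewrite ?inE //; first exact: measurableD.
by move=> y [/CB].
Qed.

(* A set U with m1^-(n+1) < diam U <= m1^-n lies in a ball of level n, which is
   either inside the removed set or light.  For diam U = 0 the ball is taken at
   level N, or shrunk to a point, according as s = 0 or not. *)
Lemma light_cover (s : R) N (U : set Sigma) : 0 <= s ->
  (diam (@dist R m1 m2) U <= (expR (- (N%:R * lm)))%:E)%E ->
  exists C : set (borel_Sigma m1 m2), [/\ measurable C, U `<=` C &
    (P (C `\` \bigcup_(n in [set n | (N <= n)%N]) heavy L P (s * lm) n) <=
     (expR (s * lm))%:E * gauge (@dist R m1 m2) s U)%E].
Proof.
move=> s0 dU; set Bad := \bigcup_(n in _) _.
have mBad : measurable Bad by apply: bigcup_measurable => n _; exact: measurable_heavy.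
have mB x n : measurable (ball L x n : set (borel_Sigma m1 m2)) by exact: measurable_cylinder.
have [->|/set0P Une] := eqVneq U set0.
  exists set0; split=> //; rewrite set0D measure0 mule_ge0 ?lee_fin ?expR_ge0 //.
  exact: gauge_ge0.
have [x Ux] := Une.
have dU0 := diam_ge0 R Une.
have gaugeE : gauge (@dist R m1 m2) s U = (diam (@dist R m1 m2) U `^ s)%E.
  by rewrite /gauge; case: asboolP => // U0; case: Une => y; rewrite U0.
have dfin : diam (@dist R m1 m2) U \is a fin_num.
  by rewrite ge0_fin_numE //; apply: le_lt_trans dU _; exact: ltry.
set r := fine (diam (@dist R m1 m2) U).
have dr : diam (@dist R m1 m2) U = r%:E by rewrite fineK.
have r0 : 0 <= r by rewrite fine_ge0.
have rN : r <= expR (- (N%:R * lm)) by rewrite -lee_fin -dr.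
have Uball n : r <= expR (- (n%:R * lm)) -> U `<=` ball L x n.
  move=> rn y Uy; apply/(ballP m2_gt1 m21 L_bound L_lt); apply: le_trans rn.
  by rewrite -lee_fin -dr; exact: dist_diam.
(* The whole ball of a heavy point is heavy, so from level [N] on it lies in the removed set. *)
have PleI n : (N <= n)%N -> heavy L P (s * lm) n x ->
    forall C : set (borel_Sigma m1 m2), C `<=` ball L x n -> P (C `\` Bad) = 0%E.
  move=> Nn hx C CB; rewrite (_ : C `\` Bad = set0) ?measure0 //.
  apply/seteqP; split=> // y [/CB /heavy_ball hy nBad]; apply: nBad.
  by exists n => //; exact: hy.
rewrite gaugeE dr poweR_EFin -EFinM.
move: r0; rewrite le_eqVlt => /orP[/eqP r0|r0]; last first.
  pose n := Num.trunc (- ln r / lm).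
  have lr : N%:R <= - ln r / lm.
    by rewrite ler_pdivlMr // lerNr -ler_expR lnK ?posrE.
  have /andP[n1 n2] := truncn_itv (le_trans (ler0n _ N) lr).
  rewrite -/n in n1 n2.
  have Nn : (N <= n)%N by rewrite -ltnS -(ltr_nat R); apply: le_lt_trans n2.
  have rn : r <= expR (- (n%:R * lm)).
    by rewrite -[leLHS]lnK ?posrE // ler_expR lerNr -ler_pdivlMr.
  exists (ball L x n); split=> //; first exact: Uball.
  have [hx|hx] := pselect (heavy L P (s * lm) n x).
    by rewrite (PleI n) // lee_fin mulr_ge0 ?expR_ge0 ?powR_ge0.
  apply: le_trans (le_heavy _ mBad _ (@subset_refl _ _)) _ => //.
  apply: le_trans (mass_light hx) _; rewrite lee_fin /powR gt_eqF // -expRD ler_expR.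
  move: n2; rewrite -natr1 ltr_pdivrMr // => n2.
  have : 0 <= s * (lm * (n%:R + 1) + ln r).
    by rewrite mulr_ge0 // -lerBlDr sub0r mulrC ltW.
  by move: (ln r) => a; lra.
have Un n : U `<=` ball L x n by apply: Uball; rewrite -r0 expR_ge0.
move: s0; rewrite le_eqVlt => /orP[/eqP s0|s0].
  exists (ball L x N); split=> //.
  rewrite -s0 mul0r expR0 powRr0 mulr1; apply: probability_le1.
  exact: measurableD.
exists (\bigcap_n ball L x n); split.
- by apply: bigcapT_measurable.
- by move=> y Uy n _; exact: Un.
have [[n Nn hx]|hx] := pselect (exists2 n, (N <= n)%N & heavy L P (s * lm) n x).
  rewrite (PleI n) // ?lee_fin ?mulr_ge0 ?expR_ge0 ?powR_ge0 //.
  by move=> y /(_ n Logic.I).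
rewrite -r0 powR0 ?gt_eqF // mulr0.
apply/lee_addgt0Pr => e e0; rewrite add0e.
pose n := maxn N (Num.bound `|- ln e / (s * lm)|).
apply: le_trans (_ : (P (ball L x n) <= _)%E).
  by apply: le_heavy => //; [exact: bigcapT_measurable | move=> y /(_ n Logic.I)].
have hn : ~ heavy L P (s * lm) n x by move=> hn; apply: hx; exists n => //; exact: leq_maxl.
apply: le_trans (mass_light hn) _; rewrite lee_fin -[leRHS]lnK ?posrE // ler_expR.
rewrite lerNl mulrC -ler_pdivrMr ?mulr_gt0 //.
apply: le_trans (ler_norm _) _; apply: (@le_trans _ _ (Num.bound `|- ln e / (s * lm)|)%:R).
  by rewrite ltW // archi_boundP.
by rewrite ler_nat leq_maxr.
Qed.

(** If some s < kap / lm were admissible for [E], the union of the heavy sets of levels at least N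
    would have probability at most e / 2, and a cover of [E] with small gauges would carry at most e
    / 2 outside of it. *)
Lemma dim_set_ge (kap : R) :
  (forall lam, lam < kap -> exists c K : R, 0 < c /\ forall n,
     fine (P (heavy L P lam n)) <= expR (K - c * n%:R)) ->
  forall E : set (borel_Sigma m1 m2), measurable E -> (0 < P E)%E ->
  ((kap / lm)%:E <= dim_set R (E : set Sigma))%E.
Proof.
move=> h E mE PE; apply: le_ereal_inf_tmp => _ [s [s0 Hs] <-].
rewrite lee_fin leNgt; apply/negP; rewrite ltr_pdivlMr // => sk.
have [c [K [c0 hK]]] := h _ sk.
suff : (P E <= 0)%E by rewrite leNgt PE.
apply/lee_addgt0Pr => e e0; rewrite add0e.
have e2 : 0 < e / 2 by rewrite divr_gt0.
have [N hN] := exp_tail K c0 e2.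
pose F n : set (borel_Sigma m1 m2) := if (N <= n)%N then heavy L P (s * lm) n else set0.
have mF n : measurable (F n) by rewrite /F; case: ifP => // _; exact: measurable_heavy.
set Bad := \bigcup_(n in [set n | (N <= n)%N]) heavy L P (s * lm) n.
have mBad : measurable Bad by apply: bigcup_measurable => n _; exact: measurable_heavy.
have PBad : (P Bad <= (e / 2)%:E)%E.
  have sub : Bad `<=` \bigcup_n F n by move=> y [n /= Nn hy]; exists n => //; rewrite /F Nn.
  apply: le_trans (measure_sigma_subadditive P mF mBad sub) _.
  apply: le_trans hN; apply: lee_nneseries => // n _; rewrite /F.
  case: ifP => _; last by rewrite measure0.
  have := hK n; rewrite -lee_fin -(fine_probability P); first by [].
  exact: measurable_heavy.
have : (hausdorff_premeasure (@dist R m1 m2) s (expR (- (N%:R * lm))) E <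
    (e / 2 / expR (s * lm))%:E)%E.
  apply: (@le_lt_trans _ _ 0%E); last by rewrite lte_fin divr_gt0 // expR_gt0.
  rewrite -Hs; apply: ereal_sup_ubound; exists (expR (- (N%:R * lm))) => //=.
  exact: expR_gt0.
move=> /ereal_inf_lt [_ [U [EU dU] <-]] sumU.
(* Covering sets are arbitrary; they are replaced by measurable ones. *)
have /choice [C hC] k := light_cover s0 (dU k).
have mD : measurable (\bigcup_k (C k `\` Bad)).
  by apply: bigcupT_measurable => k; apply: measurableD => //; have [] := hC k.
have PD : (P (\bigcup_k (C k `\` Bad)) <= (e / 2)%:E)%E.
  have mk k : measurable (C k `\` Bad) by apply: measurableD => //; have [] := hC k.
  apply: le_trans (generalized_Boole_inequality P mk mD) _.
  apply: (@le_trans _ _ (\sum_(0 <= k <oo) (expR (s * lm))%:E *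
      gauge (@dist R m1 m2) s (U k))%E).
    by apply: lee_nneseries => // k _; have [] := hC k.
  rewrite nneseriesZl; last by move=> k _; exact: gauge_ge0.
  apply: le_trans (lee_wpmul2l _ (ltW sumU)) _; first by rewrite lee_fin expR_ge0.
  by rewrite -EFinM lee_fin mulrC divfK // gt_eqF // expR_gt0.
apply: (@le_trans _ _ (P (Bad `|` \bigcup_k (C k `\` Bad)))).
  apply: le_measure; rewrite ?inE //; first exact: measurableU.
  move=> y /EU [k _ Uy]; have [yB|yB] := pselect (Bad y); [left => // | right].
  by exists k => //; split=> //; have [_ sub _] := hC k; exact: sub.
apply: le_trans (measureU2 _ mBad mD) _.
by rewrite [e]splitr EFinD; exact: leeD.
Qed.

End LowerBound.

(** * The variational principle *)

Section Variational.
Context (R : realType) (q m1 m2 j : nat).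
Context (Omega : set (Sigma m1 m2)) (t : word m1 m2 -> R).
Local Notation A := (letter m1 * letter m2)%type.
Local Notation Sigma := (Sigma m1 m2).
Local Notation proba := (probability (borel_Sigma m1 m2) R).
Local Notation g := (gamma R m1 m2).
Local Notation lm := (ln (m1%:R : R)).
Local Notation ln_t := (ln_t j t).
Local Notation ln_x := (ln_x j Omega t).
Local Notation ln_den := (ln_den q j Omega t).
Local Notation ln_num := (ln_num q j Omega t).
Local Notation t0 := (t_empty q j Omega t).
Hypothesis q_gt1 : (1 < q)%N.
Hypothesis m2_gt1 : (2 <= m2)%N.
Hypothesis m21 : (m2 < m1)%N.
Hypothesis q_j : q%:R ^+ j <= g^-1 < q%:R ^+ j.+1.
Hypothesis Omega0 : Omega !=set0.
Hypothesis closedOmega : closed Omega.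
Hypothesis ht : is_t q j Omega t.

Let g_gt0 : 0 < g. Proof. exact: gamma_gt0. Qed.
Let qj_gt0 : 0 < q%:R ^+ j :> R.
Proof. by rewrite exprn_gt0 // ltr0n ltnW. Qed.
Let e1_gt0 : 0 < q%:R ^+ j * g. Proof. exact: mulr_gt0. Qed.

Lemma ys_word_agree (s s' : Sigma) p l :
  agree (p + l) s s' -> ys_word s p l = ys_word s' p l.
Proof.
move=> h; apply: (@eq_from_nth _ ord0) => [|k]; rewrite !size_mkseq // => kl.
by rewrite !nth_mkseq // h // ltn_add2l.
Qed.

Lemma ln_t_dep r : depends (r + j.+1) (ln_t^~ r).
Proof.
move=> s s' h; rewrite /ln_t /prefix_word (@ys_word_agree s s' r.+1) ?addSnnS //.
suff -> : mkseq s r.+1 = mkseq s' r.+1 by [].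
by apply/agree_mkseq/(agree_le _ h); rewrite -addSnnS leq_addr.
Qed.

Lemma ln_x_dep r : depends (r + j.+1) (ln_x^~ r).
Proof.
move=> s s' h; rewrite /ln_x /sum_xs (ys_word_agree h).
suff -> : mkseq s r = mkseq s' r by [].
by apply/agree_mkseq/(agree_le _ h); rewrite leq_addr.
Qed.

Lemma ln_den_dep a : depends a (ln_den^~ a).
Proof.
move=> s s' h; rewrite /ln_den; case: ifPn => [aj|]; first by rewrite (@ys_word_agree s s' 0).
by rewrite -ltnNge => ja; congr (_ * _); apply: ln_t_dep; rewrite subnK.
Qed.

Lemma ln_num_dep a : depends a.+1 (ln_num^~ a).
Proof.
move=> s s' h; rewrite /ln_num; case: ifPn => [aj|]; first by rewrite (ln_den_dep h).
by rewrite -leqNgt => ja; congr (_ * _); apply: ln_x_dep; rewrite addnS subnK.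
Qed.

Let C : R := m2%:R `^ (2 / (g * (q%:R - 1))).
Let card1 : R := #|{: letter m1}|%:R.

Lemma ln_bound (x K : R) : 1 <= x <= K -> `|ln x| <= ln K.
Proof.
move=> /andP[x1 xK]; have x0 : 0 < x by exact: lt_le_trans x1.
rewrite ger0_norm ?ln_ge0 // ler_ln ?posrE //; exact: lt_le_trans xK.
Qed.

Lemma ln_t_bound s r : Omega s -> `|ln_t s r| <= ln C.
Proof. by move=> Os; apply: ln_bound; have [] := t_prefix_word ht r Os. Qed.

Lemma ln_x_bound s r : Omega s -> `|ln_x s r| <= ln (card1 * C).
Proof.
move=> Os; apply: ln_bound; rewrite (sum_xs_ge1 ht) //= sum_xsE.
apply: (@le_trans _ _ (\sum_(x : letter m1) C)); last first.
  by rewrite sumr_const /card1 mulr_natl.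
rewrite [leLHS]big_mkcond; apply: ler_sum => x _; case: ifP => h; last exact: powR_ge0.
have [s' Os' e] := prefix_wordP h; have [/andP[_]] := t_prefix_word ht r Os'.
by move: e; rewrite /= size_rcons !size_mkseq => ->.
Qed.

(** A crude uniform bound, available because there are finitely many words of length at most j. *)
Let den_head : R :=
  \sum_(a < j.+1) \sum_(z : a.-tuple (letter m2)) `|ln (W_ q j Omega t a z)|.

Lemma ln_den_head_bound (s : Sigma) a : (a <= j)%N ->
  `|ln (W_ q j Omega t a (ys_word s 0 a))| <= den_head.
Proof.
move=> aj; have aj' : (a < j.+1)%N by [].
rewrite /den_head (bigD1 (Ordinal aj')) //=.
have hz : size (ys_word s 0 a) == a by rewrite size_mkseq.
rewrite (bigD1 (Tuple hz)) //= -addrA lerDl addr_ge0 ?sumr_ge0 // => k _.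
exact: sumr_ge0.
Qed.

Lemma ln_bounds : exists M : R, forall s r, Omega s ->
  [/\ `|ln_t s r| <= M, `|ln_x s r| <= M, `|ln_den s r| <= M & `|ln_num s r| <= M].
Proof.
have e2_ge0 : 0 <= q%:R ^+ j.+1 * g by rewrite exprS -mulrA mulr_ge0 // ltW.
have [s0 Os0] := Omega0.
have C0 : 0 <= ln C by apply: le_trans (ln_t_bound 0 Os0).
have X0 : 0 <= ln (card1 * C) by apply: le_trans (ln_x_bound 0 Os0).
have D0 : 0 <= den_head by apply: sumr_ge0 => k _; exact: sumr_ge0.
have e2C : 0 <= q%:R ^+ j.+1 * g * ln C by exact: mulr_ge0.
have e1X : 0 <= q%:R ^+ j * g * ln (card1 * C) by apply: mulr_ge0 => //; exact: ltW.
have hden s a : Omega s -> `|ln_den s a| <= den_head + q%:R ^+ j.+1 * g * ln C.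
  move=> Os; rewrite /ln_den; case: ifPn => [aj|_].
    by apply: le_trans (ln_den_head_bound s aj) _; rewrite lerDl.
  rewrite normrM (ger0_norm e2_ge0).
  by apply: le_trans (ler_wpM2l e2_ge0 (ln_t_bound _ Os)) _; rewrite lerDr.
exists (ln C + ln (card1 * C) + den_head + q%:R ^+ j.+1 * g * ln C +
  q%:R ^+ j * g * ln (card1 * C)) => s r Os; split.
- by apply: le_trans (ln_t_bound _ Os) _; lra.
- by apply: le_trans (ln_x_bound _ Os) _; lra.
- by apply: le_trans (hden s r Os) _; lra.
rewrite /ln_num; case: ifPn => [_|_].
  have h := hden s r.+1 Os; rewrite normrM (@ger0_norm _ q%:R^-1) ?invr_ge0 //.
  apply: (@le_trans _ _ `|ln_den s r.+1|); last by apply: le_trans h _; lra.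
  by rewrite ler_piMr // invf_le1 ?ler1n ?ltr0n ltnW.
rewrite normrM (ger0_norm (ltW e1_gt0)).
by apply: le_trans (ler_wpM2l (ltW e1_gt0) (ln_x_bound _ Os)) _; lra.
Qed.

(* L n is the number of y letters fixed by a ball of radius m1 ^ (-n). *)
Let L n := `|Num.ceil (n%:R / g : R)|%N.

Let L_ceil n : n%:R / g <= (L n)%:R /\ (L n)%:R < n%:R / g + 1.
Proof.
have x0 : 0 <= n%:R / g by rewrite divr_ge0 // ltW.
have -> : (L n)%:R = (Num.ceil (n%:R / g : R))%:~R :> R.
  by rewrite -[LHS]/(((L n)%:Z)%:~R) /L gez0_abs // -(ler0z R); apply: le_trans (ceil_ge _).
split; first exact: ceil_ge.
by have := ceilB1_lt (n%:R / g : R); rewrite intrB ltrBlDr.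
Qed.

Let L_lb n : n%:R / g <= (L n)%:R := (L_ceil n).1.
Let L_ub n : (L n)%:R < n%:R / g + 1 := (L_ceil n).2.

Let L_bound n : n%:R / g <= (L n)%:R <= n%:R / g + 1.
Proof. by rewrite L_lb ltW ?L_ub. Qed.

Let L_ge n : (q ^ j * n <= L n)%N.
Proof.
have /andP[h _] := q_j; rewrite -(ler_nat R) natrM natrX; apply: le_trans (L_lb n).
by rewrite mulrC ler_wpM2l.
Qed.

(** As g < 1, n / g + 1 <= (n + 1) / g. *)
Let L_lt n : (L n < q ^ j.+1 * n.+1)%N.
Proof.
have /andP[_ h] := q_j; have g1 : 1 < g^-1 by rewrite invf_gt1 // gamma_lt1.
rewrite -(ltr_nat R) natrM natrX; apply: lt_le_trans (L_ub n) _.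
apply: (@le_trans _ _ (n.+1%:R / g)); last by rewrite mulrC ler_wpM2r // ltW.
by rewrite -natr1 mulrDl mul1r lerD2l ltW.
Qed.

Let d0 : R := ln t0.
(** The growth rate of the entropy in natural logarithms; radii being m1^-n, division by ln m1 gives
    the dimension. *)
Let kap : R := (1 - q%:R^-1) * d0 / g.
Let dim : R := (q%:R - 1) / q%:R * (ln t0 / ln m2%:R).

Let lm_pos : 0 < lm. Proof. exact: (lm_gt0 R m2_gt1 m21). Qed.

Let kap_dim : kap = dim * lm.
Proof.
have l2 : 0 < ln m2%:R :> R by rewrite ln_gt0 // ltr1n.
rewrite /kap /dim /d0 /gamma; field.
by rewrite !gt_eqF ?ltr0n // ltnW.
Qed.

Section Tree.
Context (mu : proba).
Hypothesis mu_node : forall w z, (size z <= j)%N ->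
  mass mu (w, z) = node_sum q j Omega t (j - size z) w z.

Lemma ln_mass_chain s p p' : Omega s -> chain_type j p p' ->
  0 < mass mu (prefix_word s p (p' - p)) /\
  ln (mass mu (prefix_word s p (p' - p))) =
    \sum_(0 <= r < p) (ln_t s r - ln_x s r) +
    \sum_(0 <= a < p') (ln_num s a - ln_den s a).
Proof.
move=> Os /or3P[/andP[p0 /eqP->]|/eqP->|/andP[/eqP-> p'j]].
- by rewrite addKn; exact: (ln_mass_eq q_gt1 Omega0 ht e1_gt0 mu_node Os p0).
- by rewrite addKn; exact: (ln_mass_next q_gt1 Omega0 ht e1_gt0 mu_node p Os).
- by rewrite subn0; exact: (ln_mass_head q_gt1 Omega0 ht e1_gt0 mu_node Os p'j).
Qed.

Let den_ge s a : ln_den s (a + j.+1)%N = q%:R ^+ j.+1 * g * ln_t s a.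
Proof. by rewrite -addSnnS; exact: ln_den_gt. Qed.

Let num_lt s a : (a < j)%N -> ln_num s a = ln_den s a.+1 / q%:R.
Proof. by rewrite /ln_num => ->. Qed.

Let num_ge s a : ln_num s (a + j)%N = q%:R ^+ j * g * ln_x s a.
Proof. exact: ln_num_ge. Qed.

Let den0 s : ln_den s 0%N = d0. Proof. by []. Qed.

Section Competitor.
Context (nu P : proba) (nuO : supported_on Omega nu) (nuP : is_P q nu P).

Lemma dim_measure_le_dim : (dim_measure P <= dim%:E)%E.
Proof.
have [M hM] := ln_bounds.
apply/lee_addgt0Pr => e e0.
have e2 : 0 < e * lm / 2 by rewrite divr_gt0 // mulr_gt0.
have [K hK] := entropy_le q_gt1 g_gt0 L_bound L_ge L_lt closedOmega nuO nuP
  ln_t_dep ln_x_dep ln_den_dep ln_num_dep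
  (fun s r Os => let: And4 h _ _ _ := hM s r Os in h)
  (fun s r Os => let: And4 _ h _ _ := hM s r Os in h)
  (fun s r Os => let: And4 _ _ h _ := hM s r Os in h)
  (fun s r Os => let: And4 _ _ _ h := hM s r Os in h)
  den_ge num_lt num_ge den0 ln_mass_chain e2.
rewrite -EFinD; apply: (dim_measure_le m2_gt1 m21 L_lb L_ub hK).
by rewrite -/kap kap_dim mulrDl ltrD2l ltr_pdivrMr // ltr_pMr ?mulr_gt0 // ltr1n.
Qed.

(** By [same_mass_node] a difference shows on a word with j trailing y-letters. [entropy_lt] then
    lowers the rate by [c], half of which is spent on the strict inequality that [dim_measure_le]
    requires. *)
Lemma dim_measure_lt_dim : ~ same_measure nu mu -> (dim_measure P < dim%:E)%E.
Proof.
move=> ne; have [M hM] := ln_bounds; have /andP[_ qj1] := q_j.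
have [[w z] /= [w0 zj hwz]] : exists wz : word m1 m2,
    [/\ (0 < size wz.1)%N, size wz.2 = j & mass nu wz <> mass mu wz].
  apply: contrapT => h; apply: ne; apply: (@same_mass_node _ _ _ j) => w z w0 zj.
  by apply: contrapT => hwz; apply: h; exists (w, z).
have [c [K [c0 hK]]] := entropy_lt q_gt1 g_gt0 L_bound L_ge L_lt closedOmega nuO nuP
  ln_t_dep ln_x_dep ln_den_dep ln_num_dep
  (fun s r Os => let: And4 h _ _ _ := hM s r Os in h)
  (fun s r Os => let: And4 _ h _ _ := hM s r Os in h)
  (fun s r Os => let: And4 _ _ h _ := hM s r Os in h)
  (fun s r Os => let: And4 _ _ _ h := hM s r Os in h)
  den_ge num_lt num_ge den0 ln_mass_chain qj1 w0 zj hwz.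
apply: (@le_lt_trans _ _ (dim - c / 2 / lm)%:E).
  apply: (dim_measure_le m2_gt1 m21 L_lb L_ub hK).
  rewrite -/kap kap_dim mulrBl divfK ?gt_eqF // ltrD2l ltrN2 ltr_pdivrMr //.
  by rewrite ltr_pMr // ltr1n.
by rewrite lte_fin ltrBlDr ltrDl !divr_gt0.
Qed.

End Competitor.

Lemma dim_set_ge_dim (P : proba) : is_P q mu P ->
  forall E : set (borel_Sigma m1 m2), measurable E -> (0 < P E)%E ->
  (dim%:E <= dim_set R (E : set Sigma))%E.
Proof.
move=> muP E mE PE; have [M hM] := ln_bounds.
have muO := optimal_supported closedOmega mu_node.
have -> : dim = kap / lm by rewrite kap_dim mulfK // gt_eqF.
apply: (dim_set_ge m2_gt1 m21 L_lb L_ub _ mE PE) => lam hlam.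
have [c [K [c0 hK]]] := exp_moment q_gt1 g_gt0 L_bound L_ge L_lt closedOmega muO muP
  ln_t_dep ln_x_dep ln_den_dep ln_num_dep
  (fun s r Os => let: And4 h _ _ _ := hM s r Os in h)
  (fun s r Os => let: And4 _ h _ _ := hM s r Os in h)
  (fun s r Os => let: And4 _ _ h _ := hM s r Os in h)
  (fun s r Os => let: And4 _ _ _ h := hM s r Os in h)
  den_ge num_lt num_ge den0 ln_mass_chain hlam.
exists c, K; split=> // n; apply: le_trans (hK n).
rewrite heavy_mass; apply: ler_sum => w _.
by rewrite (mass_P_ball q_gt1 muP n (val w)) ?size_tuple.
Qed.

Lemma dim_measure_optimal (P : proba) : is_P q mu P -> dim_measure P = dim%:E.
Proof.
move=> muP; apply/eqP; rewrite eq_le.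
rewrite (dim_measure_le_dim (optimal_supported closedOmega mu_node) muP) /=.
by apply: le_ereal_inf_tmp => _ [E [mE PE] <-]; exact: dim_set_ge_dim PE.
Qed.

Lemma dim_X_Omega_ge : (dim%:E <= dim_set R (X_Omega q Omega))%E.
Proof.
apply: (dim_set_ge_dim (P_P q_gt1 mu)); first exact: measurable_X_Omega.
rewrite (P_X_Omega q_gt1 (P_P q_gt1 mu) closedOmega) //.
exact: optimal_supported mu_node.
Qed.

End Tree.
End Variational.

Theorem proposition2p7 (R : realType) (q m1 m2 j : nat)
    (Omega : set (Sigma m1 m2)) (t : word m1 m2 -> R)
    (hq : (2 <= q)%N) (hm2 : (2 <= m2)%N) (hm : (m2 < m1)%N)
    (hj : q%:R ^+ j <= (gamma R m1 m2)^-1 < q%:R ^+ j.+1)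
    (Omega0 : Omega !=set0) (closedOmega : closed Omega)
    (ht : is_t q j Omega t) :
  let dim := (q%:R - 1) / q%:R * (ln (t_empty q j Omega t) / ln m2%:R) in
  (exists mu : probability (borel_Sigma m1 m2) R,
    [/\ supported_on Omega mu /\ has_cylinder_masses q j Omega t mu,
        forall nu : probability (borel_Sigma m1 m2) R,
          supported_on Omega nu -> has_cylinder_masses q j Omega t nu ->
          same_measure nu mu,
        optimal q Omega mu,
        forall nu : probability (borel_Sigma m1 m2) R,
          optimal q Omega nu -> same_measure nu mu &
        dim_measure (P_ q mu) = dim%:E]) /\
  (dim%:E <= dim_set R (X_Omega q Omega))%E.
Proof.
move=> dim.
have [mu mu_node] : exists mu : probability (borel_Sigma m1 m2) R, forall w z,
    (size z <= j)%N -> mass mu (w, z) = node_sum q j Omega t (j - size z) w z.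
  apply: (optimal_tree_exists hq Omega0 ht).
  by rewrite mulr_gt0 ?exprn_gt0 ?ltr0n ?(ltnW hq) //; exact: gamma_gt0.
have muO := optimal_supported closedOmega mu_node.
have dim_mu P : is_P q mu P -> dim_measure P = dim%:E.
  exact: (dim_measure_optimal hq hm2 hm hj Omega0 closedOmega ht mu_node).
have dim_P := dim_mu _ (P_P hq mu).
split; last exact: (dim_X_Omega_ge hq hm2 hm hj Omega0 closedOmega ht mu_node).
exists mu; split=> //.
- split=> //; exact: optimal_has_masses mu_node.
- by move=> nu nuO; exact: has_masses_unique.
- split=> // nu nuO; rewrite dim_P.
  exact: (dim_measure_le_dim hq hm2 hm hj Omega0 closedOmega ht mu_node nuO (P_P hq nu)).
(* Another optimal measure would have dimension strictly below that of [mu]. *)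
- move=> nu [nuO nu_max]; apply: contrapT => ne.
  have := dim_measure_lt_dim hq hm2 hm hj Omega0 closedOmega ht mu_node nuO (P_P hq nu) ne.
  by rewrite ltNge -/dim -dim_P nu_max.
Qed.
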